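(* Let $m$ be a positive integer and let $K\neq 2^{[m]}$ be an abstract simplicial complex on $[m]$ (ghost vertices allowed). Then the Bier sphere $\mathrm{Bier}(K)$ is flag if and only if it is polytopal with the corresponding simple polytope $P_K$ being (up to combinatorial equivalence) a flag nestohedron of one of the following types: (1) $P_K=I^n$ for $n\ge 1$; (2) $P_K=I^n\times P_5$ for $n\ge 0$; (3) $P_K=I^n\times P_6$ for $n\ge 0$; (4) $P_K=I^n\times Q_2^3$ for $n\ge 0$.
   Context: $[m]=\{1,\dots,m\}$, $[m']=\{1',\dots,m'\}$ is a disjoint copy, and for $I\subseteq[m]$, $I'=\{i' : i\in I\}$. A simplicial complex on $[m]$ is a set $K\subseteq 2^{[m]}$ containing $\varnothing$ and closed under taking subsets; $i$ is a ghost vertex if $\{i\}\notin K$. A minimal non-face is an inclusion-minimal subset of the ground set not in $K$. $K$ is flag if all its minimal non-faces have cardinality $\le 2$ (ghost vertices, i.e. minimal non-faces of cardinality 1, are allowed). For $K\ne 2^{[m]}$ the Alexander dual is the simplicial complex $K^\vee$ on $[m']$ given by $K^\vee=\{J' : J\subseteq [m],\ [m]\setminus J\notin K\}$. The Bier sphere is the simplicial complex on $[m]\sqcup[m']$ $$\mathrm{Bier}(K)=\{I\sqcup J' : I\in K,\ J'\in K^\vee,\ I\cap J=\varnothing\};$$ it is a sphere of dimension $m-2$. A simplicial complex is polytopal if it is isomorphic (disregarding ghost vertices) to the boundary complex of a simplicial polytope $Q$; if $\mathrm{Bier}(K)$ is polytopal, $P_K$ denotes the simple polytope dual to $Q$ (so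 $\mathrm{Bier}(K)=\partial P_K^*$), considered up to combinatorial equivalence. A simple polytope is flag if the boundary complex of its dual simplicial polytope is flag. $I^n$ is the $n$-cube; $P_k$ is the $k$-gon; $Q_2^3$ is the simple 3-polytope obtained from the 3-cube $I^3$ by two adjacent edge cuts: if $F_1,F_2,F_3$ are three facets of $I^3$ sharing a vertex, one first cuts off the edge $F_1\cap F_2$ by a hyperplane in general position, and then cuts off the (remaining part of the) edge $F_2\cap F_3$. A building set on $[n+1]$ is a collection $\mathcal B$ of nonempty subsets of $[n+1]$ containing all singletons and such that $S,T\in\mathcal B$, $S\cap T\ne\varnothing$ imply $S\cup T\in\mathcal B$; it is connected if $[n+1]\in\mathcal B$. An $n$-dimensional nestohedron is a polytope combinatorially equivalent to the Minkowski sum $\sum_{S\in\mathcal B}\mathrm{conv}\{e_i : i\in S\}\subset\mathbb R^{n+1}$ for a connected building set $\mathcal B$ on $[n+1]$ (it is a simple polytope).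
   Formalization: For m = 1 the only K is {∅}, Bier(K) = {∅} is flag and P_K is a point, which is none of the listed types; so in type (1) the condition n ≥ 1 is required only for m ≥ 2, and P_K = I^0 is also allowed when m = 1. *)

(* Defs.v *)
From HB Require Import structures.
From mathcomp Require Import all_boot all_order all_algebra.
From mathcomp Require Import finmap.
From mathcomp Require Import boolp classical_sets functions cardinality reals.

Set Implicit Arguments.
Unset Strict Implicit.
Unset Printing Implicit Defensive.

Import Order.TTheory GRing.Theory Num.Theory.

Local Open Scope ring_scope.
Local Open Scope classical_set_scope.

Section SimplicialComplexes.
Variable V : finType.
Implicit Types K : {set {set V}}.

Definition simplicial_complex K : Prop :=
  finset.set0 \in K /\
  forall A B : {set V}, A \in K -> B \subset A -> B \in K.

Definition ghost K (v : V) : bool := [set v]%SET \notin K.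

Definition minimal_nonface K (A : {set V}) : bool :=
  minset (fun B : {set V} => B \notin K) A.

Definition flag_complex K : Prop :=
  forall A : {set V}, minimal_nonface K A -> (#|A| <= 2)%N.

Definition alexander_dual K : {set {set V}} :=
  [set J : {set V} | (~: J)%SET \notin K]%SET.

(* [V + V] is the disjoint union of the ground set and its primed copy; the
   Alexander dual is transported to the second summand along [inr]. *)
Definition bier K : {set {set V + V}} :=
  [set ((inl @: (I : {set V})) :|: (inr @: (J : {set V})))%SET
    | I in K, J in alexander_dual K & (I :&: J == finset.set0)%SET]%SET.

End SimplicialComplexes.

(* Isomorphism disregarding ghost vertices: a bijection between the non-ghost
   vertices that preserves and reflects membership in the complexes. *)
Definition complex_iso (V W : finType) (K : {set {set V}}) (L : {set {set W}}) :
    Prop :=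
  exists2 f : {v : V | ~~ ghost K v} -> {w : W | ~~ ghost L w},
    bijective f &
    forall A : {set {v : V | ~~ ghost K v}},
      ([set val v | v in A]%SET \in K) = ([set val (f v) | v in A]%SET \in L).

Section Polytopes.
Variable R : realType.

Definition conv_hull (d : nat) (A : set 'rV[R]_d) : set 'rV[R]_d :=
  [set x | exists (k : nat) (v : 'I_k -> 'rV[R]_d) (a : 'I_k -> R),
     [/\ forall i, A (v i), forall i, 0 <= a i, \sum_i a i = 1
       & x = \sum_i a i *: v i]].

Definition polytope (d : nat) (P : set 'rV[R]_d) : Prop :=
  exists A : set 'rV[R]_d, [/\ finite_set A, A !=set0 & P = conv_hull A].

(* The linear functional [c = 0] gives the improper faces [set0] and [P]. *)
Definition faces (d : nat) (P : set 'rV[R]_d) : set (set 'rV[R]_d) :=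
  [set F | exists (c : 'cV[R]_d) (b : R),
     (forall x, P x -> (x *m c) 0 0 <= b) /\
     F = P `&` [set x | (x *m c) 0 0 = b]].

Definition vertices (d : nat) (P : set 'rV[R]_d) : set 'rV[R]_d :=
  [set v | faces P [set v]].

Definition facet (d : nat) (P F : set 'rV[R]_d) : Prop :=
  [/\ faces P F, F <> P &
    forall G, faces P G -> G <> P -> F `<=` G -> G = F].

Definition affinely_independent (d k : nat) (v : 'I_k -> 'rV[R]_d) : Prop :=
  forall a : 'I_k -> R,
    \sum_i a i = 0 -> \sum_i a i *: v i = 0 -> forall i, a i = 0.

(* [k = 0] is allowed: the empty face is the (-1)-dimensional simplex. *)
Definition simplex (d : nat) (F : set 'rV[R]_d) : Prop :=
  exists (k : nat) (v : 'I_k -> 'rV[R]_d),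
    affinely_independent v /\ F = conv_hull (range v).

Definition simplicial_polytope (d : nat) (Q : set 'rV[R]_d) : Prop :=
  polytope Q /\ forall F, faces Q F -> F <> Q -> simplex F.

(* A polytope has finitely many vertices, so [fset_set (vertices Q)] is its
   vertex set; the simplices are the vertex sets of the proper faces. *)
Definition boundary_complex (d : nat) (Q : set 'rV[R]_d) :
    {set {set fset_set (vertices Q)}} :=
  [set A : {set fset_set (vertices Q)} |
    `[< exists F, [/\ faces Q F, F <> Q &
          forall v : fset_set (vertices Q), v \in A <-> F (fsval v)] >]]%SET.

Definition comb_equiv (d e : nat) (P : set 'rV[R]_d) (P' : set 'rV[R]_e) :
    Prop :=
  exists2 f : set 'rV[R]_d -> set 'rV[R]_e,
    set_bij (faces P) (faces P') f &
    forall F G, faces P F -> faces P G -> (F `<=` G <-> f F `<=` f G).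

Definition dual_polytopes (d e : nat) (P : set 'rV[R]_d) (Q : set 'rV[R]_e) :
    Prop :=
  exists2 f : set 'rV[R]_d -> set 'rV[R]_e,
    set_bij (faces P) (faces Q) f &
    forall F G, faces P F -> faces P G -> (F `<=` G <-> f G `<=` f F).

Definition polytopal (V : finType) (K : {set {set V}}) : Prop :=
  exists (d : nat) (Q : set 'rV[R]_d),
    simplicial_polytope Q /\ complex_iso K (boundary_complex Q).

(* [P] represents the combinatorial type of the simple polytope with
   [K = \partial P^*]; being dual to a simplicial polytope, it is simple. *)
Definition simple_polytope_of (V : finType) (K : {set {set V}}) (d : nat)
    (P : set 'rV[R]_d) : Prop :=
  polytope P /\
  exists (e : nat) (Q : set 'rV[R]_e),
    [/\ simplicial_polytope Q, complex_iso K (boundary_complex Q)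
      & dual_polytopes P Q].

Definition flag_polytope (d : nat) (P : set 'rV[R]_d) : Prop :=
  polytope P /\
  exists (e : nat) (Q : set 'rV[R]_e),
    [/\ simplicial_polytope Q, dual_polytopes P Q
      & flag_complex (boundary_complex Q)].

Definition cube (n : nat) : set 'rV[R]_n :=
  [set x | forall i, 0 <= x 0 i <= 1].

Definition polytope_prod (d e : nat) (P : set 'rV[R]_d) (P' : set 'rV[R]_e) :
    set 'rV[R]_(d + e) :=
  [set x | P (lsubmx x) /\ P' (rsubmx x)].

(* For [3 <= k] a polytope in the plane with [k] vertices is 2-dimensional. *)
Definition polygon (k : nat) (G : set 'rV[R]_2) : Prop :=
  polytope G /\ (vertices G #= `I_k)%card.

(* [P'] is obtained from [P] by cutting off the face [F] by a hyperplane in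
   general position: no vertex of [P] lies on the hyperplane, and the vertices
   of [P] that are cut off are exactly those of [F]. *)
Definition face_cut (d : nat) (P F P' : set 'rV[R]_d) : Prop :=
  faces P F /\
  exists (c : 'cV[R]_d) (b : R),
    [/\ forall v, vertices P v -> F v -> b < (v *m c) 0 0,
        forall v, vertices P v -> ~ F v -> (v *m c) 0 0 < b
      & P' = P `&` [set x | (x *m c) 0 0 <= b]].

Definition Q23 (Q : set 'rV[R]_3) : Prop :=
  exists F1 F2 F3 T : set 'rV[R]_3,
    [/\ [/\ facet (@cube 3) F1, facet (@cube 3) F2 & facet (@cube 3) F3],
        [/\ F1 <> F2, F2 <> F3 & F1 <> F3],
        exists2 v, vertices (@cube 3) v & (F1 `&` F2 `&` F3) v,
        face_cut (@cube 3) (F1 `&` F2) T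
      & face_cut T (F2 `&` F3 `&` T) Q].

End Polytopes.

Arguments cube R n : clear implicits.

Section Nestohedra.

(* The ground set is ['I_n.+1], and [B] is connected. *)
Definition connected_building_set (n : nat) (B : {set {set 'I_n.+1}}) : Prop :=
  [/\ finset.set0 \notin B,
      forall i, [set i]%SET \in B,
      forall S T : {set 'I_n.+1}, S \in B -> T \in B ->
        (S :&: T)%SET != finset.set0 -> (S :|: T)%SET \in B
    & [set: 'I_n.+1]%SET \in B].

Variable R : realType.

(* [delta_mx 0 i] is the [i]-th standard basis vector. *)
Definition face_of_standard_simplex (n : nat) (S : {set 'I_n.+1}) :
    set 'rV[R]_n.+1 :=
  conv_hull [set x | exists2 i, i \in S & x = delta_mx 0 i].

Definition minkowski_sum (n : nat) (B : {set {set 'I_n.+1}}) :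
    set 'rV[R]_n.+1 :=
  [set x | exists2 y : {set 'I_n.+1} -> 'rV[R]_n.+1,
     forall S, S \in B -> face_of_standard_simplex S (y S) &
     x = \sum_(S in B) y S].

Definition nestohedron (d : nat) (P : set 'rV[R]_d) : Prop :=
  polytope P /\
  exists (n : nat) (B : {set {set 'I_n.+1}}),
    connected_building_set B /\ comb_equiv P (minkowski_sum B).

End Nestohedra.

(* Main.v *)
(* The minimal non-faces of Bier(K) are those of K, those of its dual, and the pairs
   {i, i'}; those of the dual are the complements of the facets of K. So Bier(K)
   is flag iff K is the independence complex of a graph (loops being ghost
   vertices) all of whose minimal vertex covers have at most two elements. Apart
   from isolated vertices there are nine such graphs: a loop, two loops, an edge
   (giving cubes), a loop and an edge, a path with two edges (giving P_5), a
   triangle (giving P_6), a path with three edges, a 4-cycle and two disjoint edges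
   (giving Q_2^3); each isolated vertex suspends the sphere, that is, multiplies
   the simple polytope by an interval.

   On the polyhedral side, the nonempty faces of a polytope are determined by the
   sets of facet inequalities that are tight at its points. For a simple polytope
   these sets form the boundary complex of the polar dual, and a combinatorial
   type is identified by this complex alone. For a nestohedron they are read off
   from the linear functionals, without an inequality description. Conversely,
   flagness of the boundary complex depends only on the face lattice. *)
Require Import Defs.
From mathcomp Require Import all_boot all_order all_algebra.
From mathcomp Require Import finmap ring lra.
From mathcomp Require Import boolp classical_sets functions cardinality reals.

Set Implicit Arguments.
Unset Strict Implicit.
Unset Printing Implicit Defensive.

Import Order.TTheory GRing.Theory Num.Theory.

(** * Flag complexes *)

Section Flagness.
Local Open Scope nat_scope.
Variable V : finType.
Implicit Types (L : {set {set V}}) (e : rel V).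

(** All comparisons take place on the level of one relation. A flag complex is stored as [indep e],
    where a loop [e v v] makes [v] a ghost, and [realizes] tolerates inequalities that are never
    tight, which account for ghosts. So a polytope built for a small model also realizes the Bier
    sphere on its full vertex set, once the model embeds with only loops left over. A polytope and a
    building set are matched because they carry the same relation, facet by facet in the same order;
    no map between the two polytopes is built geometrically.

    The bound on minimal covers is used in the form that every independent set is missed by a cover
    with at most two vertices. It bounds degrees by two and rules out edges away from two disjoint
    ones.

    The unknown number of isolated vertices is split off symbolically: as the matching [cross_rel]
    on the sphere, as a cube factor of the polytope, and as iterated [prism] on building sets. What
    remains are finite statements on at most eight facets, turned into boolean tests on bit
    sequences and decided by computation. *)

Definition indep e : {set {set V}} :=
  [set A : {set V} | [forall x in A, forall y in A, ~~ e x y]]%SET.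

Lemma indepP e (A : {set V}) :
  reflect (forall x y, x \in A -> y \in A -> ~~ e x y) (A \in indep e).
Proof.
rewrite inE; apply: (iffP forall_inP) => [H x y xA yA|H x xA].
  by move/forall_inP: (H _ xA); apply.
by apply/forall_inP => y yA; apply: H.
Qed.

Lemma indep_complex e : simplicial_complex (indep e).
Proof.
split=> [|A B /indepP H /fintype.subsetP BA]; first by apply/indepP => x y; rewrite inE.
by apply/indepP => x y /BA xA /BA yA; apply: H.
Qed.

(** A non-face contains a minimal one, which has one or two elements because the empty set is a
    face. A one-element non-face is the pair with [y = x], so ghosts become loops. *)
Lemma flag_complex_indep L : simplicial_complex L -> flag_complex L ->
  L = indep (fun x y => [set x; y]%SET \notin L).
Proof.
move=> [L0 Lsub] flagL; apply/setP => A; apply/idP/indepP => [AL x y xA yA|H].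
  rewrite negbK; apply: Lsub AL _.
  by apply/fintype.subsetP => z; rewrite !inE => /orP[] /eqP->.
apply/negPn/negP => AL.
have [B minB BA] := minset_exists (P := fun C => C \notin L) AL.
have := flagL _ minB; have [BL _] := minsetP minB.
have B0 : B != finset.set0 by apply: contraNneq BL => ->.
have [x xB] := finset.set0Pn _ B0.
have xA := fintype.subsetP BA _ xB.
move=> /= cardB; have [y yB BE] : exists2 y, y \in B & B = [set x; y]%SET.
  have := cardsD1 x B; rewrite xB => cB.
  have [B1|[y yB1]] := set_0Vmem (B :\ x)%SET.
    exists x => //; apply/setP => z; rewrite !inE orbb.
    have := congr1 (fun C : {set V} => z \in C) B1; rewrite !inE.
    by case: eqVneq => [->|] //= _ ->.
  have yB : y \in B by move: yB1; rewrite !inE => /andP[].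
  exists y => //; apply/esym/eqP; rewrite eqEcard; apply/andP; split.
    by apply/fintype.subsetP => z; rewrite !inE => /orP[] /eqP->.
  by rewrite cards2; move: yB1; rewrite !inE => /andP[/negPf yx _]; rewrite eq_sym yx.
have yA := fintype.subsetP BA _ yB.
by have := H x y xA yA; rewrite -BE BL.
Qed.

End Flagness.

(** * Flagness under isomorphism up to ghost vertices *)

Section Transfer.
Local Open Scope nat_scope.

Lemma complex_iso_sym (V W : finType) (K : {set {set V}}) (L : {set {set W}}) :
  complex_iso K L -> complex_iso L K.
Proof.
move=> [f [g fK gK] H]; exists g; first by exists f.
move=> A; rewrite -[in LHS](_ : [set val (f v) | v in [set g a | a in A]]%SET =
    [set val v | v in A]%SET).
  rewrite -H; congr (_ \in K); apply/setP => z; apply/imsetP/imsetP.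
    by case=> _ /imsetP[a aA ->] ->; exists a.
  by case=> a aA ->; exists (g a) => //; apply/imsetP; exists a.
apply/setP => z; apply/imsetP/imsetP.
  by case=> _ /imsetP[a aA ->] ->; exists a; rewrite ?gK.
by case=> a aA ->; exists (g a); rewrite ?gK //; apply/imsetP; exists a.
Qed.

(** A minimal non-face containing a ghost is that ghost alone; any other one lies among the
    non-ghost vertices, where the bijection carries it to a minimal non-face of the same size. *)
Lemma complex_iso_flag (V W : finType) (K : {set {set V}}) (L : {set {set W}}) :
  complex_iso K L -> flag_complex L -> flag_complex K.
Proof.
move=> [f [g fK gK] H] flagL A minA; have [AK Amin] := minsetP minA.
have [v /andP[vA gv]|noghost] := pickP [pred v | (v \in A) && ghost K v].
  have <- : [set v]%SET = A by apply: Amin gv _; rewrite finset.sub1set.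
  by rewrite cards1.
have ng v : v \in A -> ~~ ghost K v.
  by move=> vA; have := noghost v; rewrite /= vA => /= ->.
pose A0 := [set v : {v | ~~ ghost K v} | val v \in A]%SET.
have AE : [set val v | v in A0]%SET = A.
  apply/setP => z; apply/imsetP/idP => [[v]|zA]; first by rewrite inE => ? ->.
  by exists (Sub z (ng _ zA)); rewrite ?inE SubK.
have finj : injective (fun v => val (f v)).
  by move=> x y /val_inj /(can_inj fK).
rewrite -AE card_imset; last exact: val_inj.
have <- : #|[set val (f v) | v in A0]%SET| = #|A0| by rewrite card_imset.
apply: flagL; apply/minsetP; split; first by rewrite -H AE.
move=> B BL BA; have BE : [set val (f v) | v in
    [set v in A0 | val (f v) \in B]]%SET = B.
  apply/setP => z; apply/imsetP/idP => [[v]|zB]; first by rewrite inE => /andP[_ ?] ->.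
  have /imsetP[v vA0 zE] := fintype.subsetP BA _ zB.
  by exists v => //; rewrite inE vA0 -zE.
have := Amin [set val v | v in [set v in A0 | val (f v) \in B]]%SET.
rewrite H BE => /(_ BL) H'.
have {}H' : [set val v | v in [set v in A0 | val (f v) \in B]]%SET = A.
  apply: H'; rewrite -AE; apply: imsetS; apply/fintype.subsetP => v.
  by rewrite inE => /andP[].
suff E : [set v in A0 | val (f v) \in B]%SET = A0 by rewrite -BE E.
apply/setP => v; apply/idP/idP; first by rewrite inE => /andP[].
move=> vA0; have : val v \in A by rewrite -AE imset_f.
by rewrite -{1}H' => /imsetP[w] wP /val_inj ->.
Qed.
End Transfer.

(** * Faces of polytopes *)

Section Convexity.
Local Open Scope ring_scope.
Local Open Scope classical_set_scope.
Variable R : realType.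

Definition dot d (x : 'rV[R]_d) (c : 'cV[R]_d) : R := (x *m c) 0 0.

Lemma dotE d (x : 'rV[R]_d) c : dot x c = \sum_j x 0 j * c j 0.
Proof. by rewrite /dot mxE. Qed.

Lemma dotDl d (x y : 'rV[R]_d) c : dot (x + y) c = dot x c + dot y c.
Proof. by rewrite /dot mulmxDl mxE. Qed.

Lemma dotBl d (x y : 'rV[R]_d) c : dot (x - y) c = dot x c - dot y c.
Proof. by rewrite /dot mulmxBl !mxE. Qed.

Lemma dotZl d a (x : 'rV[R]_d) c : dot (a *: x) c = a * dot x c.
Proof. by rewrite /dot -scalemxAl mxE. Qed.

Lemma dotNl d (x : 'rV[R]_d) c : dot (- x) c = - dot x c.
Proof. by rewrite /dot mulNmx mxE. Qed.

Lemma dot0l d (c : 'cV[R]_d) : dot 0 c = 0.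
Proof. by rewrite /dot mul0mx mxE. Qed.

Lemma dot0r d (x : 'rV[R]_d) : dot x 0 = 0.
Proof. by rewrite /dot mulmx0 mxE. Qed.

Lemma dot_suml d I (r : seq I) (P : pred I) (F : I -> 'rV[R]_d) c :
  dot (\sum_(i <- r | P i) F i) c = \sum_(i <- r | P i) dot (F i) c.
Proof. by rewrite /dot mulmx_suml summxE. Qed.

Lemma dotDr d (x : 'rV[R]_d) c c' : dot x (c + c') = dot x c + dot x c'.
Proof. by rewrite /dot mulmxDr mxE. Qed.

Lemma dotZr d a (x : 'rV[R]_d) c : dot x (a *: c) = a * dot x c.
Proof. by rewrite /dot -scalemxAr mxE. Qed.

Lemma dot_sumr d I (r : seq I) (P : pred I) (x : 'rV[R]_d) (F : I -> 'cV[R]_d) :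
  dot x (\sum_(i <- r | P i) F i) = \sum_(i <- r | P i) dot x (F i).
Proof. by rewrite /dot mulmx_sumr summxE. Qed.

Lemma dot_tr d (x : 'rV[R]_d) c : dot c^T x^T = dot x c.
Proof. by rewrite /dot -trmx_mul mxE. Qed.

Lemma dot_col_mx d e (x : 'rV[R]_(d + e)) (c : 'cV[R]_d) (c' : 'cV[R]_e) :
  dot x (col_mx c c') = dot (lsubmx x) c + dot (rsubmx x) c'.
Proof. by rewrite /dot -{1}[x]hsubmxK mul_row_col mxE. Qed.

Lemma dot_delta d (j : 'I_d) c : dot (delta_mx 0 j) c = c j 0.
Proof. by rewrite /dot -rowE mxE. Qed.

Lemma conv_hullP d (I : finType) (a : I -> 'rV[R]_d) (A : {pred I}) x :
  conv_hull [set y | exists2 i, i \in A & y = a i] x <->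
  exists t : I -> R, [/\ forall i, 0 <= t i, forall i, i \notin A -> t i = 0,
    \sum_i t i = 1 & x = \sum_i t i *: a i].
Proof.
split=> [[k [v [c [vA c0 c1 ->]]]]|[t [t0 tA t1 ->]]].
  have /choice[s sP] j : exists i, i \in A /\ v j = a i.
    by have [i Ai vi] := vA j; exists i.
  exists (fun i => \sum_(j | s j == i) c j); split.
  - by move=> i; apply: sumr_ge0.
  - move=> i nAi; apply: big1 => j /eqP sj.
    by have [] := sP j; rewrite sj (negPf nAi).
  - by rewrite -c1 [RHS](partition_big s predT).
  - rewrite (partition_big s predT) //=; apply: eq_bigr => i _.
    rewrite scaler_suml; apply: eq_bigr => j /eqP <-.
    by have [_ ->] := sP j.
exists #|A|, (fun j => a (enum_val j)), (fun j => t (enum_val j)); split.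
- by move=> j; exists (enum_val j) => //; exact: (enum_valP j).
- by [].
- rewrite -t1 [RHS](bigID (mem A)) /= [X in _ + X]big1 ?addr0 => [|i /tA //].
  by rewrite [RHS]big_enum_val.
- rewrite [LHS](bigID (mem A)) /= [X in _ + X]big1 ?addr0 => [|i /tA ->]; last by rewrite scale0r.
  by rewrite big_enum_val.
Qed.

Lemma conv_hull_mem d (A : set 'rV[R]_d) x : A x -> conv_hull A x.
Proof.
move=> Ax; exists 1%N, (fun=> x), (fun=> 1); split => //.
  by rewrite big_ord1.
by rewrite big_ord1 scale1r.
Qed.

Lemma conv_hull_dot_le d (A : set 'rV[R]_d) c b :
  (forall x, A x -> dot x c <= b) -> forall x, conv_hull A x -> dot x c <= b.
Proof.
move=> H x [k [v [a [vA a0 a1 ->]]]].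
rewrite dot_suml -[b]mul1r -a1 mulr_suml; apply: ler_sum => i _.
by rewrite dotZl; apply: ler_wpM2l => //; apply: H.
Qed.

Lemma conv_hull_segment d (A : set 'rV[R]_d) x y (t : R) :
  0 <= t <= 1 -> conv_hull A x -> conv_hull A y ->
  conv_hull A (t *: x + (1 - t) *: y).
Proof.
move=> /andP[t0 t1] [k [v [a [vA a0 a1 ->]]]] [l [w [b [wA b0 b1 ->]]]].
pose F T (f : 'I_k -> T) (g : 'I_l -> T) (i : 'I_(k + l)) :=
  match fintype.split i with inl j => f j | inr j => g j end.
exists (k + l)%N, (F _ v w), (F _ (fun j => t * a j) (fun j => (1 - t) * b j)).
have Fl T f g i : F T f g (lshift l i) = f i.
  by rewrite /F (unsplitK (inl i)).
have Fr T f g i : F T f g (rshift k i) = g i.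
  by rewrite /F (unsplitK (inr i)).
split.
- by move=> i; rewrite /F; case: (fintype.split i).
- by move=> i; rewrite /F; case: (fintype.split i) => j; apply: mulr_ge0; rewrite ?subr_ge0.
- rewrite big_split_ord /=.
  under eq_bigr do rewrite Fl.
  under [X in _ + X]eq_bigr do rewrite Fr.
  by rewrite -!mulr_sumr a1 b1; ring.
- rewrite [RHS]big_split_ord /= !scaler_sumr.
  congr (_ + _); apply: eq_bigr => i _.
    by rewrite !Fl scalerA.
  by rewrite !Fr scalerA.
Qed.

(* [e = (1 + \sum_i |r i| / s i)^-1] works. *)
Lemma small_step (I : finType) (s r : I -> R) :
  (forall i, 0 < s i) -> exists2 e, 0 < e & forall i, e * r i <= s i.
Proof.
move=> s0; pose T := 1 + \sum_i `|r i| / s i.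
have S0 : 0 <= \sum_i `|r i| / s i.
  by apply: sumr_ge0 => i _; apply: divr_ge0 => //; exact: ltW.
have T0 : 0 < T by rewrite /T; lra.
exists T^-1 => [|i]; first by rewrite invr_gt0.
rewrite mulrC ler_pdivrMr // mulrC -ler_pdivrMr //.
have : `|r i| / s i <= T.
  rewrite /T (bigD1 i) //=.
  have : 0 <= \sum_(j | j != i) `|r j| / s j.
    by apply: sumr_ge0 => j _; apply: divr_ge0 => //; exact: ltW.
  lra.
apply: le_trans; apply: ler_wpM2r; last exact: ler_norm.
by rewrite invr_ge0 ltW.
Qed.

Lemma faces_set0 d (P : set 'rV[R]_d) : faces P set0.
Proof.
exists 0, 1; split=> [x _|]; first by rewrite mulmx0 mxE.
rewrite predeqE => x; split=> // -[_ /=]; rewrite mulmx0 mxE => /esym/eqP.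
by rewrite oner_eq0.
Qed.

Lemma faces_setT d (P : set 'rV[R]_d) : faces P P.
Proof.
exists 0, 0; split=> [x _|]; first by rewrite mulmx0 mxE.
by rewrite predeqE => x; split=> [Px|[]//]; split=> //=; rewrite mulmx0 mxE.
Qed.

Lemma faces_sub d (P F : set 'rV[R]_d) : faces P F -> F `<=` P.
Proof. by move=> [c [b [_ ->]]] x []. Qed.

Lemma vertex_mem d (P : set 'rV[R]_d) v : vertices P v -> P v.
Proof. by move=> /faces_sub; apply. Qed.

Lemma vertex_extreme d (P : set 'rV[R]_d) v u :
  vertices P v -> P (v + u) -> P (v - u) -> u = 0.
Proof.
move=> [c [b [H E]]] Pp Pm.
have [_ /= vb] : (P `&` [set x | dot x c = b]) v by rewrite -[_ `&` _]E.
have h1 : dot (v + u) c <= b := H _ Pp.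
have h2 : dot (v - u) c <= b := H _ Pm.
rewrite dotDl vb in h1; rewrite dotBl vb in h2.
have : [set v] (v + u).
  by rewrite E; split=> //=; rewrite -/(dot _ _) dotDl vb; lra.
by move=> /= /eqP; rewrite -subr_eq0 addrAC subrr add0r => /eqP.
Qed.

Definition convex_span d (I : finType) (a : I -> 'rV[R]_d) : set 'rV[R]_d :=
  [set x | exists t : I -> R,
     [/\ forall i, 0 <= t i, \sum_i t i = 1 & x = \sum_i t i *: a i]].

Lemma polytope_span d (P : set 'rV[R]_d) : polytope P ->
  exists (I : finType) (a : I -> 'rV[R]_d), P = convex_span a.
Proof.
move=> [A [Afin _ ->]].
exists (fset_set A : finType), (fun i => fsval i).
have AE : A = [set y | exists2 i : fset_set A, i \in predT & y = fsval i].
  rewrite predeqE => x; split=> [Ax|[i _ ->]].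
    have xA : x \in fset_set A by rewrite in_fset_set // inE.
    by exists [` xA]%fset.
  by have := fsvalP i; rewrite in_fset_set // inE.
rewrite {1}AE.
rewrite predeqE => x; split=> [/conv_hullP[t [t0 _ t1 xE]]|[t [t0 t1 xE]]].
  by exists t.
by apply/conv_hullP; exists t; split.
Qed.

Lemma convex_span_gen d (I : finType) (a : I -> 'rV[R]_d) i :
  convex_span a (a i).
Proof.
exists (fun j => (j == i)%:R); split=> [j||]; first exact: ler0n.
  by rewrite (bigD1 i) //= eqxx big1 ?addr0 // => j /negPf->.
rewrite (bigD1 i) //= eqxx scale1r big1 ?addr0 // => j /negPf->.
by rewrite scale0r.
Qed.

(** The weighted slacks are nonnegative and add up to zero, so each of them vanishes. *)
Lemma tight_weights d (I : finType) (a : I -> 'rV[R]_d) (t : I -> R) c b :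
  (forall i, 0 <= t i) -> \sum_i t i = 1 -> (forall i, dot (a i) c <= b) ->
  dot (\sum_i t i *: a i) c = b -> forall i, t i != 0 -> dot (a i) c = b.
Proof.
move=> t0 t1 H E i ti.
have slack : \sum_i t i * (b - dot (a i) c) = 0.
  under eq_bigr do rewrite mulrBr.
  rewrite sumrB -mulr_suml t1 mul1r -{1}E dot_suml.
  by apply/eqP; rewrite subr_eq0; apply/eqP/eq_bigr => j _; rewrite dotZl.
have ge0 j : true -> 0 <= t j * (b - dot (a j) c).
  by move=> _; apply: mulr_ge0 => //; rewrite subr_ge0.
have /eqP := psumr_eq0P ge0 slack (i := i) isT.
by rewrite mulf_eq0 (negPf ti) subr_eq0 => /eqP.
Qed.

Lemma convex_span_dot_le d (I : finType) (a : I -> 'rV[R]_d) c b :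
  (forall i, dot (a i) c <= b) -> forall x, convex_span a x -> dot x c <= b.
Proof.
move=> H x [t [t0 t1 ->]]; rewrite dot_suml -[b]mul1r -t1 mulr_suml.
by apply: ler_sum => i _; rewrite dotZl; apply: ler_wpM2l.
Qed.

Lemma face_weights d (I : finType) (a : I -> 'rV[R]_d) F (t : I -> R) :
  faces (convex_span a) F -> (forall i, 0 <= t i) -> \sum_i t i = 1 ->
  F (\sum_i t i *: a i) -> forall i, t i != 0 -> F (a i).
Proof.
move=> [c [b [H ->]]] t0 t1 [_ /= E] i ti; split; first exact: convex_span_gen.
by apply: tight_weights ti => // j; apply/H/convex_span_gen.
Qed.

(* A small positive multiple of the functional exposing [G] in [F], added to the
   functional exposing [F] in [P], exposes [G] in [P]. *)
Lemma faces_trans d (P F G : set 'rV[R]_d) : polytope P -> faces P F ->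
  faces F G -> faces P G.
Proof.
move=> /polytope_span[I [a ->]] [c [b [H FE]]] [c' [b' [H' GE]]].
have Hle i : dot (a i) c <= b by apply/H/convex_span_gen.
have Fa i : dot (a i) c = b -> F (a i).
  by move=> E; rewrite FE; split => //; exact: convex_span_gen.
pose s i := if `[< F (a i) >] then 1 else (b - dot (a i) c) / 2.
pose r i := if `[< F (a i) >] then 0 else dot (a i) c' - b'.
have [e e0 eP] : exists2 e, 0 < e & forall i, e * r i <= s i.
  apply: small_step => i; rewrite /s; case: asboolP => // nFi.
  apply: divr_gt0 => //; rewrite subr_gt0 lt_neqAle Hle andbT.
  by apply/eqP => /Fa.
have le2 i : dot (a i) (c + e *: c') <= b + e * b' ?= iff
    (`[< F (a i) >] && (dot (a i) c' == b')).
  rewrite dotDr dotZr; have := eP i; rewrite /r /s; case: asboolP => [Fi _|nFi].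
    have -> : dot (a i) c = b by move: Fi; rewrite FE => -[].
    split; first by rewrite lerD2l ler_pM2l //; apply: H'.
    by rewrite (inj_eq (addrI _)) (inj_eq (mulfI (lt0r_neq0 e0))).
  have lt : dot (a i) c < b by rewrite lt_neqAle Hle andbT; apply/eqP => /Fa.
  rewrite mulrBr => h; split; first by lra.
  by apply/negbTE; rewrite lt_eqF //; lra.
exists (c + e *: c'), (b + e * b'); split.
  by apply: convex_span_dot_le => i; apply: le2.
rewrite predeqE => x; split=> [|[Px xE]].
  rewrite GE FE => -[[Px /= xb] /= xb']; split=> //=.
  by rewrite -/(dot _ _) dotDr dotZr /dot xb xb'.
have [t [t0 t1 E]] := Px.
have tF i : t i != 0 -> dot (a i) c = b /\ dot (a i) c' = b'.
  move=> ti; have le2' j : dot (a j) (c + e *: c') <= b + e * b' by apply: le2.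
  rewrite {}E in xE; have /eqP := tight_weights t0 t1 le2' xE ti.
  rewrite (le2 i) => /andP[/asboolP + /eqP].
  by rewrite {1}FE => -[].
have sumE k l : (forall i, t i != 0 -> dot (a i) k = l) -> dot x k = l.
  move=> kl; rewrite E dot_suml -[l]mul1r -t1 mulr_suml; apply: eq_bigr => i _.
  by rewrite dotZl; have [->|/kl->//] := eqVneq (t i) 0; rewrite !mul0r.
rewrite GE FE; split; first split=> //=.
  by apply: sumE => i /tF[].
by apply: sumE => i /tF[].
Qed.

(** Induction on the number of generators on [F]. If two of them differ, they differ in a
    coordinate, and maximizing it over [F] exposes a face with fewer generators, which is a face of
    [P] by [faces_trans]. If all coincide, [F] is a point. *)
Lemma face_has_vertex d (P F : set 'rV[R]_d) : polytope P -> faces P F ->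
  F !=set0 -> exists2 v, vertices P v & F v.
Proof.
move=> polP; have [I [a PE]] := polytope_span polP.
pose onF (F : set 'rV[R]_d) := [set i | `[< F (a i) >]]%SET.
have [n] := ubnP #|onF F|; elim: n F => // n IH F nF faF [x Fx].
have faF' : faces (convex_span a) F by rewrite -PE.
have spanF y : F y -> exists t : I -> R, [/\ forall i, 0 <= t i,
    \sum_i t i = 1, y = \sum_i t i *: a i & forall i, t i != 0 -> F (a i)].
  move=> Fy; have := faces_sub faF Fy; rewrite PE => -[t [t0 t1 E]].
  by exists t; split=> //; apply: face_weights => //; rewrite -E.
have [t [t0 t1 _ tF]] := spanF _ Fx.
have [i0 Fi0] : exists i, F (a i).
  have [j tj] : exists j, t j != 0.
    apply/existsP; apply: contra_eqT t1; rewrite negb_exists => /forallP t_0.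
    rewrite big1 1?eq_sym ?oner_eq0 // => j _.
    by have := t_0 j; rewrite negbK => /eqP.
  by exists j; apply: tF.
have [uniqF|] := pselect (forall i, F (a i) -> a i = a i0).
  exists (a i0) => //; rewrite /vertices /= -(_ : F = [set a i0]) //.
  rewrite predeqE => y; split=> [/spanF[u [u0 u1 -> uF]]|-> //] /=.
  rewrite -[RHS]scale1r -u1 scaler_suml; apply: eq_bigr => i _.
  by have [->|/uF/uniqF->//] := eqVneq (u i) 0; rewrite !scale0r.
move=> /existsNP[i1 /not_implyP[Fi1 ne]].
have [j nej] : exists j, a i1 0 j != a i0 0 j.
  apply/existsP; apply: contra_notT ne; rewrite negb_exists => /forallP E.
  by apply/rowP => j; have := E j; rewrite negbK => /eqP.
pose c' : 'cV[R]_d := delta_mx j 0.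
have dc' y : dot y c' = y 0 j by rewrite /dot -colE mxE.
have [i2 /asboolP Fi2 maxi2] := @Order.TotalTheory.arg_maxP _ R _ i0
  (fun i => `[< F (a i) >]) (fun i => a i 0 j) (asboolT Fi0).
pose G := F `&` [set y | dot y c' = a i2 0 j].
have faG : faces F G.
  exists c', (a i2 0 j); split=> // y /spanF[u [u0 u1 -> uF]].
  rewrite -/(dot _ _) dot_suml -[leRHS]mul1r -u1 mulr_suml.
  apply: ler_sum => i _; rewrite dotZl dc'.
  have [->|/uF Fi] := eqVneq (u i) 0; first by rewrite !mul0r.
  by apply: ler_wpM2l => //; apply: maxi2; apply/asboolP.
have G0 : G !=set0 by exists (a i2); split=> //=; rewrite dc'.
have ltG : (#|onF G| < n)%N.
  rewrite ltnS in nF; apply: leq_trans nF; apply: proper_card; apply/properP; split.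
    by apply/fintype.subsetP => i; rewrite !inE => -[].
  have [i Fi ltF] : exists2 i, F (a i) & a i 0 j != a i2 0 j.
    by have [E|] := eqVneq (a i0 0 j) (a i2 0 j); [exists i1; rewrite // -E|exists i0].
  exists i; first by rewrite !inE.
  by rewrite !inE; case: asboolP => // -[_ /=]; rewrite dc' => E; rewrite E eqxx in ltF.
by have [v vv [Fv _]] := IH G ltG (faces_trans polP faF faG) G0; exists v.
Qed.
End Convexity.

(** * Tight sets and face lattices *)

Section FaceLattice.
Local Open Scope ring_scope.
Local Open Scope classical_set_scope.
Variable R : realType.

(** Two maps with the same fibres on [D] have images in bijection; this lets face lattices be
    compared through a common index set. *)
Lemma bij_of_param (T : pointedType) (U W : choiceType) (D : set T) (g : T -> U) (h : T -> W) :
  (forall s t, D s -> D t -> g s = g t <-> h s = h t) ->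
  exists2 f : U -> W, set_bij (g @` D) (h @` D) f & forall t, D t -> f (g t) = h t.
Proof.
move=> gh.
pose f u := h (xget point [set t | D t /\ g t = u]).
have fE t : D t -> f (g t) = h t.
  move=> Dt; rewrite /f; case: xgetP => [s _ [Ds E]|/(_ t)]; last by case.
  by apply/gh.
exists f => //; split.
- by move=> _ [t Dt <-]; rewrite fE //; exists t.
- move=> _ _ /set_mem[s Ds <-] /set_mem[t Dt <-]; rewrite !fE //.
  by move=> E; apply/gh.
- by move=> _ [t Dt <-]; exists (g t); [exists t|rewrite fE].
Qed.

Lemma comb_equiv_param (T : pointedType) (D : set T) d e (P : set 'rV[R]_d)
    (P' : set 'rV[R]_e) g h :
  faces P = g @` D -> faces P' = h @` D ->
  (forall s t, D s -> D t -> g s `<=` g t <-> h s `<=` h t) -> comb_equiv P P'.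
Proof.
move=> Pg Ph gh; have [s t Ds Dt|f fbij fE] := @bij_of_param _ _ _ D g h.
  by rewrite !eqEsubset; split=> -[st ts]; split; apply/gh.
exists f; first by rewrite Pg Ph.
by rewrite Pg => _ _ [s Ds <-] [t Dt <-]; rewrite !fE //; apply: gh.
Qed.

Lemma dual_polytopes_param (T : pointedType) (D : set T) d e (P : set 'rV[R]_d)
    (P' : set 'rV[R]_e) g h :
  faces P = g @` D -> faces P' = h @` D ->
  (forall s t, D s -> D t -> g s `<=` g t <-> h t `<=` h s) ->
  dual_polytopes P P'.
Proof.
move=> Pg Ph gh; have [s t Ds Dt|f fbij fE] := @bij_of_param _ _ _ D g h.
  by rewrite !eqEsubset; split=> -[st ts]; split; apply/gh.
exists f; first by rewrite Pg Ph.
by rewrite Pg => _ _ [s Ds <-] [t Dt <-]; rewrite !fE //; apply: gh.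
Qed.

Lemma comb_equiv_refl d (P : set 'rV[R]_d) : comb_equiv P P.
Proof. by exists id => //; split=> // F FP; exists F. Qed.

Section Tight.
Variables (d : nat) (I : finType) (l : I -> 'cV[R]_d) (b : I -> R).
Implicit Types (P : set 'rV[R]_d) (L : {set {set I}}) (A : {set I}).

Definition tight (x : 'rV[R]_d) : {set I} := [set i | dot x (l i) == b i]%SET.

Lemma tightP x i : reflect (dot x (l i) = b i) (i \in tight x).
Proof. by rewrite inE; apply: eqP. Qed.

Definition tight_face P A : set 'rV[R]_d := [set y | P y /\ A \subset tight y].

(* The nonempty faces of [P] correspond, with inclusions reversed, to the members
   of [L]: the sets of those of the valid inequalities [dot x (l i) <= b i] that
   hold with equality at some point of [P]. *)
Definition tight_complex P L : Prop :=
  [/\ forall x i, P x -> dot x (l i) <= b i,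
      forall F, faces P F -> F !=set0 ->
        exists2 x, P x & F = tight_face P (tight x)
    & forall A, A \in L <-> exists2 x, P x & tight x = A].

(** [None] is the one face that has no tight set: the empty face of [P], and correspondingly the
    improper face of the polar dual. *)
Definition face_dom L : set (option {set I}) :=
  [set o | if o is Some A then A \in L else True].

Definition face_code P (o : option {set I}) : set 'rV[R]_d :=
  if o is Some A then tight_face P A else set0.

Definition code_le (o o' : option {set I}) : Prop :=
  match o, o' with
  | None, _ => True
  | Some _, None => False
  | Some A, Some A' => A' \subset A
  end.

(** The sum of the inequalities indexed by [A] exposes the face: it is tight only where every
    summand is. *)
Lemma tight_face_faces P A : (forall x i, P x -> dot x (l i) <= b i) ->
  faces P (tight_face P A).
Proof.
move=> H; exists (\sum_(i in A) l i), (\sum_(i in A) b i); split=> [x Px|].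
  by rewrite -/(dot _ _) dot_sumr; apply: ler_sum => i _; apply: H.
rewrite predeqE => x; split=> -[Px] /=; rewrite -/(dot _ _) dot_sumr.
  move=> /fintype.subsetP At; split => //; apply: eq_bigr => i /At.
  by rewrite inE => /eqP.
move=> E; split=> //; apply/fintype.subsetP => i iA; rewrite inE.
have [//|ne] := eqVneq.
suff : \sum_(i in A) dot x (l i) < \sum_(i in A) b i by rewrite E ltxx.
rewrite (bigD1 i) //= [ltRHS](bigD1 i) //=; apply: ltr_leD.
  by rewrite lt_neqAle ne H.
by apply: ler_sum => j _; apply: H.
Qed.

Lemma faces_code P L : tight_complex P L -> faces P = face_code P @` face_dom L.
Proof.
move=> [H HF HL]; rewrite predeqE => F; split=> [faF|[[A|] + <-]].
- have [->|/set0P/(HF _ faF)[x Px FE]] := eqVneq F set0; first by exists None.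
  by exists (Some (tight x)) => //; apply/HL; exists x.
- by move=> _; apply: tight_face_faces.
- by move=> _; apply: faces_set0.
Qed.

Lemma face_code_le P L : tight_complex P L ->
  forall o o', face_dom L o -> face_dom L o' ->
  face_code P o `<=` face_code P o' <-> code_le o o'.
Proof.
move=> [H HF HL] [A|] o'; last by move=> _ _; split=> // _; apply: sub0set.
move=> /HL[x Px <-]; case: o' => [A'|] _ /=.
  split=> [/(_ x)|A'A y [Py Ay]]; first by case.
  by split=> //; apply: fintype.subset_trans Ay.
by split=> // /(_ x); apply; split.
Qed.

End Tight.

Lemma comb_equiv_tight d e (I : finType) (L : {set {set I}}) (P : set 'rV[R]_d)
    (P' : set 'rV[R]_e) l b l' b' :
  tight_complex l b P L -> tight_complex l' b' P' L -> comb_equiv P P'.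
Proof.
move=> PL PL'; apply: comb_equiv_param (faces_code PL) (faces_code PL') _.
by move=> s t Ds Dt; rewrite (face_code_le PL) // (face_code_le PL').
Qed.

Section HPolytope.
Variables (d : nat) (I : finType) (l : I -> 'cV[R]_d) (b : I -> R).
Implicit Types (L : {set {set I}}) (A : {set I}).

Definition hpolyhedron : set 'rV[R]_d := [set x | forall i, dot x (l i) <= b i].

(** A point of [F] with the fewest tight inequalities plays the part of a relative interior
    point. *)
Lemma tight_complex_hpolyhedron L :
  (forall A, A \in L <-> exists2 x, hpolyhedron x & tight l b x = A) ->
  tight_complex l b hpolyhedron L.
Proof.
move=> HL; split=> // F [c [beta [H FE]]] [x0 Fx0].
pose size x := #|tight l b x|.
have [x Fx minx] : exists2 x, F x & forall y, F y -> (size x <= size y)%N.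
  have ex : exists n, `[< exists2 x, F x & size x = n >].
    by exists (size x0); apply/asboolP; exists x0.
  have [n /asboolP[x Fx <-] nmin] := ex_minnP ex.
  by exists x => // y Fy; apply: nmin; apply/asboolP; exists y.
have [Px xb] : (hpolyhedron `&` [set x | dot x c = beta]) x by rewrite -[_ `&` _]FE.
exists x => //; rewrite FE predeqE => y; split=> [[Py /= yb]|[Py xy]].
  split=> //; pose z := (1 / 2) *: x + (1 / 2) *: y.
  have tz i : i \in tight l b z -> i \in tight l b x /\ i \in tight l b y.
    move=> /tightP; rewrite dotDl !dotZl => E.
    have := Px i; have := Py i => h1 h2.
    by split; apply/tightP; lra.
  have Fz : F z.
    rewrite FE; split=> [i|/=].
      by rewrite dotDl !dotZl; have := Px i; have := Py i; lra.
    have xb' : dot x c = beta := xb; have yb' : dot y c = beta := yb.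
    by rewrite -/(dot z c) dotDl !dotZl xb' yb'; lra.
  have sub : tight l b z \subset tight l b x by apply/fintype.subsetP => i /tz[].
  have /eqP <- : tight l b z == tight l b x by rewrite eqEcard sub minx.
  by apply/fintype.subsetP => i /tz[].
split=> //=.
(* Conversely, [x] is pushed slightly away from [y]: inequalities tight at [x] are tight at [y] and
   stay tight, the others have positive slack. The exposing functional cannot increase there, so it
   is maximal at [y] too. The values 1 and 0 make tight indices harmless in [small_step]. *)
pose s i := if i \in tight l b x then 1 else b i - dot x (l i).
pose r i := if i \in tight l b x then 0 else dot x (l i) - dot y (l i).
have [e e0 eP] : exists2 e, 0 < e & forall i, e * r i <= s i.
  apply: small_step => i; rewrite /s; case: tightP => // ne.
  by rewrite subr_gt0 lt_neqAle Px andbT; apply/eqP.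
have Pz : hpolyhedron (x + e *: (x - y)).
  move=> i; rewrite dotDl dotZl dotBl; have := eP i; rewrite /r /s.
  case: ifP => [ti _|_ h]; last by lra.
  have /tightP-> := fintype.subsetP xy _ ti.
  by have /tightP-> := ti; rewrite subrr mulr0 addr0.
have h1 : dot (x + e *: (x - y)) c <= beta := H _ Pz.
have h2 : dot y c <= beta := H _ Py.
have h3 : dot x c = beta := xb.
have : e * (beta - dot y c) <= 0.
  by move: h1; rewrite dotDl dotZl dotBl h3 gerDl.
rewrite pmulr_rle0 // subr_le0 => h4.
by apply/eqP; rewrite eq_le -/(dot y c) h2 h4.
Qed.

Hypothesis bounded : forall u, (forall i, dot u (l i) <= 0) -> u = 0.

(** [bounded] says that the recession cone is trivial, so some inequality grows along [u]; the step
    is the smallest ratio at which such an inequality becomes tight. *)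
Lemma hpolyhedron_exit x u : hpolyhedron x -> u <> 0 ->
  (forall i, i \in tight l b x -> dot u (l i) = 0) ->
  exists2 t, 0 <= t & hpolyhedron (x + t *: u) /\
    tight l b x \proper tight l b (x + t *: u).
Proof.
move=> Px u0 tu.
have [i0 i0P] : exists i, 0 < dot u (l i).
  apply: contra_notP u0 => none; apply: bounded => i.
  by rewrite leNgt; apply/negP => ui; apply: none; exists i.
pose q i := (b i - dot x (l i)) / dot u (l i).
have [i1 i1P qmin] := @Order.TotalTheory.arg_minP _ R _ i0
  (fun i => 0 < dot u (l i)) q i0P.
have q0 : 0 <= q i1 by apply: divr_ge0; [rewrite subr_ge0 Px|exact: ltW].
exists (q i1) => //; split=> [i|].
  rewrite dotDl dotZl; have [ui|ui] := ltP 0 (dot u (l i)).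
    have /= := qmin i ui; rewrite {2}/q ler_pdivlMr //; lra.
  have := Px i; have : q i1 * dot u (l i) <= 0 by apply: mulr_ge0_le0.
  lra.
apply/properP; split.
  apply/fintype.subsetP => i ti; apply/tightP; rewrite dotDl dotZl (tu i ti) mulr0 addr0.
  exact/tightP.
exists i1.
  by apply/tightP; rewrite dotDl dotZl divfK ?gt_eqF //; lra.
by apply/negP => /tu E; rewrite E ltxx in i1P.
Qed.

(* A point that is not determined by its tight inequalities lies on a segment
   whose end points satisfy more inequalities with equality. *)
Lemma hpolyhedron_polytope : hpolyhedron !=set0 -> polytope hpolyhedron.
Proof.
move=> [x0 Px0].
pose A := [set x | hpolyhedron x /\ forall y, hpolyhedron y ->
  tight l b x \subset tight l b y -> y = x].
have hull x : hpolyhedron x -> conv_hull A x.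
  have [n] := ubnP #|~: tight l b x|%SET; elim: n x => // n IH x xn Px.
  have [xA|nA] := pselect (A x); first exact: conv_hull_mem.
  have [y [Py xy yx]] : exists y, [/\ hpolyhedron y,
      tight l b x \subset tight l b y & y <> x].
    apply: contra_notP nA => none; split=> // y Py xy.
    by apply: contrapT => yx; apply: none; exists y.
  have u0 : y - x <> 0 by move=> /eqP; rewrite subr_eq0 => /eqP.
  have u0' : x - y <> 0 by move=> /eqP; rewrite subr_eq0 => /eqP/esym.
  have tu i : i \in tight l b x -> dot (y - x) (l i) = 0.
    move=> ti; have /tightP E := fintype.subsetP xy _ ti.
    by have /tightP E' := ti; rewrite dotBl E E' subrr.
  have tu' i : i \in tight l b x -> dot (x - y) (l i) = 0.
    by move=> /tu E; rewrite -opprB dotNl E oppr0.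
  have IH' z : hpolyhedron z -> tight l b x \proper tight l b z -> conv_hull A z.
    move=> Pz tz; apply: IH => //; rewrite ltnS in xn; apply: leq_trans xn.
    by apply: proper_card; rewrite finset.properC.
  have [s s0 [Ps ts]] := hpolyhedron_exit Px u0 tu.
  have [t t0 [Pt tt]] := hpolyhedron_exit Px u0' tu'.
  have [s00|sn0] := eqVneq s 0.
    by move: ts; rewrite s00 scale0r addr0 fintype.properxx.
  have st : 0 < s + t by move: s0; rewrite le_eqVlt eq_sym (negPf sn0) /=; lra.
  have -> : x = (t / (s + t)) *: (x + s *: (y - x)) +
      (1 - t / (s + t)) *: (x + t *: (x - y)).
    apply/rowP => j; rewrite !mxE; field; exact: lt0r_neq0.
  apply: conv_hull_segment (IH' _ Ps ts) (IH' _ Pt tt).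
  by apply/andP; split; [apply: divr_ge0 => //; exact: ltW|rewrite ler_pdivrMr //; lra].
exists A; split.
(* A point of [A] is recovered from its tight set, so [A] is finite. *)
- apply: (@sub_finite_set _ _ ((fun T => xget 0 [set x | A x /\ tight l b x = T]) @` setT)).
    move=> x Ax; exists (tight l b x) => //; case: xgetP => [y _ [[Py _] E]|/(_ x)].
      by case: Ax => _; apply; rewrite ?E.
    by case.
  exact/finite_image/finite_finset.
- apply/set0P/eqP => A0; have := hull _ Px0; rewrite A0 => -[k [v [a [vA _ a1 _]]]].
  case: k v a vA a1 => [v a _|k v a vA _]; last by have := vA ord0.
  by rewrite big_ord0 => /esym/eqP; rewrite oner_eq0.
- rewrite predeqE => x; split=> [/hull //|Ax i].
  by apply: conv_hull_dot_le Ax => y [Py _]; apply: Py.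
Qed.

End HPolytope.

End FaceLattice.

(** * Polar duals *)

Section Polar.
Local Open Scope ring_scope.
Local Open Scope classical_set_scope.
Variable R : realType.
Variables (d : nat) (I : finType) (l : I -> 'cV[R]_d) (b : I -> R).
Variables (L : {set {set I}}) (x0 : 'rV[R]_d) (i0 : I).
Implicit Type A : {set I}.
Let P := hpolyhedron l b.
Hypothesis complexL : simplicial_complex L.
Hypothesis bounded : forall u, (forall i, dot u (l i) <= 0) -> u = 0.
Hypothesis HL : forall A, A \in L <-> exists2 x, P x & tight l b x = A.
Hypothesis x0_int : forall i, dot x0 (l i) < b i.

(** With [x0] moved to the origin, the [i]-th inequality says that the product with this vector is
    at most 1. Points [x] of [P] thereby become the functionals [(x - x0)^T] bounded by 1 on the
    polar. *)
Definition polar_vertex i : 'rV[R]_d := (b i - dot x0 (l i))^-1 *: (l i)^T.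

Definition polar_face A : set 'rV[R]_d :=
  conv_hull [set y | exists2 i, i \in A & y = polar_vertex i].

Definition polar : set 'rV[R]_d := convex_span polar_vertex.

(** Opposite to [face_code]: the empty index set now codes the empty face, and [None] the whole
    polytope. *)
Definition polar_code (o : option {set I}) : set 'rV[R]_d :=
  if o is Some A then polar_face A else polar.

Lemma slack_gt0 i : 0 < b i - dot x0 (l i).
Proof. by rewrite subr_gt0. Qed.

Lemma dot_polar_vertex i (u : 'rV[R]_d) :
  dot (polar_vertex i) u^T = dot u (l i) / (b i - dot x0 (l i)).
Proof. by rewrite dotZl -[(l i)^T in LHS]trmxK trmxK dot_tr mulrC. Qed.

Lemma polar_vertex_tight i x :
  (dot (polar_vertex i) (x - x0)^T == 1) = (i \in tight l b x).
Proof.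
rewrite dot_polar_vertex dotBl; apply/eqP/tightP => [/divr1_eq/addIr//|->].
by rewrite divff // gt_eqF ?slack_gt0.
Qed.

Lemma polar_vertex_le i x : P x -> dot (polar_vertex i) (x - x0)^T <= 1.
Proof.
move=> Px; rewrite dot_polar_vertex ler_pdivrMr ?slack_gt0 // mul1r dotBl.
by rewrite lerD2r; apply: Px.
Qed.

Lemma polar_hull : polar = conv_hull [set y | exists2 i, i \in predT & y = polar_vertex i].
Proof.
rewrite predeqE => x; split=> [[t [t0 t1 xE]]|/conv_hullP[t [t0 _ t1 xE]]].
  by apply/conv_hullP; exists t; split.
by exists t.
Qed.

Lemma polar_polytope : polytope polar.
Proof.
exists [set y | exists2 i, i \in predT & y = polar_vertex i].
split; last exact: polar_hull.
  apply: sub_finite_set (finite_image polar_vertex (@finite_finset I setT)).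
  by move=> _ [i _ ->]; exists i.
by exists (polar_vertex i0), i0.
Qed.

Lemma polar_faceE x : P x ->
  polar_face (tight l b x) = polar `&` [set y | dot y (x - x0)^T = 1].
Proof.
move=> Px; rewrite predeqE => y; split.
  move=> /conv_hullP[t [t0 tA t1 yE]]; split; first by exists t.
  rewrite /= yE dot_suml -t1; apply: eq_bigr => i _; rewrite dotZl.
  have [ti|/tA->] := boolP (i \in tight l b x); last by rewrite mul0r.
  by move: ti; rewrite -polar_vertex_tight => /eqP->; rewrite mulr1.
move=> [[t [t0 t1 yE]] /= y1]; apply/conv_hullP; exists t; split=> // i.
apply: contraNeq => ti; rewrite -polar_vertex_tight; apply/eqP.
rewrite yE in y1; apply: (tight_weights t0 t1 _ y1 ti) => j.
exact: polar_vertex_le.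
Qed.

Lemma polar_face_vertex A i : A \in L -> polar_face A (polar_vertex i) -> i \in A.
Proof.
move=> /HL[x Px <-]; rewrite polar_faceE // => -[_ /= /eqP].
by rewrite polar_vertex_tight.
Qed.

(** At a point where everything is tight, [x0 - x] would be a recession direction, hence zero,
    although [x0] satisfies all inequalities strictly. This keeps the whole polar apart from the
    faces [polar_face A]. *)
Lemma full_notin : [set: I]%SET \notin L.
Proof.
apply/negP => /HL[x Px xT].
have tx i : dot x (l i) = b i by apply/tightP; rewrite xT inE.
have xx0 : x0 - x = 0.
  by apply: bounded => i; rewrite dotBl tx; have := x0_int i; lra.
have := slack_gt0 i0; have := congr1 (fun u => dot u (l i0)) xx0.
by rewrite dot0l dotBl tx; lra.
Qed.

(** A functional with positive bound [beta] rescales to a point of [P]. Otherwise it is a recession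
    direction, hence zero, and exposes only the improper face. *)
Lemma faces_polar : faces polar = polar_code @` face_dom L.
Proof.
rewrite predeqE => F; split; last first.
  case=> -[A|] + <-; last by move=> _; exact: faces_setT.
  move=> /HL[x Px <-]; rewrite /= polar_faceE //.
  exists (x - x0)^T, 1; split=> // y; apply: convex_span_dot_le => i.
  exact: polar_vertex_le.
move=> [c [beta [H FE]]].
have Hi i : dot (polar_vertex i) c <= beta by apply/H/convex_span_gen.
have [beta0|beta0] := ltP 0 beta.
  pose x := x0 + beta^-1 *: c^T.
  have xx0 : (x - x0)^T = beta^-1 *: c.
    by rewrite /x addrAC subrr add0r linearZ /= trmxK.
  have Px : P x.
    move=> i; rewrite dotDl dotZl.
    have := Hi i; rewrite -{1}[c]trmxK dot_polar_vertex.
    rewrite ler_pdivrMr ?slack_gt0 // -ler_pdivrMl //; lra.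
  exists (Some (tight l b x)); first by apply/HL; exists x.
  rewrite /= polar_faceE // FE xx0 predeqE => y.
  have E : dot y (beta^-1 *: c) = 1 <-> dot y c = beta.
    by rewrite dotZr; split=> [/(canRL (mulKf _))->|->];
      rewrite ?invrK ?mulr1 ?mulVf ?gt_eqF ?invr_gt0.
  by split=> -[Qy /E]; split.
have c0 : c^T = 0.
  apply: bounded => i; have := Hi i; rewrite -{1}[c]trmxK dot_polar_vertex.
  rewrite ler_pdivrMr ?slack_gt0 // => /le_trans; apply.
  by apply: mulr_le0_ge0 => //; apply/ltW/slack_gt0.
have {}c0 : c = 0 by rewrite -[c]trmxK c0 trmx0.
have beta_0 : beta = 0.
  by apply/eqP; rewrite eq_le beta0 /=; have := Hi i0; rewrite c0 /dot mulmx0 mxE.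
exists None => //=; rewrite FE c0 beta_0 predeqE => y.
by split=> [Qy|[]//]; split=> //=; rewrite mulmx0 mxE.
Qed.

Lemma polar_code_le o o' : face_dom L o -> face_dom L o' ->
  polar_code o `<=` polar_code o' <-> code_le o' o.
Proof.
have sub A : polar_face A `<=` polar.
  by move=> y /conv_hullP[t [t0 _ t1 yE]]; exists t.
case: o' => [A'|] /= Do Do'; last by split=> // _; case: o Do => [A|] _ //; exact: sub.
case: o Do => [A|] /= Do.
  split=> [H|/fintype.subsetP H y /conv_hullP[t [t0 tA t1 yE]]].
    apply/fintype.subsetP => i iA; apply: polar_face_vertex => //; apply: H.
    by apply: conv_hull_mem; exists i.
  apply/conv_hullP; exists t; split=> // i iA'; apply: tA.
  by apply: contra iA'; exact: H.
split=> // H; have := full_notin; rewrite (_ : [set: I]%SET = A') ?Do' //.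
apply/esym/eqP; rewrite -finset.subTset; apply/fintype.subsetP => i _.
by apply: polar_face_vertex => //; apply/H/convex_span_gen.
Qed.

(* If [j \in A] had a nonzero coefficient in an affine relation among the
   vertices of [A], evaluating the relation at a point whose tight set is
   [A :\ j] would give a contradiction. *)
Lemma polar_face_simplex A : A \in L -> simplex (polar_face A).
Proof.
move=> AL; exists #|A|, (fun k => polar_vertex (enum_val k)); split; last first.
  congr conv_hull; rewrite predeqE => y; split=> [[i iA ->]|[k _ <-]].
    by exists (enum_rank_in iA i) => //; rewrite enum_rankK_in.
  by exists (enum_val k) => //; exact: enum_valP.
move=> a a0 aE k; pose j := enum_val k.
have jA : j \in A by exact: enum_valP.
have /HL[x Px tx] : (A :\ j)%SET \in L.
  by have [_] := complexL; apply; [exact: AL|exact: subD1set].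
have := congr1 (fun y => dot y (x - x0)^T) aE; rewrite dot0l dot_suml.
under eq_bigr do rewrite dotZl.
move=> E; have : \sum_i a i * (dot (polar_vertex (enum_val i)) (x - x0)^T - 1) = 0.
  by under eq_bigr do rewrite mulrBr mulr1; rewrite sumrB E a0 subrr.
rewrite (bigD1 k) //= big1 ?addr0 => [|i ik].
  move=> /eqP; rewrite mulf_eq0 subr_eq0 polar_vertex_tight tx !inE eqxx orbF.
  by move=> /eqP.
have -> : dot (polar_vertex (enum_val i)) (x - x0)^T = 1.
  apply/eqP; rewrite polar_vertex_tight tx !inE enum_valP andbT.
  by apply: contra ik => /eqP/enum_val_inj->.
by rewrite subrr mulr0.
Qed.

Lemma polar_face_neq A : A \in L -> polar_face A <> polar.
Proof.
move=> AL E; have : code_le (Some A) None.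
  by apply/polar_code_le => //=; rewrite E.
by [].
Qed.

Lemma polar_simplicial : simplicial_polytope polar.
Proof.
split=> [|F]; first exact: polar_polytope.
by rewrite faces_polar => -[[A|] AL <-] //= _; exact: polar_face_simplex.
Qed.

Lemma polar_face0 : polar_face finset.set0 = set0.
Proof.
rewrite predeqE => y; split=> // /conv_hullP[t [_ tA t1 _]].
by move: t1; rewrite big1 => [/esym/eqP|i _]; rewrite ?oner_eq0 ?tA ?inE.
Qed.

Lemma polar_face1 i : polar_face [set i]%SET = [set polar_vertex i].
Proof.
rewrite predeqE => y; split=> [/conv_hullP[t [_ tA t1 ->]]|->]; last first.
  by apply: conv_hull_mem; exists i => //; rewrite inE.
have t_i : t i = 1.
  move: t1; rewrite (bigD1 i) //= big1 ?addr0 // => j ji.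
  by apply: tA; rewrite inE.
rewrite /= (bigD1 i) //= t_i scale1r big1 ?addr0 // => j ji.
by rewrite tA ?inE // scale0r.
Qed.

(** The first alternative is that of a polar with a single point: this vertex lies on no proper face
    and is a ghost of the boundary complex. *)
Lemma vertex_polar v : vertices polar v ->
  [set v] = polar \/ exists2 i, [set i]%SET \in L & v = polar_vertex i.
Proof.
rewrite /vertices /= faces_polar => -[[A|] /= AL E]; last by left.
right; have [A0|[i iA]] := set_0Vmem A.
  by have : [set v] v by []; rewrite -E A0 polar_face0.
exists i; first by have [_] := complexL; apply; [exact: AL|rewrite finset.sub1set].
have : polar_face A (polar_vertex i) by apply: conv_hull_mem; exists i.
by rewrite E => ->.
Qed.

Lemma polar_vertex_vertex i : [set i]%SET \in L -> vertices polar (polar_vertex i).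
Proof.
by move=> iL; rewrite /vertices /= faces_polar; exists (Some [set i]%SET); rewrite //= polar_face1.
Qed.

Lemma finite_vertices_polar : finite_set (vertices polar).
Proof.
apply: sub_finite_set (finite_image polar_vertex (@finite_finset I setT)).
move=> v /vertex_polar[E|[i _ ->]]; last by exists i.
exists i0 => //; have : polar (polar_vertex i0) by exact: convex_span_gen.
by rewrite -E.
Qed.

Lemma polar_vertex_inj i j : [set i]%SET \in L -> [set j]%SET \in L ->
  polar_vertex i = polar_vertex j -> i = j.
Proof.
move=> iL jL E; have : polar_face [set j]%SET (polar_vertex i).
  by rewrite E polar_face1.
by move=> /(polar_face_vertex jL); rewrite inE => /eqP.
Qed.

(** Both face lattices are indexed by the same codes, in opposite orders. *)
Lemma dual_polar : dual_polytopes P polar.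
Proof.
apply: dual_polytopes_param (faces_code (tight_complex_hpolyhedron HL)) faces_polar _.
move=> s t Ds Dt; rewrite (face_code_le (tight_complex_hpolyhedron HL)) //.
by rewrite polar_code_le.
Qed.

Lemma mem_vertices (v : fset_set (vertices polar)) : vertices polar (fsval v).
Proof.
have := fsvalP v; rewrite in_fset_set; last exact: finite_vertices_polar.
exact: set_mem.
Qed.

Lemma polar_vertex_in i : [set i]%SET \in L ->
  polar_vertex i \in fset_set (vertices polar).
Proof.
move=> iL; rewrite in_fset_set; last exact: finite_vertices_polar.
exact/mem_set/polar_vertex_vertex.
Qed.

Lemma boundary_polarP (A : {set fset_set (vertices polar)}) :
  reflect (exists2 B, B \in L & forall v, v \in A <-> polar_face B (fsval v))
    (A \in boundary_complex polar).
Proof.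
rewrite inE; apply: (iffP (asboolP _)) => [[F [+ FQ FA]]|[B BL BA]].
  by rewrite faces_polar => -[[B|] /= BL FE]; [exists B; rewrite // FE|case: FQ].
exists (polar_face B); split=> //; last exact: polar_face_neq.
by rewrite faces_polar; exists (Some B).
Qed.

Lemma polar_face_single v B : vertices polar v -> B \in L -> polar_face B v ->
  exists2 i, i \in B & [set i]%SET \in L /\ v = polar_vertex i.
Proof.
move=> /vertex_polar[E|[i iL ->]] BL Bv.
  case: (polar_face_neq BL); rewrite eqEsubset; split; last first.
    by rewrite -E => _ ->.
  move=> y /conv_hullP[t [t0 _ t1 yE]]; by exists t.
by exists i => //; apply: polar_face_vertex.
Qed.

Lemma nonghost_polar i (iL : [set i]%SET \in L) :
  ~~ ghost (boundary_complex polar) [` polar_vertex_in iL]%fset.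
Proof.
rewrite negbK; apply/boundary_polarP; exists [set i]%SET => // v.
rewrite polar_face1 inE; split=> [/eqP->//|/= E].
by apply/eqP/val_inj.
Qed.

(** A non-ghost vertex of the boundary complex lies on a proper face. This rules out the one-point
    case of [vertex_polar] and gives surjectivity. *)
Lemma complex_iso_polar : complex_iso L (boundary_complex polar).
Proof.
have nL (v : {v | ~~ ghost L v}) : [set val v]%SET \in L.
  by have := valP v; rewrite negbK.
pose f (v : {v | ~~ ghost L v}) : {w | ~~ ghost (boundary_complex polar) w} :=
  exist (fun w => ~~ ghost (boundary_complex polar) w) _ (nonghost_polar (nL v)).
have fE v : fsval (val (f v)) = polar_vertex (val v) by [].
have finj : injective f.
  move=> v w /(congr1 (fun u => fsval (val u))); rewrite !fE => E.
  by apply/val_inj/(polar_vertex_inj (nL v) (nL w)).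
have fsurj w : exists v, f v = w.
  have := valP w; rewrite negbK => /boundary_polarP[B BL BP].
  have /BP Bw : val w \in [set val w]%SET by rewrite inE.
  have [i _ [iL E]] := polar_face_single (mem_vertices (val w)) BL Bw.
  have ig : ~~ ghost L i by rewrite negbK.
  by exists (exist (fun i => ~~ ghost L i) i ig); apply/val_inj/val_inj; rewrite [RHS]E.
have [g gP] := choice fsurj.
exists f; first by exists g => // v; apply: finj; rewrite gP.
move=> A; apply/idP/boundary_polarP => [AL|[B BL BP]].
  exists [set val v | v in A]%SET => // w; split=> [/imsetP[v vA ->]|].
    by rewrite fE; apply: conv_hull_mem; exists (val v) => //; apply: imset_f.
  move=> /(polar_face_single (mem_vertices w) AL)[i /imsetP[v vA ->] [_ E]].
  by apply/imsetP; exists v => //; apply/val_inj; rewrite [LHS]E.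
suff -> : [set val v | v in A]%SET = B by [].
apply/setP => i; apply/imsetP/idP => [[v vA ->]|iB].
  apply: polar_face_vertex => //; rewrite -fE; apply/BP.
  by apply/imsetP; exists v.
have iL : [set i]%SET \in L.
  by have [_] := complexL; apply; [exact: BL|rewrite finset.sub1set].
have ig : ~~ ghost L i by rewrite negbK.
have : polar_face B (fsval (val (f (exist (fun i => ~~ ghost L i) i ig)))).
  by rewrite fE; apply: conv_hull_mem; exists i.
move=> /BP/imsetP[v vA /val_inj/finj vE]; exists v => //.
by rewrite -vE.
Qed.

End Polar.

(** * Polytopes realizing a given complex *)

Section Realization.
Local Open Scope ring_scope.
Local Open Scope classical_set_scope.
Variable R : realType.

(** Inequalities that are never tight are allowed; when [L] is closed under subsets, their indices
    are its ghosts. *)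
Definition realizes d (P : set 'rV[R]_d) (I : finType) (L : {set {set I}}) :=
  exists (l : I -> 'cV[R]_d) (b : I -> R),
    [/\ P = hpolyhedron l b, forall u, (forall i, dot u (l i) <= 0) -> u = 0
      & forall A, A \in L <-> exists2 x, P x & tight l b x = A].

Lemma realizes_tight_complex d (P : set 'rV[R]_d) (I : finType) (L : {set {set I}}) :
  realizes P L -> exists l b, tight_complex l b P L.
Proof.
by move=> [l [b [-> _ HL]]]; exists l, b; apply: tight_complex_hpolyhedron.
Qed.

Lemma realizes_polytope d (P : set 'rV[R]_d) (I : finType) (L : {set {set I}}) :
  finset.set0 \in L -> realizes P L -> polytope P.
Proof.
move=> L0 [l [b [-> bd HL]]]; apply: hpolyhedron_polytope => //.
by have /HL[x Px _] := L0; exists x.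
Qed.

(** Since the empty set belongs to [L], some point satisfies every inequality strictly; the polar is
    taken at that point. *)
Lemma realizes_dual d (P : set 'rV[R]_d) (I : finType) (L : {set {set I}}) :
  (0 < #|I|)%N -> simplicial_complex L -> realizes P L ->
  exists Q : set 'rV[R]_d, [/\ simplicial_polytope Q,
    complex_iso L (boundary_complex Q) & dual_polytopes P Q].
Proof.
move=> /card_gt0P[i0 _] complexL [l [b [-> bd HL]]].
have [L0 _] := complexL; have /HL[x0 Px0 tx0] := L0.
have x0_int i : dot x0 (l i) < b i.
  rewrite lt_neqAle Px0 andbT; apply/eqP => /tightP.
  by rewrite tx0 inE.
exists (polar l b x0); split.
- exact: (polar_simplicial i0 complexL bd HL).
- exact: (complex_iso_polar i0 complexL bd HL).
- exact: (dual_polar i0 bd HL).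
Qed.

End Realization.

Lemma flag_complex_bij (V W : finType) (K : {set {set V}}) (L : {set {set W}})
    (f : V -> W) :
  bijective f -> (forall A : {set V}, (A \in K) = ((f @: A)%SET \in L)) ->
  flag_complex L -> flag_complex K.
Proof.
move=> [g fK gK] H flagL A /minsetP[AK Amin].
rewrite -(card_imset A (can_inj fK)); apply: flagL; apply/minsetP; split=> [|B BL BA].
  by rewrite -H.
have BE : (f @: (g @: B) = B)%SET.
  by rewrite -imset_comp (eq_imset _ gK) imset_id.
rewrite -BE; suff -> : (g @: B)%SET = A by [].
apply: Amin; first by rewrite H BE.
apply/fintype.subsetP => _ /imsetP[w wB ->].
by have /imsetP[v vA ->] := fintype.subsetP BA w wB; rewrite fK.
Qed.

(** * Flagness is a combinatorial invariant *)

Section CombinatorialInvariance.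
Local Open Scope ring_scope.
Local Open Scope classical_set_scope.
Variable R : realType.

Lemma dual_comb_equiv d e e' (P : set 'rV[R]_d) (Q : set 'rV[R]_e)
    (Q' : set 'rV[R]_e') :
  dual_polytopes P Q -> dual_polytopes P Q' -> comb_equiv Q Q'.
Proof.
move=> [f [fQ finj fsurj] fle] [f' [fQ' finj' fsurj'] fle'].
have /choice[g gP] F : exists G, faces Q F -> faces P G /\ f G = F.
  have [/fsurj[G PG GF]|nF] := pselect (faces Q F); first by exists G.
  by exists set0 => /nF.
exists (fun F => f' (g F)); first split.
- by move=> F /gP[Pg _]; apply: fQ'.
- move=> F G /set_mem/gP[Fg FE] /set_mem/gP[Gg GE].
  by move=> /(finj' _ _ (mem_set Fg) (mem_set Gg)); rewrite -{2}FE -{2}GE => ->.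
- move=> F /fsurj'[G PG <-]; have Qf : faces Q (f G) := fQ _ PG.
  exists (f G) => //=; congr f'; have [Pg E] := gP _ Qf.
  by apply: finj (mem_set Pg) (mem_set PG) E.
- move=> F G /gP[Fg FE] /gP[Gg GE].
  by rewrite -{1}FE -{1}GE -fle // fle'.
Qed.

Lemma finite_vertices d (Q : set 'rV[R]_d) : polytope Q -> finite_set (vertices Q).
Proof.
move=> /polytope_span[I [a ->]].
apply: sub_finite_set (finite_image a (@finite_finset I setT)) => v Qv.
have [t [t0 t1 vE]] := vertex_mem Qv.
have [i ti] : exists i, t i != 0.
  apply/existsP; apply: contra_eqT t1; rewrite negb_exists => /forallP t_0.
  rewrite big1 1?eq_sym ?oner_eq0 // => j _.
  by have := t_0 j; rewrite negbK => /eqP.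
exists i => //; have : [set v] (\sum_i t i *: a i) by rewrite -vE.
by move=> /(face_weights Qv t0 t1) /(_ i ti).
Qed.

(** As every nonempty face contains a vertex, vertices are the minimal nonempty faces, a notion of
    the face lattice alone. *)
Lemma comb_equiv_vertex d e (Q : set 'rV[R]_d) (Q' : set 'rV[R]_e) f :
  polytope Q -> polytope Q' -> set_bij (faces Q) (faces Q') f ->
  (forall F G, faces Q F -> faces Q G -> (F `<=` G <-> f F `<=` f G)) ->
  (forall v, vertices Q v -> exists2 w, vertices Q' w & f [set v] = [set w]) /\
  (forall w, vertices Q' w -> exists2 v, vertices Q v & f [set v] = [set w]).
Proof.
move=> polQ polQ' [fQ finj fsurj] fle.
have f0 : f set0 = set0.
  have [F QF F0] := fsurj _ (faces_set0 Q').
  by apply/seteqP; split=> //; rewrite -F0; apply/fle => //; exact: faces_set0.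
have nonempty F : faces Q F -> F !=set0 <-> f F !=set0.
  move=> QF; split=> /set0P ne; apply/set0P; apply: contra ne => /eqP E; apply/eqP.
    by apply: finj; rewrite ?inE ?f0 //; exact: faces_set0.
  by rewrite E.
split=> [v Qv|w Qw].
  have [w0 w0P] : f [set v] !=set0 by apply/nonempty => //; exists v.
  have [||w Qw fw] := @face_has_vertex _ _ Q' (f [set v]) polQ'.
  - exact: fQ.
  - by exists w0.
  exists w => //; have [F QF FE] := fsurj _ Qw.
  rewrite -FE; congr f; apply/esym.
  have Fv : F `<=` [set v] by apply/fle => //; rewrite FE => _ ->.
  have [u Fu] : F !=set0 by apply/nonempty => //; rewrite FE; exists w.
  by rewrite eqEsubset; split=> // _ ->; rewrite -(Fv _ Fu).
have [F QF FE] := fsurj _ Qw.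
have F0 : F !=set0 by apply/nonempty => //; rewrite FE; exists w.
have [v Qv Fv] := face_has_vertex polQ QF F0.
exists v => //; have fvw : f [set v] `<=` [set w].
  by rewrite -FE; apply/fle => // _ ->.
have [u fu] : f [set v] !=set0 by apply/nonempty => //; exists v.
by rewrite eqEsubset; split=> // _ ->; rewrite -(fvw _ fu).
Qed.

Lemma comb_equiv_flag d e (Q : set 'rV[R]_d) (Q' : set 'rV[R]_e) :
  polytope Q -> polytope Q' -> comb_equiv Q Q' ->
  flag_complex (boundary_complex Q') -> flag_complex (boundary_complex Q).
Proof.
move=> polQ polQ' [f fbij fle].
have [fv fw] := comb_equiv_vertex polQ polQ' fbij fle.
have [fQ finj fsurj] := fbij.
have memV d' (T : set 'rV[R]_d') (polT : polytope T) (v : fset_set (vertices T)) :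
    vertices T (fsval v).
  by have := fsvalP v; rewrite in_fset_set ?inE //; exact: finite_vertices.
have liftV d' (T : set 'rV[R]_d') (polT : polytope T) v : vertices T v ->
    exists u : fset_set (vertices T), fsval u = v.
  move=> Tv; have vT : v \in fset_set (vertices T).
    by rewrite in_fset_set ?inE //; exact: finite_vertices.
  by exists [` vT]%fset.
have /choice[p pP] (v : fset_set (vertices Q)) :
    exists w : fset_set (vertices Q'), f [set fsval v] = [set fsval w].
  have [w Qw E] := fv _ (memV _ _ polQ v).
  by have [u uE] := liftV _ _ polQ' _ Qw; exists u; rewrite uE.
have /choice[q qP] (w : fset_set (vertices Q')) :
    exists v : fset_set (vertices Q), f [set fsval v] = [set fsval w].
  have [v Qv E] := fw _ (memV _ _ polQ' w).
  by have [u uE] := liftV _ _ polQ _ Qv; exists u; rewrite uE.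
have set1_inj (T : Type) (x y : T) : [set x] = [set y] -> x = y.
  by move=> E; have : [set y] x by rewrite -E.
have pK : cancel p q.
  move=> v; apply/val_inj/set1_inj; apply: finj; rewrite ?inE; try exact: memV.
  by rewrite qP pP.
have qK : cancel q p.
  by move=> w; apply/val_inj/set1_inj; rewrite -pP qP.
(* Incidence of a vertex with a face is an inclusion of faces, hence preserved by [f]. *)
have faceP v F : faces Q F -> F (fsval v) <-> f F (fsval (p v)).
  move=> QF; have -> : F (fsval v) <-> [set fsval v] `<=` F.
    by split=> [Fv _ ->|]; [|apply].
  rewrite fle //; last exact: memV.
  by rewrite pP; split=> [|H _ ->]; [apply|].
apply: (@flag_complex_bij _ _ _ _ p); first by exists q.
move=> A; rewrite !inE; apply/idP/idP => /asboolP[F [QF FQ FA]]; apply/asboolP.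
  exists (f F); split; first exact: fQ.
    move=> E; apply: FQ; have QQ := faces_setT Q.
    rewrite eqEsubset; split; first exact: faces_sub QF.
    by apply/fle => //; rewrite E; exact: faces_sub (fQ _ QQ).
  move=> w; rewrite -[w]qK -faceP // -FA; split=> [/imsetP[v vA E]|]; last first.
    by move=> wA; apply: imset_f.
  by have /(can_inj pK) -> := E.
have [G QG GF] := fsurj _ QF; exists G; split=> //.
  move=> E; apply: FQ; rewrite eqEsubset; split; first exact: faces_sub QF.
  have [H QH HE] := fsurj _ (faces_setT Q').
  by rewrite -GF -[X in X `<=` _]HE; apply/fle => //; rewrite E; exact: faces_sub QH.
move=> v; rewrite faceP // GF -FA; split=> [vA|/imsetP[u uA /(can_inj pK)->//]].
exact: imset_f.
Qed.

End CombinatorialInvariance.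

(** Disjoint union of graphs: the independence complex is the join, which belongs to the product of
    polytopes. *)
Definition sum_rel (I J : Type) (e : rel I) (e' : rel J) : rel (I + J) :=
  fun x y => match x, y with
  | inl i, inl j => e i j
  | inr i, inr j => e' i j
  | _, _ => false
  end.

(** A perfect matching, whose independence complex is the boundary of the cross-polytope; adding it
    to a graph by [sum_rel] suspends the complex [n] times. *)
Definition cross_rel n : rel ('I_n + 'I_n) :=
  fun x y => match x, y with
  | inl i, inr j => i == j
  | inr i, inl j => i == j
  | _, _ => false
  end.

Lemma sum_rel_sym I J (e : rel I) (e' : rel J) :
  symmetric e -> symmetric e' -> symmetric (sum_rel e e').
Proof. by move=> es es' [x|x] [y|y] //=. Qed.

Lemma cross_rel_sym n : symmetric (@cross_rel n).
Proof. by move=> [x|x] [y|y] //=. Qed.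

(** * Products and cubes *)

Section Realizations.
Local Open Scope ring_scope.
Local Open Scope classical_set_scope.
Variable R : realType.

Lemma realizes_prod d d' (P : set 'rV[R]_d) (P' : set 'rV[R]_d') (I J : finType)
    (e : rel I) (e' : rel J) :
  realizes P (indep e) -> realizes P' (indep e') ->
  realizes (polytope_prod P P') (indep (sum_rel e e')).
Proof.
move=> [l [b [PE bd HL]]] [l' [b' [PE' bd' HL']]].
pose m (x : I + J) : 'cV[R]_(d + d') :=
  match x with inl i => col_mx (l i) 0 | inr j => col_mx 0 (l' j) end.
pose c x := match x with inl i => b i | inr j => b' j end.
have dotl x i : dot x (m (inl i)) = dot (lsubmx x) (l i).
  by rewrite dot_col_mx dot0r addr0.
have dotr x j : dot x (m (inr j)) = dot (rsubmx x) (l' j).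
  by rewrite dot_col_mx dot0r add0r.
exists m, c; split.
- rewrite PE PE' predeqE => x; split=> [[Px Px'] [i|j]|H].
  + by rewrite dotl; apply: Px.
  + by rewrite dotr; apply: Px'.
  + by split=> i; [rewrite -dotl; apply: (H (inl i))|rewrite -dotr; apply: (H (inr i))].
- move=> u H.
  have ul : lsubmx u = 0 by apply: bd => i; rewrite -dotl.
  have ur : rsubmx u = 0 by apply: bd' => i; rewrite -dotr.
  by rewrite -(hsubmxK u) ul ur row_mx0.
- move=> A; pose Al := [set i | inl i \in A]%SET; pose Ar := [set j | inr j \in A]%SET.
  have -> : A \in indep (sum_rel e e') <-> Al \in indep e /\ Ar \in indep e'.
    split=> [/indepP H|[/indepP Hl /indepP Hr]].
      by split; apply/indepP => x y; rewrite !inE => xA yA; apply: (H _ _ xA yA).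
    apply/indepP => -[x|x] [y|y] xA yA //=.
      by apply: Hl; rewrite inE.
    by apply: Hr; rewrite inE.
  rewrite HL HL'; split=> [[[x Px xA] [y Py yA]]|[z [Pz Pz'] zA]].
    exists (row_mx x y); first by split; rewrite ?row_mxKl ?row_mxKr.
    apply/setP => -[i|j].
      have := congr1 (fun B : {set I} => i \in B) xA.
      by rewrite !finset.inE dotl row_mxKl.
    have := congr1 (fun B : {set J} => j \in B) yA.
    by rewrite !finset.inE dotr row_mxKr.
  split; [exists (lsubmx z)|exists (rsubmx z)] => //.
    by apply/setP => i; rewrite !finset.inE -zA finset.inE dotl.
  by apply/setP => j; rewrite !finset.inE -zA finset.inE dotr.
Qed.

Lemma realizes_cube n : realizes (cube R n) (indep (@cross_rel n)).
Proof.
pose l (x : 'I_n + 'I_n) : 'cV[R]_n :=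
  match x with inl i => delta_mx i 0 | inr i => - delta_mx i 0 end.
pose b (x : 'I_n + 'I_n) : R := if x is inl _ then 1 else 0.
have dl x i : dot x (l (inl i)) = x 0 i by rewrite /dot -colE mxE.
have dr x i : dot x (l (inr i)) = - x 0 i by rewrite /dot mulmxN -colE !mxE.
have cubeP x : cube R n x <-> hpolyhedron l b x.
  split=> [H [i|i]|H i].
  - by rewrite dl; case/andP: (H i).
  - by rewrite dr oppr_le0; case/andP: (H i).
  - by have := H (inl i); have := H (inr i); rewrite dl dr oppr_le0 => -> ->.
exists l, b; split.
- by rewrite predeqE.
- move=> u H; apply/rowP => i; rewrite mxE; apply/eqP; rewrite eq_le.
  by have := H (inl i); have := H (inr i); rewrite dl dr oppr_le0 => -> ->.
- move=> A; split=> [/indepP H|[x /cubeP Px <-]].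
    pose x : 'rV[R]_n := \row_i
      if inl i \in A then 1 else if inr i \in A then 0 else 1 / 2.
    exists x.
      by move=> i; rewrite mxE; case: ifP => _; [|case: ifP => _];
        apply/andP; split; lra.
    apply/setP => -[i|i]; rewrite finset.inE ?dl ?dr mxE /=.
      case: ifP => _; first by rewrite eqxx.
      by case: ifP => _; apply/negbTE/eqP; lra.
    case: ifP => iA; last first.
      case: ifP => _; first by rewrite oppr0 eqxx.
      by apply/negbTE/eqP; lra.
    have := H (inl i) (inr i) iA; rewrite /= eqxx => /contraFF-> //.
    by apply/eqP; lra.
  apply/indepP => -[i|i] [j|j] //= /tightP + /tightP; rewrite ?dl ?dr => xi xj;
    apply/negP => /eqP ij; subst j; move: xi xj => /=; lra.
Qed.

(** An index outside the image of [f] receives the inequality [0 <= 1], valid everywhere and never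
    tight, as its loop demands. *)
Lemma realizes_embed d (P : set 'rV[R]_d) (I J : finType) (e : rel I) (e' : rel J)
    (f : I -> J) : injective f -> (forall x y, e' (f x) (f y) = e x y) ->
  (forall v, v \notin codom f -> e' v v) ->
  realizes P (indep e) -> realizes P (indep e').
Proof.
move=> finj fe fghost [l [b [PE bd HL]]].
pose m v := if [pick i | f i == v] is Some i then l i else 0.
pose c v := if [pick i | f i == v] is Some i then b i else 1.
have mf i : m (f i) = l i.
  by rewrite /m; case: pickP => [j /eqP/finj->//|/(_ i)]; rewrite eqxx.
have cf i : c (f i) = b i.
  by rewrite /c; case: pickP => [j /eqP/finj->//|/(_ i)]; rewrite eqxx.
have notf v : v \notin codom f -> m v = 0 /\ c v = 1.
  move=> vf; rewrite /m /c; case: pickP => // i /eqP fi.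
  by rewrite -fi codom_f in vf.
exists m, c; split.
- rewrite PE predeqE => x; split=> H v; last by rewrite -mf -cf; apply: H.
  have [/codomP[i ->]|/notf[-> ->]] := boolP (v \in codom f).
    by rewrite mf cf; apply: H.
  by rewrite dot0r.
- by move=> u H; apply: bd => i; rewrite -mf; apply: H.
- move=> A; pose B := [set i | f i \in A]%SET.
  have tf x i : (f i \in tight m c x) = (i \in tight l b x).
    by rewrite !finset.inE mf cf.
  have tn x v : v \notin codom f -> v \notin tight m c x.
    by move=> /notf[m0 c1]; rewrite inE m0 c1 dot0r eq_sym oner_eq0.
  split=> [/indepP H|[x Px <-]].
    have /HL[x Px xB] : B \in indep e.
      by apply/indepP => i j; rewrite !finset.inE -fe; apply: H.
    exists x => //; apply/setP => v.
    have [/codomP[i ->]|vf] := boolP (v \in codom f).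
      by rewrite tf xB inE.
    rewrite (negPf (tn _ _ vf)); apply/esym/negbTE/negP => vA.
    by have := H v v vA vA; rewrite fghost.
  have /HL/indepP H : exists2 y, P y & tight l b y = tight l b x by exists x.
  apply/indepP => v w vt wt.
  have /codomP[i vE] : v \in codom f by apply: contraTT vt; exact: tn.
  have /codomP[j wE] : w \in codom f by apply: contraTT wt; exact: tn.
  by move: vt wt; rewrite vE wE fe !tf; apply: H.
Qed.

(* Vertices are the points whose tight set is a maximal member of the complex. *)
Lemma card_vertices d (P : set 'rV[R]_d) (I : finType) (L : {set {set I}}) k
    (M : 'I_k -> {set I}) :
  finset.set0 \in L -> realizes P L -> (forall j, M j \in L) ->
  (forall i j, M i \subset M j -> i = j) ->
  (forall A, A \in L -> exists j, A \subset M j) -> (vertices P #= `I_k)%card.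
Proof.
move=> L0 PL ML Manti Mmax; have polP := realizes_polytope L0 PL.
have [l [b [PE _ HL]]] := PL.
have tc : tight_complex l b P L.
  by rewrite PE; apply: tight_complex_hpolyhedron; rewrite -PE.
have [H HF _] := tc.
have vtight v : vertices P v -> exists2 j, tight l b v = M j &
    [set v] = tight_face l b P (M j).
  move=> Pv; have [x Px vE] : exists2 x, P x & [set v] = tight_face l b P (tight l b x).
    by apply: HF => //; exists v.
  have xv : x = v by have : [set v] x by rewrite vE.
  have /Mmax[j vj] : tight l b v \in L by apply/HL; exists x; rewrite // xv.
  have /HL[y Py yj] := ML j.
  have yv : y = v by have : [set v] y by rewrite vE xv; split; rewrite ?yj.
  by exists j; rewrite -yj yv // vE xv.
have vex j : exists2 v, vertices P v & tight l b v = M j.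
  have /HL[y Py yj] := ML j.
  have [||v Pv [_ jv]] := @face_has_vertex _ _ P (tight_face l b P (M j)) polP.
  - exact: tight_face_faces.
  - by exists y; split; rewrite ?yj.
  exists v => //; have [i vi _] := vtight _ Pv.
  by move: jv; rewrite vi => /Manti->.
pose f v := if [pick j | tight l b v == M j] is Some j then val j else 0%N.
have fE v j : tight l b v = M j -> f v = j.
  move=> vj; rewrite /f; case: pickP => [i|/(_ j)]; rewrite vj ?eqxx // => /eqP E.
  by rewrite (Manti i j) // E.
apply/card_set_bijP; exists f; split.
- by move=> v /vtight[j /fE-> _] /=.
- move=> v w /set_mem/vtight[i vi vE] /set_mem/vtight[j wj wE].
  rewrite (fE _ _ vi) (fE _ _ wj) => /val_inj ij.
  have : [set w] v by rewrite wE -ij -vE.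
  by [].
- move=> j /= jk; have [v Pv vj] := vex (Ordinal jk).
  by exists v => //; rewrite (fE _ _ vj).
Qed.

End Realizations.

(** * Subsets as bit sequences, for finite checks by computation *)

Fixpoint bitseqs k : seq bitseq :=
  if k is k'.+1 then [seq x :: s | x <- [:: true; false], s <- bitseqs k']
  else [:: [::]].

Lemma mem_bitseqs s : s \in bitseqs (size s).
Proof.
elim: s => // x s IH; apply/allpairsP; exists (x, s); split=> //.
by case: x; rewrite !inE.
Qed.

Definition set_of_bits k (s : bitseq) : {set 'I_k} := [set i : 'I_k | nth false s i]%SET.

Definition bits_of_set k (A : {set 'I_k}) : bitseq :=
  mkseq (fun i => if insub i is Some j then j \in A else false) k.

Lemma bits_of_setK k : cancel (@bits_of_set k) (@set_of_bits k).
Proof.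
move=> A; apply/setP => i; rewrite finset.inE nth_mkseq //.
by rewrite (insubT (fun j => j < k)%N (ltn_ord i)) /= (_ : Sub _ _ = i) //; apply/val_inj.
Qed.

Lemma mem_bits_of_set k (A : {set 'I_k}) : bits_of_set A \in bitseqs k.
Proof. by have := mem_bitseqs (bits_of_set A); rewrite size_mkseq. Qed.

Lemma nth_bits_of_set k (A : {set 'I_k}) (i : 'I_k) : nth false (bits_of_set A) i = (i \in A).
Proof. by rewrite -{2}[A]bits_of_setK finset.inE. Qed.

Lemma all_iotaP k (p : pred nat) : reflect (forall i : 'I_k, p i) (all p (iota 0 k)).
Proof.
apply: (iffP allP) => [H i|H i]; first by apply: H; rewrite mem_iota /=.
by rewrite mem_iota /= => ik; have := H (Ordinal ik).
Qed.

Definition pair_rel (E : seq (nat * nat)) : rel nat :=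
  fun i j => ((i, j) \in E) || ((j, i) \in E).

Lemma pair_rel_sym E : symmetric (pair_rel E).
Proof. by move=> i j; rewrite /pair_rel orbC. Qed.

Definition ord_rel k (E : seq (nat * nat)) : rel 'I_k := fun i j => pair_rel E i j.

Lemma ord_rel_sym k E : symmetric (ord_rel (k := k) E).
Proof. by move=> i j; apply: pair_rel_sym. Qed.

Definition indep_bits k (E : seq (nat * nat)) (s : bitseq) : bool :=
  all (fun i => all (fun j => [&& nth false s i, nth false s j & pair_rel E i j] ==> false)
    (iota 0 k)) (iota 0 k).

Lemma indep_bitsP k E (A : {set 'I_k}) :
  (A \in indep (ord_rel E)) = indep_bits k E (bits_of_set A).
Proof.
apply/indepP/all_iotaP => [H i|H i j iA jA].
  apply/all_iotaP => j; rewrite !nth_bits_of_set; apply/implyP => /and3P[iA jA ij].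
  by have := H i j iA jA; rewrite /ord_rel ij.
have /all_iotaP/(_ j) := H i; rewrite !nth_bits_of_set iA jA /=.
by rewrite implybF.
Qed.

(** Decides the hypotheses of [card_vertices] for a proposed list of maximal faces; the test on
    lengths makes [bits_of_set] undo [set_of_bits] on it. *)
Definition maximal_bits k E (M : seq bitseq) : bool :=
  [&& all (indep_bits k E) M,
      all (fun i => all (fun j =>
        all (fun v => nth false (nth [::] M i) v ==> nth false (nth [::] M j) v)
          (iota 0 k) ==> (i == j)) (iota 0 (size M))) (iota 0 (size M)),
      all (fun t => size t == k) M
    & all (fun s => indep_bits k E s ==>
        has (fun t => all (fun v => nth false s v ==> nth false t v) (iota 0 k)) M)
      (bitseqs k)].

(** * Polytopes with rational vertices *)

Section IntegralPolytopes.
Local Open Scope ring_scope.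
Local Open Scope classical_set_scope.
Variable R : realType.

Definition lin d (a : seq int) : 'cV[R]_d := \col_j (a`_j)%:~R.

Definition halfspaces := seq (seq int * int).

Definition row_of (h : halfspaces) i : seq int := (nth ([::], 0) h i).1.
Definition bound_of (h : halfspaces) i : int := (nth ([::], 0) h i).2.

Definition int_polyhedron d (h : halfspaces) : set 'rV[R]_d :=
  @hpolyhedron R d 'I_(size h) (fun i => lin d (row_of h i))
    (fun i => (bound_of h i)%:~R).

Definition int_dot d (x a : seq int) : int :=
  foldr (fun j s => x`_j * a`_j + s) 0 (iota 0 d).

Lemma int_dotE d x a : int_dot d x a = \sum_(j < d) x`_j * a`_j.
Proof. by rewrite -(big_mkord xpredT (fun j => x`_j * a`_j)) unlock /index_iota subn0. Qed.

Definition int_sum d (s : seq (seq int)) : seq int :=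
  mkseq (fun j => foldr (fun v t => v`_j + t) 0 s) d.

(* Every face contains the barycentre of those of the points [v / q], [v \in vs],
   that lie on it; the check is that its tight inequalities are the expected ones. *)
Definition barycentres_ok d (h : halfspaces) E (q : nat) (vs : seq (seq int)) : bool :=
  all (fun s => indep_bits (size h) E s ==>
    let V := [seq v <- vs | all (fun i => nth false s i ==>
      (int_dot d v (row_of h i) == q%:Z * bound_of h i)) (iota 0 (size h))] in
    let n := (size V * q)%N in
    (0 < n)%N && all (fun i =>
      let D := int_dot d (int_sum d V) (row_of h i) in
      let B := n%:Z * bound_of h i in (D <= B) && ((D == B) == nth false s i))
      (iota 0 (size h))) (bitseqs (size h)).

(** The separation hypothesis shows that tight sets are independent; conversely the barycentres
    supply, for each independent set, a point with exactly that tight set. *)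
Lemma realizes_int d (h : halfspaces) (E : seq (nat * nat)) q vs :
  (forall u : 'rV[R]_d, (forall i : 'I_(size h), dot u (lin d (row_of h i)) <= 0) -> u = 0) ->
  (forall (x : 'rV[R]_d) i j, int_polyhedron h x -> (i, j) \in E ->
    dot x (lin d (row_of h i)) = (bound_of h i)%:~R ->
    dot x (lin d (row_of h j)) = (bound_of h j)%:~R -> False) ->
  barycentres_ok d h E q vs ->
  realizes (int_polyhedron (d := d) h) (indep (ord_rel (k := size h) E)).
Proof.
move=> bd sep /allP ok.
exists (fun i : 'I_(size h) => lin d (row_of h i)),
  (fun i : 'I_(size h) => (bound_of h i)%:~R); split=> // A.
split=> [|[x Px <-]]; last first.
  apply/indepP => i j /tightP xi /tightP xj; apply/negP => /orP[] ij.
    exact: (sep _ _ _ Px ij xi xj).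
  exact: (sep _ _ _ Px ij xj xi).
rewrite indep_bitsP => sA.
have := ok _ (mem_bits_of_set A); rewrite sA /=.
set V := [seq v <- vs | _]; set n := (size V * q)%N => /andP[n0 /all_iotaP H].
(* The points are stored as numerators over [q], so the mean of [size V] of them has denominator
   [size V * q]. *)
pose x : 'rV[R]_d := \row_j (((int_sum d V)`_j)%:~R / n%:R).
have nR : 0 < n%:R :> R by rewrite ltr0n.
have xE (i : 'I_(size h)) :
    dot x (lin d (row_of h i)) = (int_dot d (int_sum d V) (row_of h i))%:~R / n%:R.
  rewrite dotE int_dotE rmorph_sum /= mulr_suml; apply: eq_bigr => j _.
  by rewrite !mxE intrM mulrAC.
exists x.
  move=> i; have /andP[le _] := H i.
  by rewrite xE ler_pdivrMr // mulrC -[n%:R]/((n%:Z)%:~R) -intrM ler_int.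
apply/setP => i; have /andP[_ /eqP] := H i; rewrite nth_bits_of_set => <-.
have nn0 : n%:R != 0 :> R by rewrite gt_eqF.
rewrite finset.inE xE; apply/eqP/eqP => [/(canRL (divfK nn0)) e|->].
  by apply/eqP; rewrite -(eqr_int R) intrM e mulrC.
by rewrite intrM mulrC mulKf.
Qed.

Lemma card_vertices_bits d (P : set 'rV[R]_d) k E M :
  realizes P (indep (ord_rel (k := k) E)) -> maximal_bits k E M ->
  (vertices P #= `I_(size M))%card.
Proof.
move=> PE /and4P[/allP MI /all_iotaP Manti /allP Msize /allP Mmax].
have MK (j : 'I_(size M)) : bits_of_set (set_of_bits k (nth [::] M j)) = nth [::] M j.
  have /eqP sz := Msize _ (mem_nth [::] (ltn_ord j)).
  apply: (@eq_from_nth _ false); rewrite ?size_mkseq ?sz // => i ik.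
  by rewrite (nth_bits_of_set _ (Ordinal ik)) finset.inE.
apply: (card_vertices (M := fun j => set_of_bits k (nth [::] M j))) PE _ _ _.
- by have [] := indep_complex (ord_rel (k := k) E).
- by move=> j; rewrite indep_bitsP MK; apply/MI/mem_nth.
- move=> i j /fintype.subsetP ij; apply/val_inj/eqP.
  have /all_iotaP/(_ j)/implyP := Manti i; apply.
  by apply/all_iotaP => v; apply/implyP; have := ij v; rewrite !finset.inE.
- move=> A; rewrite indep_bitsP => sA.
  have /implyP/(_ sA)/hasP[t tM At] := Mmax _ (mem_bits_of_set A).
  have tj : (index t M < size M)%N by rewrite index_mem.
  exists (Ordinal tj); apply/fintype.subsetP => v vA.
  rewrite finset.inE /= nth_index //.
  by have /all_iotaP/(_ v) := At; rewrite nth_bits_of_set vA.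
Qed.

End IntegralPolytopes.

(** * The pentagon, the hexagon and the twice-cut cube *)

Section Bases.
Local Open Scope ring_scope.
Local Open Scope classical_set_scope.
Variable R : realType.

Lemma int_polyhedron_le d (h : halfspaces) (x : 'rV[R]_d) i :
  int_polyhedron h x -> (i < size h)%N ->
  dot x (lin R d (row_of h i)) <= (bound_of h i)%:~R.
Proof. by move=> Px ih; apply: (Px (Ordinal ih)). Qed.

Lemma dot_lin2 (x : 'rV[R]_2) a b :
  dot x (lin R 2 [:: a; b]) = x 0 0 * a%:~R + x 0 1 * b%:~R.
Proof.
rewrite dotE big_ord_recl big_ord1 !mxE /=; congr (_ + x 0 _ * _).
exact/val_inj.
Qed.

Lemma dot_lin3 (x : 'rV[R]_3) a b c :
  dot x (lin R 3 [:: a; b; c]) = x 0 0 * a%:~R + x 0 1 * b%:~R + x 0 2%:R * c%:~R.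
Proof.
rewrite dotE !big_ord_recl big_ord0 !mxE /= addr0 addrA.
by congr (_ + x 0 _ * _ + x 0 _ * _); exact/val_inj.
Qed.

Lemma rowP2 (x : 'rV[R]_2) : x 0 0 = 0 -> x 0 1 = 0 -> x = 0.
Proof.
move=> x0 x1; apply/rowP => -[[|[|//]] ilt]; rewrite [RHS]mxE;
  [rewrite -[RHS]x0|rewrite -[RHS]x1]; by congr (x 0 _); apply/val_inj.
Qed.

Lemma rowP3 (x : 'rV[R]_3) : x 0 0 = 0 -> x 0 1 = 0 -> x 0 2%:R = 0 -> x = 0.
Proof.
move=> x0 x1 x2; apply/rowP => -[[|[|[|//]]] ilt]; rewrite [RHS]mxE;
  [rewrite -[RHS]x0|rewrite -[RHS]x1|rewrite -[RHS]x2]; by congr (x 0 _); apply/val_inj.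
Qed.

(** The unit square with the corner [(1, 1)] cut off by [x + y <= 3/2]. *)
Definition pentagon_halfspaces : halfspaces :=
  [:: ([:: -1; 0], 0); ([:: 1; 0], 1); ([:: 0; -1], 0); ([:: 0; 1], 1);
      ([:: 2; 2], 3)].

Definition pentagon_nonedges : seq (nat * nat) :=
  [:: (0, 1); (2, 3); (1, 3); (0, 4); (2, 4)]%N.

Lemma realizes_pentagon :
  realizes (@int_polyhedron R 2 pentagon_halfspaces)
    (indep (ord_rel (k := 5) pentagon_nonedges)).
Proof.
apply: (@realizes_int R 2 pentagon_halfspaces _ 2
  [:: [:: 0; 0]; [:: 2; 0]; [:: 2; 1]; [:: 1; 2]; [:: 0; 2]]).
- move=> u H.
  have := H (Ordinal (isT : 0 < 5)%N).
  have := H (Ordinal (isT : 1 < 5)%N).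
  have := H (Ordinal (isT : 2 < 5)%N).
  have := H (Ordinal (isT : 3 < 5)%N).
  rewrite /row_of /= !dot_lin2 => *; apply: rowP2; lra.
- move=> x i j Px.
  have := int_polyhedron_le (i := 0) Px isT.
  have := int_polyhedron_le (i := 1) Px isT.
  have := int_polyhedron_le (i := 2) Px isT.
  have := int_polyhedron_le (i := 3) Px isT.
  have := int_polyhedron_le (i := 4) Px isT.
  rewrite /row_of /bound_of /= !dot_lin2 => h0 h1 h2 h3 h4.
  by rewrite !inE; do ?[case/orP]; move=> /eqP[-> ->] /=; rewrite !dot_lin2; lra.
- by vm_compute.
Qed.

(** Here the corner [(0, 0)] is cut off too, by [x + y >= 1/2]. *)
Definition hexagon_halfspaces : halfspaces :=
  [:: ([:: -1; 0], 0); ([:: 1; 0], 1); ([:: 0; -1], 0); ([:: 0; 1], 1);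
      ([:: 2; 2], 3); ([:: -2; -2], -1)].

Definition hexagon_nonedges : seq (nat * nat) :=
  [:: (0, 1); (2, 3); (1, 3); (0, 4); (2, 4); (4, 5); (0, 2); (1, 5); (3, 5)]%N.

Lemma realizes_hexagon :
  realizes (@int_polyhedron R 2 hexagon_halfspaces)
    (indep (ord_rel (k := 6) hexagon_nonedges)).
Proof.
apply: (@realizes_int R 2 hexagon_halfspaces _ 2
  [:: [:: 1; 0]; [:: 2; 0]; [:: 2; 1]; [:: 1; 2]; [:: 0; 2]; [:: 0; 1]]).
- move=> u H.
  have := H (Ordinal (isT : 0 < 6)%N).
  have := H (Ordinal (isT : 1 < 6)%N).
  have := H (Ordinal (isT : 2 < 6)%N).
  have := H (Ordinal (isT : 3 < 6)%N).
  rewrite /row_of /= !dot_lin2 => *; apply: rowP2; lra.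
- move=> x i j Px.
  have := int_polyhedron_le (i := 0) Px isT.
  have := int_polyhedron_le (i := 1) Px isT.
  have := int_polyhedron_le (i := 2) Px isT.
  have := int_polyhedron_le (i := 3) Px isT.
  have := int_polyhedron_le (i := 4) Px isT.
  have := int_polyhedron_le (i := 5) Px isT.
  rewrite /row_of /bound_of /= !dot_lin2 => h0 h1 h2 h3 h4 h5.
  by rewrite !inE; do ?[case/orP]; move=> /eqP[-> ->] /=; rewrite !dot_lin2; lra.
- by vm_compute.
Qed.

(** The cube with the edges [x = y = 1] and [y = z = 1] cut off by [x + y <= 3/2] and
    [y + z <= 7/4]. The second plane is closer to its edge because [y + z = 3/2] would pass through
    the vertex [(1, 1/2, 1)] created by the first cut. *)
Definition two_cuts_halfspaces : halfspaces :=
  [:: ([:: -1; 0; 0], 0); ([:: 1; 0; 0], 1); ([:: 0; -1; 0], 0); ([:: 0; 1; 0], 1);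
      ([:: 0; 0; -1], 0); ([:: 0; 0; 1], 1); ([:: 2; 2; 0], 3); ([:: 0; 4; 4], 7)].

Definition two_cuts_nonedges : seq (nat * nat) :=
  [:: (0, 1); (2, 3); (4, 5); (1, 3); (3, 5); (0, 6); (2, 6); (4, 7); (2, 7); (1, 7)]%N.

Lemma realizes_two_cuts :
  realizes (@int_polyhedron R 3 two_cuts_halfspaces)
    (indep (ord_rel (k := 8) two_cuts_nonedges)).
Proof.
apply: (@realizes_int R 3 two_cuts_halfspaces _ 4
  [:: [:: 0; 0; 0]; [:: 0; 0; 4]; [:: 0; 3; 4]; [:: 0; 4; 0]; [:: 0; 4; 3]; [:: 2; 4; 0];
      [:: 2; 4; 3]; [:: 3; 3; 4]; [:: 4; 0; 0]; [:: 4; 0; 4]; [:: 4; 2; 0]; [:: 4; 2; 4]]).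
- move=> u H.
  have := H (Ordinal (isT : 0 < 8)%N).
  have := H (Ordinal (isT : 1 < 8)%N).
  have := H (Ordinal (isT : 2 < 8)%N).
  have := H (Ordinal (isT : 3 < 8)%N).
  have := H (Ordinal (isT : 4 < 8)%N).
  have := H (Ordinal (isT : 5 < 8)%N).
  rewrite /row_of /= !dot_lin3 => *; apply: rowP3; lra.
- move=> x i j Px.
  have := int_polyhedron_le (i := 0) Px isT.
  have := int_polyhedron_le (i := 1) Px isT.
  have := int_polyhedron_le (i := 2) Px isT.
  have := int_polyhedron_le (i := 3) Px isT.
  have := int_polyhedron_le (i := 4) Px isT.
  have := int_polyhedron_le (i := 5) Px isT.
  have := int_polyhedron_le (i := 6) Px isT.
  have := int_polyhedron_le (i := 7) Px isT.
  rewrite /row_of /bound_of /= !dot_lin3 => h0 h1 h2 h3 h4 h5 h6 h7.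
  by rewrite !inE; do ?[case/orP]; move=> /eqP[-> ->] /=; rewrite !dot_lin3; lra.
- by vm_compute.
Qed.

Lemma polygon_pentagon : polygon 5 (@int_polyhedron R 2 pentagon_halfspaces).
Proof.
split; first by apply: realizes_polytope realizes_pentagon; exact: (indep_complex _).1.
by apply: (card_vertices_bits (M :=
  [:: [:: true; false; true; false; false];
    [:: false; true; true; false; false];
    [:: true; false; false; true; false];
    [:: false; true; false; false; true];
    [:: false; false; false; true; true]]) realizes_pentagon); vm_compute.
Qed.

Lemma polygon_hexagon : polygon 6 (@int_polyhedron R 2 hexagon_halfspaces).
Proof.
split; first by apply: realizes_polytope realizes_hexagon; exact: (indep_complex _).1.
by apply: (card_vertices_bits (M :=
  [:: [:: false; true; true; false; false; false];
    [:: true; false; false; true; false; false];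
    [:: false; true; false; false; true; false];
    [:: false; false; false; true; true; false];
    [:: true; false; false; false; false; true];
    [:: false; false; true; false; false; true]]) realizes_hexagon); vm_compute.
Qed.

End Bases.

(** * The twice-cut cube as a result of two edge cuts *)

Section TwoCuts.
Local Open Scope ring_scope.
Local Open Scope classical_set_scope.
Variable R : realType.

(** For maximality: a functional that is constant on this face takes the same value at [e_i] and
    [e_i + e_j], so it is a multiple of the [i]-th coordinate. *)
Lemma cube_facet n (i : 'I_n) : facet (cube R n) (cube R n `&` [set x | x 0 i = 1]).
Proof.
have d1 (x : 'rV[R]_n) : dot x (delta_mx i 0) = x 0 i by rewrite /dot -colE mxE.
have e_in : cube R n (delta_mx 0 i).
  by move=> k; rewrite mxE eqxx /=; case: (k == i); rewrite ?lexx ?ler01.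
split.
- exists (delta_mx i 0), 1; split=> [x Px|].
    by rewrite -/(dot _ _) d1; case/andP: (Px i).
  by rewrite predeqE => x; split=> -[Px] /= xi; split=> //=; move: xi;
    rewrite -/(dot _ _) d1.
- have P0 : cube R n 0 by move=> k; rewrite mxE lexx ler01.
  by move=> E; move: P0; rewrite -E => -[_ /=]; rewrite mxE => /esym/eqP; rewrite oner_eq0.
move=> _ [c [b [H ->]]] GP FG.
have onF x : cube R n x -> x 0 i = 1 -> dot x c = b.
  by move=> Px xi; have [] := FG x (conj Px xi).
have ci : c i 0 = b.
  by rewrite -(dot_delta i) onF // mxE !eqxx.
have cj j : j != i -> c j 0 = 0.
  move=> ji; have : dot (delta_mx 0 i + delta_mx 0 j) c = b.
    apply: onF => [k|]; rewrite !mxE !eqxx /= ?[i == j]eq_sym ?(negPf ji) ?addr0 //.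
    have [->|_] := eqVneq k i; first by rewrite eq_sym (negPf ji) addr0 ler01 lexx.
    by rewrite add0r; case: (k == j); rewrite ?lexx ?ler01.
  by rewrite dotDl !dot_delta ci; lra.
have dE x : dot x c = x 0 i * b.
  rewrite dotE (bigD1 i) //= ci big1 ?addr0 // => j ji.
  by rewrite cj // mulr0.
have b0 : b != 0.
  apply/eqP => b0; apply: GP; rewrite predeqE => x; split=> [[]//|Px].
  by split=> //=; rewrite -/(dot _ _) dE b0 mulr0.
rewrite predeqE => x; split=> -[Px] /= xi; split=> //=; move: xi.
  rewrite -/(dot _ _) dE -{2}[b]mul1r; exact: mulIf.
by rewrite -/(dot _ _) dE => ->; rewrite mul1r.
Qed.

Lemma cube3P (x : 'rV[R]_3) : cube R 3 x <->
  [/\ 0 <= x 0 0 <= 1, 0 <= x 0 1 <= 1 & 0 <= x 0 2%:R <= 1].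
Proof.
split=> [H|[h0 h1 h2]]; first by split; apply: H.
move=> -[[|[|[|//]]] ilt].
- by rewrite (_ : Ordinal ilt = 0) //; exact/val_inj.
- by rewrite (_ : Ordinal ilt = 1) //; exact/val_inj.
- by rewrite (_ : Ordinal ilt = 2%:R) //; exact/val_inj.
Qed.

(* [v_i (1 - v_i)] is a step that stays in the cube in both directions. *)
Lemma unit_interval_step (t : R) : 0 <= t <= 1 ->
  0 <= t + t * (1 - t) <= 1 /\ 0 <= t - t * (1 - t) <= 1.
Proof. by move=> /andP[t0 t1]; split; apply/andP; split; nra. Qed.

Definition vec3 (a b c : R) : 'rV[R]_3 := \row_j [:: a; b; c]`_j.

Lemma vec3E a b c : [/\ vec3 a b c 0 0 = a, vec3 a b c 0 1 = b & vec3 a b c 0 2%:R = c].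
Proof. by split; rewrite mxE. Qed.

Lemma lin3E (x : 'rV[R]_3) a b c : (x *m lin R 3 [:: a; b; c]) 0 0 =
  x 0 0 * a%:~R + x 0 1 * b%:~R + x 0 2%:R * c%:~R.
Proof. exact: dot_lin3. Qed.

(** General position is tested at the vertices of the polytope to be cut. They are located by
    [vertex_extreme]: a point that can move both ways along some direction is no vertex. *)
Lemma Q23_two_cuts : Q23 (@int_polyhedron R 3 two_cuts_halfspaces).
Proof.
pose F (i : 'I_3) := cube R 3 `&` [set x | x 0 i = 1].
pose T := cube R 3 `&` [set x | (x *m lin R 3 [:: 2; 2; 0]) 0 0 <= 3].
have cT (x : 'rV[R]_3) : (x *m lin R 3 [:: 2; 2; 0]) 0 0 = 2 * x 0 0 + 2 * x 0 1.
  by rewrite lin3E; ring.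
have cQ (x : 'rV[R]_3) : (x *m lin R 3 [:: 0; 4; 4]) 0 0 = 4 * x 0 1 + 4 * x 0 2%:R.
  by rewrite lin3E; ring.
exists (F 0), (F 1), (F 2%:R), T; split.
- by split; exact: cube_facet.
- have [a0 a1 a2] := vec3E 1 0 0; have [b0 b1 b2] := vec3E 0 1 0.
  have aF : F 0 (vec3 1 0 0) by split => //; apply/cube3P; rewrite a0 a1 a2; split; lra.
  have bF : F 1 (vec3 0 1 0) by split => //; apply/cube3P; rewrite b0 b1 b2; split; lra.
  by split=> E; [move: aF|move: bF|move: aF]; rewrite E => -[_ /=]; rewrite ?a1 ?b2 ?a2; lra.
- have [a0 a1 a2] := vec3E 1 1 1.
  have av : cube R 3 (vec3 1 1 1) by apply/cube3P; rewrite a0 a1 a2; split; lra.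
  exists (vec3 1 1 1); last by split; first split.
  exists (lin R 3 [:: 1; 1; 1]), 3; split=> [x /cube3P[*]|].
    by rewrite lin3E; lra.
  rewrite predeqE => x; split=> [->|[/cube3P[h0 h1 h2] /=]].
    by split=> //=; rewrite lin3E a0 a1 a2; lra.
  rewrite lin3E => h3; apply/eqP; rewrite -subr_eq0; apply/eqP.
  by apply: rowP3; rewrite !mxE /=; lra.
- split.
    exists (lin R 3 [:: 1; 1; 0]), 2; split=> [x /cube3P[*]|].
      by rewrite lin3E; lra.
    rewrite predeqE => x; split=> [[[Px /= h0] [_ /= h1]]|[Px /=]].
      by split=> //=; rewrite lin3E; lra.
    have /cube3P[h0 h1 h2] := Px; rewrite lin3E => h3.
    by split; split=> //=; lra.
  exists (lin R 3 [:: 2; 2; 0]), 3; split=> // [v vv [[_ /= h0] [_ /= h1]]|v vv nF].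
    by rewrite cT h0 h1; lra.
  have Pv := vertex_mem vv.
  have v01 i : v 0 i = 0 \/ v 0 i = 1.
    pose u : 'rV[R]_3 := (v 0 i * (1 - v 0 i)) *: delta_mx 0 i.
    have uE k : u 0 k = if k == i then v 0 k * (1 - v 0 k) else 0.
      by rewrite !mxE eqxx; case: eqVneq => [->|]; rewrite ?mulr1 ?mulr0.
    have u0 : u = 0.
      apply: (vertex_extreme vv) => k; rewrite mxE ?[(- u) _ _]mxE uE;
      case: ifP => _; rewrite ?subr0 ?addr0 //;
      by have [] := unit_interval_step (Pv k).
    have := uE i; rewrite u0 mxE eqxx => /esym/eqP; rewrite mulf_eq0 subr_eq0.
    by case/orP => /eqP; [left|right].
  rewrite cT; case: (v01 0) (v01 1) => [h0|h0] [h1|h1]; rewrite h0 h1; try lra.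
  by case: nF; split; split.
split.
  exists (lin R 3 [:: 0; 1; 1]), 2; split=> [x [/cube3P[h0 h1 h2] _]|].
    by rewrite lin3E; lra.
  rewrite predeqE => x; split=> [[[[Px /= h0] [_ /= h1]] Tx]|[Tx /=]].
    by split=> //=; rewrite lin3E; lra.
  have [Px _] := Tx; have /cube3P[h0 h1 h2] := Px; rewrite lin3E => h3.
  by split=> //; split; split=> //=; lra.
exists (lin R 3 [:: 0; 4; 4]), 7; split.
- by move=> v vv [[[_ /= h0] [_ /= h1]] _]; rewrite cQ h0 h1; lra.
- move=> v vv nF; have Tv := vertex_mem vv; have [Pv] := Tv; rewrite /= cT => hT.
  have /cube3P[h0 h1 h2] := Pv.
  have TP x : T x <-> cube R 3 x /\ 2 * x 0 0 + 2 * x 0 1 <= 3.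
    by rewrite -cT.
  have step a b c : T (v + vec3 a b c) -> T (v - vec3 a b c) -> [/\ a = 0, b = 0 & c = 0].
    move=> Tp Tm; have := vertex_extreme vv Tp Tm => u0.
    have [E0 E1 E2] := vec3E a b c; rewrite u0 !mxE in E0 E1 E2.
    by split; apply/esym.
  have TPp a b c : T (v + vec3 a b c) <-> [/\ 0 <= v 0 0 + a <= 1,
      0 <= v 0 1 + b <= 1, 0 <= v 0 2%:R + c <= 1 &
      2 * (v 0 0 + a) + 2 * (v 0 1 + b) <= 3].
    rewrite TP (propext (cube3P _)) !mxE /=.
    by split=> [[[]]|[]].
  have TPm a b c : T (v - vec3 a b c) <-> [/\ 0 <= v 0 0 - a <= 1,
      0 <= v 0 1 - b <= 1, 0 <= v 0 2%:R - c <= 1 &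
      2 * (v 0 0 - a) + 2 * (v 0 1 - b) <= 3].
    rewrite TP (propext (cube3P _)) !mxE /=.
    by split=> [[[]]|[]].
  rewrite cQ.
  (* The first cut does not involve the third coordinate, which is therefore 0 or 1 at a vertex of
     [T] as well. *)
  have [z01 z01'] := unit_interval_step h2.
  have [||_ _ /eqP] := step 0 0 (v 0 2%:R * (1 - v 0 2%:R)).
  + by apply/TPp; split=> //; lra.
  + by apply/TPm; split=> //; lra.
  rewrite mulf_eq0 subr_eq0 => /orP[/eqP z|/eqP z]; first by rewrite z; lra.
  have y1 : v 0 1 < 1.
    rewrite lt_neqAle; apply/andP; split; last by case/andP: h1.
    apply/eqP => y; apply: nF; split=> //; split; split=> //=; exact: esym.
  rewrite -z ltNge; apply/negP => h3.
  (* Now [v 0 1] is at least 3/4. On the first cut plane, [v 0 0] is then between 1/2 and 3/4, and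
     [v] can slide along the plane in both directions; off it, the second coordinate alone can
     move. *)
  have [xy|xy] := eqVneq (2 * v 0 0 + 2 * v 0 1) 3.
    have [||] := step ((1 - v 0 1) / 4) (- ((1 - v 0 1) / 4)) 0.
    * by apply/TPp; split; lra.
    * by apply/TPm; split; lra.
    by move=> *; lra.
  have xy' : 2 * v 0 0 + 2 * v 0 1 < 3 by rewrite lt_neqAle xy.
  have [e [e0 e1 e2]] : exists e : R, [/\ 0 < e, e <= 1 - v 0 1 &
      2 * e <= 3 - (2 * v 0 0 + 2 * v 0 1)].
    exists (Num.min (1 - v 0 1) ((3 - (2 * v 0 0 + 2 * v 0 1)) / 2)); split.
    * by rewrite lt_min; apply/andP; split; lra.
    * by rewrite ge_min lexx.
    * by rewrite mulrC -ler_pdivlMr // ge_min lexx orbT.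
  have [||_ E _] := step 0 e 0.
  * by apply/TPp; split; lra.
  * by apply/TPm; split; lra.
  by rewrite E ltxx in e0.
- rewrite predeqE => x; split=> [Px|[[/cube3P[h0 h1 h2] /=]]].
  have := int_polyhedron_le (i := 0) Px isT.
  have := int_polyhedron_le (i := 1) Px isT.
  have := int_polyhedron_le (i := 2) Px isT.
  have := int_polyhedron_le (i := 3) Px isT.
  have := int_polyhedron_le (i := 4) Px isT.
  have := int_polyhedron_le (i := 5) Px isT.
  have := int_polyhedron_le (i := 6) Px isT.
  have := int_polyhedron_le (i := 7) Px isT.
  rewrite /row_of /bound_of /= !dot_lin3 => h7 h6 h5 h4 h3 h2 h1 h0.
  by split; [split; [apply/cube3P; split|rewrite /= cT]|rewrite /= cQ]; lra.
rewrite cT cQ => h3 h4 -[[|[|[|[|[|[|[|[|//]]]]]]]] ilt];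
  by rewrite /row_of /bound_of /= dot_lin3; lra.
Qed.

End TwoCuts.

(** * Nestohedra *)

Section Nestohedra.
Local Open Scope ring_scope.
Local Open Scope classical_set_scope.
Variable R : realType.
Variables (n : nat) (B : {set {set 'I_n.+1}}) (I : finType) (s : I -> {set 'I_n.+1}).
Implicit Types (S : {set 'I_n.+1}) (c : 'I_n.+1 -> R).

(* The facets of the nestohedron, indexed by [s], that contain its face of
   maximisers of [c]: [S] is one of them when it is a maximal member of [B] on
   which [c] does not exceed its maximum over [S]. *)
Definition nested_tight c : {set I} :=
  [set i | [forall S in B, (s i \proper S) ==>
     [exists j in S, [forall k in s i, c k < c j]]]]%SET.

Lemma nested_tightP c i : reflect
  (forall S, S \in B -> s i \proper S ->
     exists2 j, j \in S & forall k, k \in s i -> c k < c j)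
  (i \in nested_tight c).
Proof.
rewrite inE; apply: (iffP forall_inP) => H S SB.
  move=> sS; have /implyP/(_ sS)/exists_inP[j jS /forall_inP jP] := H S SB.
  by exists j.
apply/implyP => sS; have [j jS jP] := H S SB sS.
by apply/exists_inP; exists j => //; apply/forall_inP.
Qed.

(** [L] is described through functionals, that is, through the normal fan; [nest_tight_complex]
    translates this into tight sets of points. *)
Definition nest_realizes (L : {set {set I}}) : Prop :=
  [/\ connected_building_set B, forall i, s i \in B /\ s i != [set: _]%SET,
      forall S, S \in B -> S != [set: _]%SET -> exists i, s i = S
    & forall A, A \in L <-> exists c, nested_tight c = A].

Lemma simplexP S (y : 'rV[R]_n.+1) : face_of_standard_simplex (R := R) S y <->
  [/\ forall j, 0 <= y 0 j, forall j, j \notin S -> y 0 j = 0 & \sum_j y 0 j = 1].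
Proof.
split=> [/conv_hullP[t [t0 tS t1 yE]]|[y0 yS y1]].
  have yt j : y 0 j = t j.
    rewrite yE summxE (bigD1 j) //= !mxE !eqxx mulr1 big1 ?addr0 // => k kj.
    by rewrite !mxE eqxx eq_sym (negPf kj) mulr0.
  split=> [j|j|]; rewrite ?yt //; first exact: tS.
  by rewrite -t1; apply: eq_bigr.
by apply/conv_hullP; exists (y 0); split=> //; exact: row_sum_delta.
Qed.

Definition facet_normal i : 'cV[R]_n.+1 := \col_j - (j \in s i)%:R.
(** The standard facet inequality of a nestohedron, negated into an upper bound: the mass in [s i]
    is at least the number of members of [B] inside [s i]. *)
Definition facet_bound i : R := - \sum_(S in B) (S \subset s i)%:R.

Lemma dot_facet_normal y i : dot y (facet_normal i) = - \sum_(j in s i) y 0 j.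
Proof.
rewrite dotE -sumrN [RHS]big_mkcond /=; apply: eq_bigr => j _.
by rewrite mxE; case: ifP; rewrite ?mulrN ?mulr1 ?mulr0 ?oppr0.
Qed.

(** The total mass is one: it lies entirely in [s i] if [S] does, and otherwise zero is the natural
    lower bound. *)
Lemma simplex_mass S y i : face_of_standard_simplex (R := R) S y ->
  (S \subset s i)%:R <= \sum_(j in s i) y 0 j ?= iff
    (S \subset s i) || [forall j in s i, y 0 j == 0].
Proof.
move=> /simplexP[y0 yS y1]; case: (boolP (S \subset s i)) => Ss /=.
  suff -> : \sum_(j in s i) y 0 j = 1 by split; rewrite ?lexx ?eqxx.
  rewrite -y1 [RHS](bigID (mem (s i))) /= [X in _ + X]big1 ?addr0 // => j jsi.
  by apply: yS; apply: contra jsi; exact: (fintype.subsetP Ss).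
split; first exact: sumr_ge0.
rewrite eq_sym psumr_eq0 //; apply/allP/forall_inP => H j.
  by move=> js; have := H j (mem_index_enum _); rewrite js.
by move=> _; apply/implyP/H.
Qed.

Section Decomposition.
Variables (x : 'rV[R]_n.+1) (y : {set 'I_n.+1} -> 'rV[R]_n.+1).
Hypothesis ysimplex : forall S, S \in B -> face_of_standard_simplex (R := R) S (y S).
Hypothesis xE : x = \sum_(S in B) y S.

Lemma dot_decomposition i : dot x (facet_normal i) =
  - \sum_(S in B) \sum_(j in s i) y S 0 j.
Proof. by rewrite xE dot_suml -sumrN; apply: eq_bigr => S _; rewrite dot_facet_normal. Qed.

Lemma facet_normal_le i : dot x (facet_normal i) <= facet_bound i.
Proof.
rewrite dot_decomposition lerN2; apply: ler_sum => S SB.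
exact: simplex_mass (ysimplex SB).
Qed.

(** A sum of inequalities is tight exactly if each one is, so the equality cases of [simplex_mass]
    can be read off from any decomposition of [x]. *)
Lemma tight_decomposition i : i \in tight facet_normal facet_bound x <->
  forall S j, S \in B -> ~~ (S \subset s i) -> j \in s i -> y S 0 j = 0.
Proof.
have E : (dot x (facet_normal i) == facet_bound i) =
    [forall (S | S \in B), (S \subset s i) || [forall j in s i, y S 0 j == 0]].
  rewrite dot_decomposition eqr_opp eq_sym.
  have := @leif_sum R _ (fun S => S \in B) (fun S =>
    (S \subset s i) || [forall j in s i, y S 0 j == 0])
    (fun S => (S \subset s i)%:R) (fun S => \sum_(j in s i) y S 0 j)
    (fun S SB => simplex_mass i (ysimplex SB)).
  by case.
rewrite inE E; split=> [/forall_inP H S j SB Ss js|H].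
  by have := H S SB; rewrite (negPf Ss) => /forall_inP/(_ j js)/eqP.
apply/forall_inP => S SB; case: (boolP (S \subset s i)) => //= Ss.
by apply/forall_inP => j js; apply/eqP/H.
Qed.

End Decomposition.

Section Face.
Variable c : 'cV[R]_n.+1.
Hypothesis connB : connected_building_set B.

Let argmax S : {set 'I_n.+1} := [set j in S | [forall k in S, c k 0 <= c j 0]]%SET.

Lemma argmaxP S j : reflect (j \in S /\ forall k, k \in S -> c k 0 <= c j 0)
  (j \in argmax S).
Proof.
by rewrite inE; apply: (iffP andP) => -[jS /forall_inP].
Qed.

Lemma argmax_exists S : S \in B -> exists j, j \in argmax S.
Proof.
have [B0 _ _ _] := connB; move=> SB.
have /finset.set0Pn[j0 j0S] : S != finset.set0 by apply: contraNneq B0 => <-.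
have [j jS jmax] := @Order.TotalTheory.arg_maxP _ R _ j0 (mem S) (fun j => c j 0) j0S.
by exists j; apply/argmaxP; split.
Qed.

Let mu S : R := if [pick j in argmax S] is Some j then c j 0 else 0.

Lemma muE S j : j \in argmax S -> mu S = c j 0.
Proof.
move=> /argmaxP[jS jmax]; rewrite /mu; case: pickP => [k /argmaxP[kS kmax]|/(_ j)].
  by apply/eqP; rewrite eq_le kmax // jmax.
by rewrite (introT (argmaxP S j)).
Qed.

Lemma mu_ge S j : S \in B -> j \in S -> c j 0 <= mu S.
Proof.
move=> SB jS; have [k kmax] := argmax_exists SB.
by rewrite (muE kmax); have /argmaxP[_] := kmax; apply.
Qed.

Lemma mu_argmax S j : S \in B -> j \in S -> (j \in argmax S) = (c j 0 == mu S).
Proof.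
move=> SB jS; apply/idP/eqP => [/muE//|cj].
by apply/argmaxP; split=> // k kS; rewrite cj mu_ge.
Qed.

Lemma dot_simplex S y : S \in B -> face_of_standard_simplex (R := R) S y ->
  dot y c <= mu S ?= iff [forall j, (j \notin argmax S) ==> (y 0 j == 0)].
Proof.
move=> SB /simplexP[y0 yS y1].
have -> : mu S = \sum_j y 0 j * mu S by rewrite -mulr_suml y1 mul1r.
rewrite dotE; apply: leif_sum => j _.
have [jS|jS] := boolP (j \in S); last first.
  by rewrite yS // !mul0r eqxx implybT; split; rewrite ?lexx ?eqxx.
split; first by apply: ler_wpM2l => //; exact: mu_ge.
rewrite mu_argmax // -subr_eq0 -mulrBr mulf_eq0 subr_eq0 orbC.
by case: (c j 0 == mu S).
Qed.

(** A relative interior point of the face maximizing [c]: the sum of the barycentres of the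
    maximizing faces of the summands. *)
Definition face_center : 'rV[R]_n.+1 :=
  \sum_(S in B) \row_j ((j \in argmax S)%:R / #|argmax S|%:R).

Lemma argmax_center S : S \in B ->
  face_of_standard_simplex (R := R) S
    (\row_j ((j \in argmax S)%:R / #|argmax S|%:R)).
Proof.
move=> SB; apply/simplexP; split=> [j|j jS|].
- by rewrite mxE divr_ge0.
- rewrite mxE (_ : j \in argmax S = false) ?mul0r //.
  by apply/negbTE; apply: contra jS => /argmaxP[].
- under eq_bigr do rewrite mxE.
  have cardE : \sum_j (j \in argmax S)%:R = #|argmax S|%:R :> R.
    by rewrite -sum1_card natr_sum [RHS]big_mkcond; apply: eq_bigr => j _; case: ifP.
  rewrite -mulr_suml cardE divff // pnatr_eq0.
  have [j jmax] := argmax_exists SB.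
  by rewrite -lt0n; apply/card_gt0P; exists j.
Qed.

Lemma center_neq0 S j : S \in B -> j \in argmax S ->
  (\row_j ((j \in argmax S)%:R / #|argmax S|%:R) : 'rV[R]_n.+1) 0 j != 0.
Proof.
move=> SB jmax; rewrite mxE jmax mul1r invr_eq0 pnatr_eq0 -lt0n.
by apply/card_gt0P; exists j.
Qed.

Lemma minkowski_dot_le x (y : {set 'I_n.+1} -> 'rV[R]_n.+1) :
  (forall S, S \in B -> face_of_standard_simplex S (y S)) ->
  x = \sum_(S in B) y S -> dot x c <= \sum_(S in B) mu S ?= iff
    [forall (S | S \in B), [forall j, (j \notin argmax S) ==> (y S 0 j == 0)]].
Proof.
move=> ys ->; rewrite dot_suml; apply: leif_sum => S SB.
by apply: dot_simplex => //; apply: ys.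
Qed.

Lemma center_in : minkowski_sum (R := R) B face_center.
Proof.
by exists (fun S => \row_j ((j \in argmax S)%:R / #|argmax S|%:R));
  [exact: argmax_center|].
Qed.

Hypothesis sB : forall i, s i \in B.
Hypothesis s_onto : forall S, S \in B -> S != [set: _]%SET -> exists i, s i = S.

(** If [j] maximized [c] on [S], the union of [s i] and [S] would be a member of [B] in which some
    value exceeds all those on [s i]. Its place is neither in [s i] nor, by maximality of [j], in
    [S]. *)
Lemma nested_tight_argmax i S : i \in nested_tight (fun j => c j 0) ->
  S \in B -> ~~ (S \subset s i) -> forall j, j \in s i -> j \notin argmax S.
Proof.
have [_ _ BU _] := connB.
move=> /nested_tightP iN SB Ss j js; apply/negP => /argmaxP[jS jmax].
have UB : s i :|: S \in B.
  by apply: BU => //; apply/finset.set0Pn; exists j; rewrite inE js.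
have [|k] := iN _ UB.
  by rewrite properE finset.subsetUl finset.subUset fintype.subxx.
rewrite inE => /orP[ks H|kS /(_ j js)]; first by have := H k ks; rewrite ltxx.
by rewrite ltNge jmax.
Qed.

(* A maximal member of [B] through [j] on which [c] is at most [c j]. *)
Lemma nested_tight_cover S j : S \in B -> j \in S -> j \notin argmax S ->
  exists2 i, i \in nested_tight (fun j => c j 0) & j \in s i /\ ~~ (S \subset s i).
Proof.
have [B0 B1 BU BT] := connB; move=> SB jS jmax.
pose p U := [&& U \in B, j \in U & [forall k in U, c k 0 <= c j 0]].
have [|U /maxsetP[/and3P[UB jU /forall_inP cU] Umax] _] :=
    @maxset_exists _ p [set j]%SET.
  by rewrite /p B1 !inE eqxx; apply/forall_inP => k; rewrite inE => /eqP->.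
have SU : ~~ (S \subset U).
  apply: contra jmax => /fintype.subsetP SU; apply/argmaxP; split=> // k /SU.
  exact: cU.
have [|i iU] := s_onto UB; first by apply: contraNneq SU => ->; exact: finset.subsetT.
exists i; last by rewrite iU.
apply/nested_tightP => V VB; rewrite iU => UV; apply: contrapT => none.
have /andP[/fintype.subsetP subUV nVU] := UV.
have pV : p V.
  rewrite /p VB subUV //; apply/forall_inP => k kV; rewrite leNgt; apply/negP => jk.
  apply: none; exists k => // l lU; exact: le_lt_trans (cU l lU) jk.
by have E := Umax _ pV (proper_sub UV); rewrite E fintype.subxx in nVU.
Qed.

(** The centre has positive mass at every maximizer, so a facet set is tight there exactly if it
    avoids [argmax S] for all [S] not contained in it. *)
Lemma tight_center :
  tight facet_normal facet_bound face_center = nested_tight (fun j => c j 0).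
Proof.
have [_ _ BU _] := connB.
apply/setP => i; apply/idP/idP.
  move=> /(tight_decomposition argmax_center (erefl _)) H.
  apply/nested_tightP => S SB sS; have [j jmax] := argmax_exists SB.
  have nSs : ~~ (S \subset s i) by have /andP[] := sS.
  have [jS cj] := argmaxP _ _ jmax; exists j => // k ks.
  rewrite ltNge; apply/negP => jk.
  have kS : k \in S by apply: fintype.subsetP ks; exact: proper_sub.
  have kmax : k \in argmax S.
    by apply/argmaxP; split=> // l lS; apply: le_trans (cj l lS) jk.
  by have := center_neq0 SB kmax; rewrite (H _ _ SB nSs ks) eqxx.
move=> iN; apply/(tight_decomposition argmax_center (erefl _)) => S j SB Ss js.
by rewrite mxE (negPf (nested_tight_argmax iN SB Ss js)) mul0r.
Qed.

(** Forwards this is [nested_tight_argmax]. Backwards, [nested_tight_cover] puts every non-maximizer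
    [j] of [S] into a tight facet set not containing [S], so the mass of the summand at [j]
    vanishes. *)
Lemma max_face_center x : minkowski_sum (R := R) B x ->
  (dot x c = \sum_(S in B) mu S <->
   nested_tight (fun j => c j 0) \subset tight facet_normal facet_bound x).
Proof.
move=> [y ys xE]; split=> [/eqP|/fintype.subsetP sub]; last apply/eqP;
  rewrite (minkowski_dot_le ys xE).
  move=> /forall_inP H; apply/fintype.subsetP => i iN.
  apply/(tight_decomposition ys xE) => S j SB Ss js.
  have /forall_inP/(_ j) H' := H S SB; apply/eqP/H'.
  exact: nested_tight_argmax iN SB Ss j js.
apply/forall_inP => S SB; apply/forall_inP => j jmax.
have [jS|jS] := boolP (j \in S); last first.
  by have /simplexP[_ -> //] := ys _ SB.
have [i iN [js Ss]] := nested_tight_cover SB jS jmax.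
by apply/eqP/(tight_decomposition ys xE i).1 => //; exact: sub.
Qed.

End Face.

Lemma nest_tight_complex L : nest_realizes L ->
  tight_complex facet_normal facet_bound (minkowski_sum (R := R) B) L.
Proof.
move=> [connB sBT s_onto HL]; have sB i : s i \in B by have [] := sBT i.
have valid x i : minkowski_sum (R := R) B x ->
    dot x (facet_normal i) <= facet_bound i.
  by move=> [y ys xE]; apply: facet_normal_le ys xE i.
have faceE F : faces (minkowski_sum (R := R) B) F -> F !=set0 -> exists c : 'cV[R]_n.+1,
    F = tight_face facet_normal facet_bound (minkowski_sum (R := R) B)
          (nested_tight (fun j => c j 0)).
  move=> [c [b [H FE]]] [x0 Fx0]; exists c.
  have [mu muE] : exists mu : R, forall x, minkowski_sum (R := R) B x ->
      dot x c <= mu /\ (dot x c = mu <->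
        nested_tight (fun j => c j 0) \subset tight facet_normal facet_bound x).
    eexists => x Mx; split; last exact: (max_face_center c connB sB s_onto Mx).
    by have [y ys xE] := Mx; apply: (minkowski_dot_le c connB ys xE).
  (* The face is nonempty, so [b] is attained; the centre attains [mu]. *)
  have bmu : b = mu.
    have cM := center_in c connB.
    have [_ [_ cE]] := muE _ cM.
    apply/eqP; rewrite eq_le; apply/andP; split.
      have [Mx0 <-] : (minkowski_sum (R := R) B `&` [set x | dot x c = b]) x0.
        by rewrite -[_ `&` _]FE.
      by have [] := muE _ Mx0.
    rewrite -cE; first exact: (H _ cM).
    by rewrite tight_center.
  rewrite FE bmu predeqE => x; split=> -[Mx xc]; split=> //; have [_ E] := muE _ Mx.
    exact/E.
  exact/E.
split=> // [F faF F0|A].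
  have [c FE] := faceE _ faF F0; exists (face_center c); first exact: center_in.
  by rewrite tight_center.
rewrite HL; split=> [[c cA]|[x Mx <-]].
  pose c' : 'cV[R]_n.+1 := \col_j c j.
  exists (face_center c'); first exact: center_in.
  rewrite tight_center // -cA; congr nested_tight.
  by apply/funext => j; rewrite mxE.
(* The functional exposing the face cut out by the tight set of [x] is the required one: [x] and the
   centre both lie on that face, which gives the two inclusions. *)
have [|c FE] := faceE _ (tight_face_faces (tight facet_normal facet_bound x) valid).
  by exists x; split.
exists (fun j => c j 0); apply/eqP; rewrite finset.eqEsubset; apply/andP; split.
  have : tight_face facet_normal facet_bound (minkowski_sum (R := R) B)
    (tight facet_normal facet_bound x) x by split.
  by rewrite FE => -[].
have : tight_face facet_normal facet_bound (minkowski_sum (R := R) B)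
    (nested_tight (fun j => c j 0)) (face_center c).
  by split; [exact: center_in|rewrite tight_center].
by rewrite -FE => -[_]; rewrite tight_center.
Qed.

End Nestohedra.

(** * Prisms of building sets *)

Section Prism.
Local Open Scope ring_scope.
Variable R : realType.

(** The new element [ord0] is joined to the others only in the whole ground set. The two new proper
    members, [{ord0}] and the old ground set, are the ends of the prism over the old nestohedron. *)
Definition prism n (B : {set {set 'I_n.+1}}) : {set {set 'I_n.+2}} :=
  [set: 'I_n.+2] |: ([set ord0] |: [set (lift ord0 @: (S : {set 'I_n.+1}))%SET | S in B])%SET.

Lemma prismP n (B : {set {set 'I_n.+1}}) S : reflect
  [\/ S = [set: _]%SET, S = [set ord0]%SET
    | exists2 S', S' \in B & S = (lift ord0 @: S')%SET] (S \in prism B).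
Proof.
rewrite !inE; apply: (iffP or3P) => -[h|h|h].
- by apply: Or31; apply/eqP.
- by apply: Or32; apply/eqP.
- by apply: Or33; apply/imsetP.
- by apply: Or31; apply/eqP.
- by apply: Or32; apply/eqP.
- by apply: Or33; apply/imsetP.
Qed.

Lemma lift_imset n (S : {set 'I_n}) j : (lift ord0 j \in (lift ord0 @: S)%SET) = (j \in S).
Proof. by rewrite mem_imset //; exact: lift_inj. Qed.

Lemma ord0_lift_imset n (S : {set 'I_n}) : (ord0 \in (lift ord0 @: S)%SET) = false.
Proof. by apply/imsetP => -[j _ /eqP]; rewrite (negPf (neq_lift _ _)). Qed.

Lemma lift_ord0_neq n (j : 'I_n) : (lift ord0 j == ord0) = false.
Proof. by rewrite eq_sym; apply/negbTE/neq_lift. Qed.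

Lemma lift_proper n (S T : {set 'I_n}) :
  ((lift ord0 @: S)%SET \proper (lift ord0 @: T)%SET) = (S \proper T).
Proof.
have sub (U W : {set 'I_n}) :
    ((lift ord0 @: U)%SET \subset (lift ord0 @: W)%SET) = (U \subset W).
  apply/fintype.subsetP/fintype.subsetP => H j.
    by rewrite -lift_imset => /H; rewrite lift_imset.
  by move=> /imsetP[k kU ->]; rewrite lift_imset; apply: H.
by rewrite !properE !sub.
Qed.

Lemma prism_connected n (B : {set {set 'I_n.+1}}) :
  connected_building_set B -> connected_building_set (prism B).
Proof.
move=> [B0 B1 BU BT].
have T1 S : S \in prism B -> ord0 \in S -> S != [set ord0]%SET -> S = [set: _]%SET.
  move=> /prismP[->//|->|[S' _ ->]]; first by rewrite eqxx.
  by rewrite ord0_lift_imset.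
have nonempty S : S \in prism B -> S != finset.set0.
  move=> /prismP[->|->|[S' S'B ->]]; apply/finset.set0Pn.
  - by exists ord0; rewrite inE.
  - by exists ord0; rewrite inE.
  - have /finset.set0Pn[j jS] : S' != finset.set0 by apply: contraNneq B0 => <-.
    by exists (lift ord0 j); rewrite lift_imset.
split.
- by apply/negP => /nonempty; rewrite eqxx.
- move=> i; case: (unliftP ord0 i) => [j ->|->]; apply/prismP; last by apply: Or32.
  by apply: Or33; exists [set j]%SET; [exact: B1|rewrite finset.imset_set1].
- move=> S T SP TP /finset.set0Pn[i]; rewrite inE => /andP[iS iT].
  have UT (U W : {set 'I_n.+2}) : U = [set: _]%SET -> (U :|: W \in prism B) && (W :|: U \in prism B).
    by move=> ->; rewrite finset.setTU finset.setUT andbb; apply/prismP; apply: Or31.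
  have [ST|Sn1] := eqVneq S [set ord0]%SET.
    have iE : i = ord0 by apply/eqP; rewrite ST inE in iS.
    have [->|Tn1] := eqVneq T [set ord0]%SET.
      by rewrite ST finset.setUid; apply/prismP; apply: Or32.
    by have /andP[] := UT T S (T1 _ TP (eq_ind _ (fun i => i \in T) iT _ iE) Tn1).
  have [TT|Tn1] := eqVneq T [set ord0]%SET.
    have iE : i = ord0 by apply/eqP; rewrite TT inE in iT.
    by have /andP[] := UT S T (T1 _ SP (eq_ind _ (fun i => i \in S) iS _ iE) Sn1).
  have [S0|S0] := boolP (ord0 \in S).
    by have /andP[] := UT S T (T1 _ SP S0 Sn1).
  have [T0|T0] := boolP (ord0 \in T).
    by have /andP[] := UT T S (T1 _ TP T0 Tn1).
  move/prismP: SP => [SE|SE|[S' S'B SE]].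
  - by rewrite SE inE in S0.
  - by rewrite SE eqxx in Sn1.
  move/prismP: TP => [TE|TE|[T' T'B TE]].
  - by rewrite TE inE in T0.
  - by rewrite TE eqxx in Tn1.
  move: iS iT; rewrite SE TE => /imsetP[j jS ->]; rewrite lift_imset => jT.
  apply/prismP; apply: Or33; exists (S' :|: T')%SET; last by rewrite imsetU.
  by apply: BU => //; apply/finset.set0Pn; exists j; rewrite inE jS.
- by apply/prismP; apply: Or31.
Qed.

Section NestedTightPrism.
Variables (n : nat) (B : {set {set 'I_n.+1}}) (I J : finType) (s : I -> {set 'I_n.+1}).
Variables (s' : J -> {set 'I_n.+2}) (c : 'I_n.+2 -> R).
Hypothesis BT : [set: _]%SET \in B.

(** The new ground set imposes nothing more, since the old one already provides a larger value. *)
Lemma nested_tight_prism_lift i x : s i != [set: _]%SET -> s' x = (lift ord0 @: s i)%SET ->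
  (x \in nested_tight (prism B) s' c) = (i \in nested_tight B s (c \o lift ord0)).
Proof.
move=> siT sx; apply/nested_tightP/nested_tightP; rewrite sx => H S SB sS.
  have [||j /imsetP[k kS ->] kP] := H (lift ord0 @: S)%SET.
  - by apply/prismP; apply: Or33; exists S.
  - by rewrite lift_proper.
  - by exists k => // l ls; apply: kP; rewrite lift_imset.
have /andP[sub _] := sS.
case/prismP: SB sS sub => [->|->|[S' S'B ->]] sS sub.
- have [|j _ jP] := H _ BT; first by rewrite properE finset.subsetT finset.subTset.
  by exists (lift ord0 j) => // _ /imsetP[k ks ->]; apply: jP.
- exists ord0; first by rewrite inE.
  move=> k ks; have := fintype.subsetP sub _ ks; rewrite inE => /eqP k0.
  by rewrite k0 ord0_lift_imset in ks.
- rewrite lift_proper in sS; have [j jS jP] := H _ S'B sS.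
  exists (lift ord0 j); first by rewrite lift_imset.
  by move=> _ /imsetP[k ks ->]; apply: jP.
Qed.

Lemma nested_tight_prism0 x : s' x = [set ord0]%SET ->
  x \in nested_tight (prism B) s' c <-> exists j, c ord0 < c (lift ord0 j).
Proof.
move=> sx; split=> [/nested_tightP H|[j jP]].
  have [||j _] := H [set: _]%SET.
  - by apply/prismP; apply: Or31.
  - rewrite sx properE finset.subsetT finset.subTset; apply/eqP => E.
    have : (lift ord0 (ord0 : 'I_n.+1)) \in [set: 'I_n.+2]%SET by rewrite inE.
    by rewrite -E inE lift_ord0_neq.
  - move=> /(_ ord0); rewrite sx inE eqxx => /(_ isT).
    case: (unliftP ord0 j) => [k -> lt|->]; first by exists k.
    by rewrite ltxx.
apply/nested_tightP; rewrite sx => S SB sS.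
exists (lift ord0 j); last by move=> k; rewrite inE => /eqP->.
case/prismP: SB sS => [->|->|[S' _ ->]]; rewrite ?inE //.
  by rewrite fintype.properxx.
by move=> /andP[]; rewrite finset.sub1set ord0_lift_imset.
Qed.

(** Only the new ground set properly contains the old one. Together with [nested_tight_prism0] this
    shows that the two ends are never tight at once. *)
Lemma nested_tight_prismT x : s' x = (lift ord0 @: [set: _])%SET ->
  x \in nested_tight (prism B) s' c <-> forall j, c (lift ord0 j) < c ord0.
Proof.
move=> sx; split=> [/nested_tightP H j|H].
  have [||k _ kP] := H [set: _]%SET.
  - by apply/prismP; apply: Or31.
  - rewrite sx properE finset.subsetT finset.subTset; apply/eqP => E.
    by have := ord0_lift_imset [set: 'I_n.+1]%SET; rewrite E inE.
  - have kP' l : c (lift ord0 l) < c k by apply: kP; rewrite sx lift_imset inE.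
    by case: (unliftP ord0 k) kP' => [l ->|->] // /(_ l); rewrite ltxx.
apply/nested_tightP; rewrite sx => S SB sS; exists ord0.
  case/prismP: SB sS => [->|->|[S' _ ->]]; rewrite ?inE //.
  by rewrite lift_proper properE finset.subTset finset.subsetT => /andP[_].
by move=> _ /imsetP[j _ ->].
Qed.

End NestedTightPrism.

(* The nested set complex of a prism is the suspension of the original one. *)
Lemma nest_realizes_prism n (B : {set {set 'I_n.+1}}) (I J : finType)
    (s : I -> {set 'I_n.+1}) (e : rel I) (e' : rel J) (g : I -> J) a a' :
  injective g -> (forall x, [\/ x = a, x = a' | exists i, x = g i]) ->
  a != a' -> a \notin codom g -> a' \notin codom g ->
  symmetric e' -> (forall i j, e' (g i) (g j) = e i j) -> e' a a' ->
  (forall x, e' a x -> x = a') -> (forall x, e' a' x -> x = a) ->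
  nest_realizes R B s (indep e) ->
  exists s', nest_realizes R (prism B) s' (indep e').
Proof.
move=> ginj cover aa' ga ga' sym' ge eaa' ea ea' [connB sBT s_onto HL].
have [_ _ _ BT] := connB.
pose s' x : {set 'I_n.+2} := if x == a then [set ord0]%SET
  else if x == a' then (lift ord0 @: [set: _])%SET
  else if [pick i | g i == x] is Some i then (lift ord0 @: s i)%SET else finset.set0.
have s'a : s' a = [set ord0]%SET by rewrite /s' eqxx.
have s'a' : s' a' = (lift ord0 @: [set: _])%SET by rewrite /s' eq_sym (negPf aa') eqxx.
have gna i : g i != a by apply: contraNneq ga => <-; exact: codom_f.
have gna' i : g i != a' by apply: contraNneq ga' => <-; exact: codom_f.
have s'g i : s' (g i) = (lift ord0 @: s i)%SET.
  rewrite /s' (negPf (gna i)) (negPf (gna' i)).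
  by case: pickP => [j /eqP/ginj->//|/(_ i)]; rewrite eqxx.
have lift_neqT (S : {set 'I_n.+1}) : (lift ord0 @: S)%SET != [set: 'I_n.+2]%SET.
  apply/eqP => E; have : ord0 \in [set: 'I_n.+2]%SET by rewrite inE.
  by rewrite -E ord0_lift_imset.
exists s'; split.
- exact: prism_connected.
- move=> x; case: (cover x) => [->|->|[i ->]]; rewrite ?s'a ?s'a' ?s'g; split=> //.
  + by apply/prismP; apply: Or32.
  + apply/eqP => E; have : (lift ord0 (ord0 : 'I_n.+1)) \in [set: 'I_n.+2]%SET by rewrite inE.
    by rewrite -E inE lift_ord0_neq.
  + by apply/prismP; apply: Or33; exists [set: _]%SET.
  + by apply/prismP; apply: Or33; exists (s i) => //; have [] := sBT i.
- move=> S /prismP[->|->|[S' S'B ->]]; first by rewrite eqxx.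
    by exists a.
  have [->|S'T] := eqVneq S' [set: _]%SET; first by exists a'.
  by have [i <-] := s_onto _ S'B S'T; exists (g i).
move=> A; pose A0 := [set i | g i \in A]%SET.
have tg (c : 'I_n.+2 -> R) i : (g i \in nested_tight (prism B) s' c) = (i \in nested_tight B s (c \o lift ord0)).
  by apply: (nested_tight_prism_lift c BT (sBT i).2); exact: s'g.
have ta (c : 'I_n.+2 -> R) : a \in nested_tight (prism B) s' c <->
    exists j, c ord0 < c (lift ord0 j) by apply: (@nested_tight_prism0 n B J s' c a s'a).
have ta' (c : 'I_n.+2 -> R) : a' \in nested_tight (prism B) s' c <->
    forall j, c (lift ord0 j) < c ord0 by apply: (@nested_tight_prismT n B J s' c a' s'a').
split=> [/indepP H|[c <-]].
  have /HL[c0 c0A] : A0 \in indep e.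
    by apply/indepP => i j; rewrite !inE -ge; apply: H.
  have [m _ mmax] := @Order.TotalTheory.arg_maxP _ R _ ord0 predT c0 isT.
  have {}mmax j : c0 j <= c0 m by apply: mmax.
  (* The value at [ord0] is placed below, at or above the maximum [c0 m] of the others; this makes
     [a], neither end or [a'] tight. *)
  pose t := if a \in A then -1 else if a' \in A then 1 else 0 : R.
  pose c j := if unlift ord0 j is Some k then c0 k else c0 m + t.
  have cl : c \o lift ord0 = c0 by apply/funext => j; rewrite /c /= liftK.
  have c_0 : c ord0 = c0 m + t by rewrite /c unlift_none.
  have c_l j : c (lift ord0 j) = c0 j by rewrite -cl.
  exists c; apply/setP => x; case: (cover x) => [->|->|[i ->]].
  - apply/idP/idP => [/ta[j]|aA].
      rewrite c_0 c_l /t; have := mmax j; case: ifP => // _; case: ifP => _; lra.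
    by apply/ta; exists m; rewrite c_0 c_l /t aA; lra.
  - apply/idP/idP => [/ta'/(_ m)|aA].
      by rewrite c_0 c_l /t; case: ifP => _; [lra|case: ifP => // _; lra].
    apply/ta' => j; rewrite c_0 c_l /t aA ifN; first by have := mmax j; lra.
    by apply/negP => aA'; have := H _ _ aA' aA; rewrite eaa'.
  - by rewrite tg cl c0A inE.
have /indepP H : nested_tight B s (c \o lift ord0) \in indep e.
  by apply/HL; exists (c \o lift ord0).
have not_both : a \in nested_tight (prism B) s' c ->
    a' \in nested_tight (prism B) s' c -> False.
  by move=> /ta[j lt] /ta'/(_ j)/(lt_trans lt); rewrite ltxx.
apply/indepP => x y xt yt; apply/negP => exy.
case: (cover x) xt exy => [->|->|[i ->]] xt exy.
- by move/ea: exy yt => ->; exact: not_both.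
- by move/ea': exy yt => -> yt; exact: not_both.
case: (cover y) yt exy => [->|->|[j ->]] yt; rewrite ?ge.
- by rewrite sym' => /ea E; rewrite -E codom_f in ga'.
- by rewrite sym' => /ea' E; rewrite -E codom_f in ga.
- by apply/negP/H; rewrite -tg.
Qed.

Lemma nest_realizes_bij n (B : {set {set 'I_n.+1}}) (I J : finType)
    (s : I -> {set 'I_n.+1}) (e : rel I) (e' : rel J) (f : I -> J) (f' : J -> I) :
  cancel f f' -> cancel f' f -> (forall x y, e' (f x) (f y) = e x y) ->
  nest_realizes R B s (indep e) -> nest_realizes R B (s \o f') (indep e').
Proof.
move=> fK f'K fe [connB sBT s_onto HL]; split=> //.
- by move=> x; apply: sBT.
- by move=> S SB /(s_onto _ SB)[i <-]; exists (f i); rewrite /= fK.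
have tE (c : 'I_n.+1 -> R) x :
    (x \in nested_tight B (s \o f') c) = (f' x \in nested_tight B s c).
  by rewrite !inE.
move=> A; pose A0 := [set i | f i \in A]%SET.
have -> : A \in indep e' <-> A0 \in indep e.
  split=> /indepP H; apply/indepP => x y; first by rewrite !inE -fe; apply: H.
  by rewrite -[x]f'K -[y]f'K fe => xA yA; apply: H; rewrite inE.
rewrite HL; split=> -[c cA]; exists c.
  by apply/setP => x; rewrite tE cA inE f'K.
by apply/setP => i; rewrite [RHS]inE -cA tE fK.
Qed.

(** Each matched pair is realized by the two ends of one more prism. *)
Lemma nest_realizes_cross n (B : {set {set 'I_n.+1}}) (I : finType)
    (s : I -> {set 'I_n.+1}) (e : rel I) k :
  symmetric e -> nest_realizes R B s (indep e) ->
  exists n' (B' : {set {set 'I_n'.+1}}) s',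
    nest_realizes R B' s' (indep (sum_rel (@cross_rel k) e)).
Proof.
move=> esym Bs; elim: k => [|k [n' [B' [s' IH]]]].
  pose f' (x : ('I_0 + 'I_0) + I) : I :=
    match x with
    | inl (inl i) | inl (inr i) => False_rect _ (notF (ltn_ord i))
    | inr i => i
    end.
  exists n, B, (s \o f'); apply: (nest_realizes_bij (f := inr)) Bs => //.
  by move=> [[[]|[]]|].
pose g (x : ('I_k + 'I_k) + I) : ('I_k.+1 + 'I_k.+1) + I :=
  match x with
  | inl (inl i) => inl (inl (lift ord0 i))
  | inl (inr i) => inl (inr (lift ord0 i))
  | inr i => inr i
  end.
exists n'.+1, (prism B').
apply: (nest_realizes_prism (g := g) (a := inl (inl ord0)) (a' := inl (inr ord0))) IH.
- apply: (pcan_inj (g := fun z => match z with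
    | inl (inl j) => omap (fun i => inl (inl i)) (unlift ord0 j)
    | inl (inr j) => omap (fun i => inl (inr i)) (unlift ord0 j)
    | inr i => Some (inr i)
    end)) => -[[i|i]|i] //=; by rewrite liftK.
- move=> [[x|x]|x].
  + case: (unliftP ord0 x) => [y ->|->]; last by apply: Or31.
    by apply: Or33; exists (inl (inl y)).
  + case: (unliftP ord0 x) => [y ->|->]; last by apply: Or32.
    by apply: Or33; exists (inl (inr y)).
  + by apply: Or33; exists (inr x).
- by [].
- by apply/codomP => -[[[x|x]|x]] //= [/eqP]; rewrite (negPf (neq_lift _ _)).
- by apply/codomP => -[[[x|x]|x]] //= [/eqP]; rewrite (negPf (neq_lift _ _)).
- by apply: sum_rel_sym => //; exact: cross_rel_sym.
- by move=> [[x|x]|x] [[y|y]|y] //=; rewrite (inj_eq lift_inj).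
- by rewrite /= eqxx.
- by move=> [[y|y]|y] //= /eqP->.
- by move=> [[y|y]|y] //= /eqP->.
Qed.

End Prism.

(** * Nestohedra given by tables *)

Section NestTables.
Local Open Scope nat_scope.

Definition sub_bits N (t u : bitseq) := all (fun v => nth false t v ==> nth false u v) (iota 0 N).
Definition eq_bits N (t u : bitseq) := all (fun v => nth false t v == nth false u v) (iota 0 N).
Definition or_bits N (t u : bitseq) := mkseq (fun v => nth false t v || nth false u v) N.

Definition members N (tbl : seq bitseq) := nseq N true :: tbl.

Definition table_set N (tbl : seq bitseq) : {set {set 'I_N}} :=
  [set S in [seq set_of_bits N t | t <- members N tbl]]%SET.

(* The nested set [s] is realised by the function whose value at [v] decreases
   with the number of members of [s] that contain [v]. *)
Definition depth_function (tbl : seq bitseq) (s : bitseq) (v : nat) : nat :=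
  size tbl - count (fun i => nth false s i && nth false (nth [::] tbl i) v)
    (iota 0 (size tbl)).

Definition tight_bits N tbl (c : nat -> nat) (t : bitseq) : bool :=
  all (fun u => sub_bits N t u && ~~ sub_bits N u t ==>
    has (fun j => nth false u j &&
      all (fun w => nth false t w ==> (c w < c j)) (iota 0 N)) (iota 0 N))
  (members N tbl).

(** The first three tests are the axioms of a building set, the fourth says that the listed members
    are proper. By the fifth, a pair in [E] consists of incomparable sets whose union is a member,
    which excludes common tightness; by the last, each independent set is realized by its depth
    function. *)
Definition nest_table_ok N tbl E : bool :=
  [&& all (fun t => has (nth false t) (iota 0 N)) (members N tbl),
      all (fun j => has (fun t => eq_bits N t (mkseq (fun v => v == j) N))
        (members N tbl)) (iota 0 N),
      all (fun t => all (fun u =>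
        has (fun v => nth false t v && nth false u v) (iota 0 N) ==>
        has (eq_bits N (or_bits N t u)) (members N tbl)) (members N tbl))
        (members N tbl),
      all (fun t => ~~ sub_bits N (nseq N true) t) tbl,
      all (fun p => let t := nth [::] tbl p.1 in let u := nth [::] tbl p.2 in
        [&& p.1 < size tbl, p.2 < size tbl, ~~ sub_bits N t u, ~~ sub_bits N u t
          & has (eq_bits N (or_bits N t u)) (members N tbl)]) E
    & all (fun s => indep_bits (size tbl) E s ==>
        all (fun i => tight_bits N tbl (depth_function tbl s) (nth [::] tbl i)
          == nth false s i) (iota 0 (size tbl))) (bitseqs (size tbl))].

Lemma sub_bitsP N t u :
  (set_of_bits N t \subset set_of_bits N u) = sub_bits N t u.
Proof.
apply/fintype.subsetP/all_iotaP => H i.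
  by apply/implyP; have := H i; rewrite !finset.inE.
by rewrite !finset.inE; apply/implyP/H.
Qed.

Lemma eq_bitsP N t u : eq_bits N t u -> set_of_bits N t = set_of_bits N u.
Proof. by move=> /all_iotaP H; apply/setP => i; rewrite !finset.inE; apply/eqP/H. Qed.

Lemma set_of_or_bits N t u :
  set_of_bits N (or_bits N t u) = (set_of_bits N t :|: set_of_bits N u)%SET.
Proof. by apply/setP => i; rewrite !finset.inE nth_mkseq. Qed.

Lemma table_setP N tbl S :
  reflect (exists2 t, t \in members N tbl & S = set_of_bits N t) (S \in table_set N tbl).
Proof. by rewrite inE; apply: mapP. Qed.

Lemma set_of_true N : set_of_bits N (nseq N true) = [set: 'I_N]%SET.
Proof. by apply/setP => i; rewrite !finset.inE nth_nseq ltn_ord. Qed.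

Lemma has_iotaP N (p : pred nat) : reflect (exists i : 'I_N, p i) (has p (iota 0 N)).
Proof.
apply: (iffP hasP) => [[i]|[i pi]]; last by exists (val i); rewrite // mem_iota /=.
by rewrite mem_iota /= => iN pi; exists (Ordinal iN).
Qed.

Lemma nest_realizes_table (R : realType) n tbl E : nest_table_ok n.+1 tbl E ->
  nest_realizes R (table_set n.+1 tbl)
    (fun i : 'I_(size tbl) => set_of_bits n.+1 (nth [::] tbl i))
    (indep (ord_rel (k := size tbl) E)).
Proof.
move=> /and4P[/allP T0 /all_iotaP T1 /allP TU] /and3P[/allP TT /allP TE /allP TD].
have memT (i : 'I_(size tbl)) : nth [::] tbl i \in members n.+1 tbl.
  by rewrite inE mem_nth ?orbT.
have or_mem t u : has (eq_bits n.+1 (or_bits n.+1 t u)) (members n.+1 tbl) ->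
    (set_of_bits n.+1 t :|: set_of_bits n.+1 u)%SET \in table_set n.+1 tbl.
  move=> /hasP[w wT /eq_bitsP E']; apply/table_setP; exists w => //.
  by rewrite -E' set_of_or_bits.
have conn : connected_building_set (table_set n.+1 tbl).
  split.
  - apply/table_setP => -[t /T0/has_iotaP[i ti] /setP/(_ i)].
    by rewrite !finset.inE ti.
  - move=> i; have /hasP[t tT /eq_bitsP tE] := T1 i.
    apply/table_setP; exists t => //; rewrite tE; apply/setP => j.
    by rewrite !finset.inE nth_mkseq // -val_eqE.
  - move=> _ _ /table_setP[t tT ->] /table_setP[u uT ->] /finset.set0Pn[i itu].
    have tu : nth false t i && nth false u i by move: itu; rewrite !finset.inE.
    apply: or_mem.
    have /allP/(_ u uT)/implyP := TU t tT; apply; apply/has_iotaP.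
    by exists i.
  - apply/table_setP; exists (nseq n.+1 true); first by rewrite inE eqxx.
    by rewrite set_of_true.
split=> //.
- move=> i; split; first by apply/table_setP; exists (nth [::] tbl i).
  have := TT _ (mem_nth [::] (ltn_ord i)); apply: contra => /eqP iE.
  by rewrite -sub_bitsP iE finset.subsetT.
- move=> S /table_setP[t]; rewrite inE => /orP[/eqP->|tT] -> ST.
    by rewrite set_of_true eqxx in ST.
  have ti : index t tbl < size tbl by rewrite index_mem.
  by exists (Ordinal ti); rewrite /= nth_index.
move=> A; split=> [|[c <-]].
  rewrite indep_bitsP => sA.
  have /implyP/(_ sA)/all_iotaP H := TD _ (mem_bits_of_set A).
  exists (fun j => (depth_function tbl (bits_of_set A) j)%:R%R).
  apply/setP => i; have := H i; rewrite nth_bits_of_set => /eqP <-.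
  apply/nested_tightP/allP => [K u uT|K _ /table_setP[u uT ->]].
    apply/implyP => tu; have [||j ju jP] := K (set_of_bits n.+1 u).
    - by apply/table_setP; exists u.
    - by rewrite properE !sub_bitsP.
    apply/has_iotaP; exists j; rewrite finset.inE in ju; rewrite ju andTb.
    apply/all_iotaP => w; apply/implyP => tw.
    by have := jP w; rewrite finset.inE ltr_nat; apply.
  rewrite properE !sub_bitsP => tu.
  have /implyP/(_ tu)/has_iotaP[j /andP[ju /all_iotaP jP]] := K u uT.
  exists j; first by rewrite finset.inE.
  move=> w; rewrite finset.inE ltr_nat; apply/implyP/jP.
apply/indepP => i j it jt; apply/negP.
wlog ij : i j it jt / (val i, val j) \in E => [W|_].
  by move=> /orP[ij|ji]; [apply: (W i j)|apply: (W j i)]; rewrite /ord_rel /pair_rel ?ij ?ji.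
(* If both sets were tight, their union would contain [k] with a value above the first set and [l]
   with a value above the second. Then [k] is in the second set and [l] in the first, so each value
   exceeds the other. *)
have /and5P[_ _ ij1 ij2 /or_mem U] := TE _ ij.
rewrite /= -!sub_bitsP in ij1 ij2 U.
move/nested_tightP: it => /(_ _ U); rewrite properE finset.subsetUl finset.subUset fintype.subxx.
move=> /(_ ij2)[k + ki]; rewrite inE => /orP[/ki|kj]; first by rewrite ltxx.
move/nested_tightP: jt => /(_ _ U); rewrite properE finset.subsetUr finset.subUset fintype.subxx andbT.
move=> /(_ ij1)[l + lj]; rewrite inE => /orP[li|/lj]; last by rewrite ltxx.
by have := lt_trans (ki l li) (lj k kj); rewrite ltxx.
Qed.

End NestTables.

Section NestBases.
Variable R : realType.

Local Notation o := false.
Local Notation x := true.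

(** The proper intervals of a path on three vertices (an associahedron). The order is that of
    [pentagon_halfspaces], so that one list of non-edges serves both; likewise for the next two
    tables. *)
Definition pentagon_nest : seq bitseq :=
  [:: [:: o; o; x]; [:: x; x; o]; [:: x; o; o]; [:: o; x; x]; [:: o; x; o]].

(** All proper nonempty subsets of three elements (a permutohedron). *)
Definition hexagon_nest : seq bitseq :=
  [:: [:: o; o; x]; [:: x; x; o]; [:: o; x; o]; [:: x; o; x]; [:: x; o; o];
      [:: o; x; x]].

(** The proper intervals of a path on [0, 1, 2, 3], except [{2, 3}]. *)
Definition two_cuts_nest : seq bitseq :=
  [:: [:: o; o; x; o]; [:: x; x; o; o]; [:: x; o; o; o]; [:: o; x; x; o];
      [:: x; x; x; o]; [:: o; o; o; x]; [:: o; x; o; o]; [:: o; x; x; x]].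

End NestBases.

(** * Graphs with small vertex covers *)

Section Classification.
Local Open Scope nat_scope.

(* [E] lists the edges and loops of a graph on [0, 1, ...]: these are the minimal
   non-faces of a complex in which [a, b] is a non-face iff [nonface E a b], and
   the complement of [a, b] is a face iff [edge_cover E a b]. *)
Definition nonface (E : seq (nat * nat)) a b :=
  [|| (a, a) \in E, (b, b) \in E | pair_rel E a b].

Definition edge_cover (E : seq (nat * nat)) a b :=
  all (fun p => [|| p.1 == a, p.1 == b, p.2 == a | p.2 == b]) E.

Definition graph_types : seq (nat * seq (nat * nat)) :=
  [:: (1, [:: (0, 0)]);
      (2, [:: (0, 0); (1, 1)]);
      (2, [:: (0, 1)]);
      (3, [:: (0, 0); (1, 2)]);
      (3, [:: (0, 1); (1, 2)]);
      (3, [:: (0, 1); (1, 2); (0, 2)]);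
      (4, [:: (0, 1); (1, 2); (2, 3)]);
      (4, [:: (0, 1); (1, 2); (2, 3); (0, 3)]);
      (4, [:: (0, 1); (2, 3)])].

Lemma nonface_sym E : symmetric (nonface E).
Proof. by move=> a b; rewrite /nonface pair_rel_sym orbCA. Qed.

Variables (V : finType) (h : rel V).

(** [{i, j}] is a vertex cover; [i = j] admits covers by a single vertex. *)
Definition hits i j := [forall u, forall v, h u v ==> [|| u == i, u == j, v == i | v == j]].

Lemma hitsP i j : reflect (forall u v, h u v -> [|| u == i, u == j, v == i | v == j]) (hits i j).
Proof.
apply: (iffP forallP) => [H u v|H u]; first by have /forallP/(_ v)/implyP := H u; apply.
by apply/forallP => v; apply/implyP/H.
Qed.

(** A vertex outside [s] has index [size s], which no edge of a listed graph mentions, so it is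
    related only to vertices with a loop. *)
Definition has_type s E := (size s, E) \in graph_types /\
  forall i j, h i j = nonface E (index i s) (index j s).

Hypothesis hC : symmetric h.

Lemma has_typeP x0 s E : uniq s -> (size s, E) \in graph_types ->
  (forall i j, i \notin s -> h i j = ((index j s, index j s) \in E)) ->
  (forall a b, a < size s -> b < size s -> h (nth x0 s a) (nth x0 s b) = nonface E a b) ->
  has_type s E.
Proof.
move=> us sE out inn; split=> // i j.
have bnd p : p \in E -> (p.1 < size s) && (p.2 < size s).
  have : all (fun t => all (fun p => (p.1 < t.1) && (p.2 < t.1)) t.2) graph_types by [].
  by move=> /allP/(_ _ sE)/allP/(_ p).
have outE k l : k \notin s -> h k l = nonface E (index k s) (index l s).
  move=> ks; rewrite out // (memNindex ks) /nonface.
  have no a : (size s, a) \notin E /\ (a, size s) \notin E.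
    by split; apply/negP => /bnd; rewrite /= ltnn ?andbF.
  have [/negPf n1 /negPf n2] := no (index l s).
  have [/negPf n3 _] := no (size s).
  by rewrite /pair_rel n1 n2 n3 /= orbF.
have [is_|is_] := boolP (i \in s); last exact: outE.
have [js|js] := boolP (j \in s); last by rewrite hC outE // nonface_sym.
by rewrite -inn ?index_mem // !nth_index.
Qed.

Hypothesis loopP : forall a x, h a a -> h a x.
(** For a maximal independent set, whose complement is a minimal cover, this says that the minimal
    cover has at most two vertices. *)
Hypothesis avoid : forall A : {set V}, (forall u v, u \in A -> v \in A -> ~~ h u v) ->
  exists i j, [/\ i \notin A, j \notin A & hits i j].

Lemma avoid0 : exists i j, hits i j.
Proof.
have [u v|i [j [_ _ H]]] := avoid (A := finset.set0); first by rewrite inE.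
by exists i, j.
Qed.

Lemma avoid1 a : ~~ h a a -> exists i j, [/\ a != i, a != j & hits i j].
Proof.
move=> haa; have [u v|i [j []]] := avoid (A := [set a]%SET).
  by rewrite !inE => /eqP-> /eqP->.
by rewrite !inE => ia ja H; exists i, j; rewrite eq_sym ia eq_sym ja.
Qed.

(** Every cover contains the vertices with loops. Two loops fill it, leaving no further edge. With a
    single loop [a], an edge [x y] away from it makes both [{a, x}] and [{a, y}] covers, so there is
    no second such edge. *)
Lemma classify_loop a : h a a -> exists s E, uniq s /\ has_type s E.
Proof.
move=> haa; have ha x : h a x by exact: loopP.
have ha' x : h x a by rewrite hC.
have [b /andP[ba hbb]|noloop] := pickP [pred b | (b != a) && h b b].
  have hb x : h b x by exact: loopP.
  have hb' x : h x b by rewrite hC.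
  have [i [j /hitsP H]] := avoid0.
  exists [:: a; b], [:: (0, 0); (1, 1)].
  have uab : uniq [:: a; b] by rewrite /= inE eq_sym ba.
  split=> //; apply: (has_typeP (x0 := a)) => // [k l|[|[|//]] [|[|//]] _ _ /=];
    rewrite ?ha ?hb //.
  rewrite !inE negb_or => /andP[ka kb]; rewrite /= (eq_sym a) (eq_sym b).
  have [->|la] := eqVneq l a; first by rewrite ha'.
  have [->|lb] := eqVneq l b; first by rewrite hb'.
  apply/negbTE/negP => /H; have := H a a haa; have := H b b hbb.
  have Hor (x : V) : [|| x == i, x == j, x == i | x == j] -> (x == i) || (x == j).
    by do 2 case: (_ == _).
  move=> /Hor Hb /Hor Ha.
  by case/orP: Ha Hb ba ka kb la lb => /eqP <- /orP[] /eqP <-;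
    rewrite ?eqxx // => ba ka kb la lb /or4P[] /eqP E;
    move: ka kb la lb; rewrite ?E ?eqxx.
have irr x : x != a -> h x x = false by move=> xa; have := noloop x; rewrite /= xa.
have [[x y] /and3P[/= xa ya hxy]|noedge] :=
    pickP [pred p | [&& p.1 != a, p.2 != a & h p.1 p.2]].
  have xy : x != y by apply/eqP => E; move: hxy; rewrite E irr.
  (* A cover avoiding [z] contains [a] and [t], hence is [{a, t}]. *)
  have key z t : z != a -> t != a -> h z t -> z != t -> forall u v, h u v ->
      [|| u == a, u == t, v == a | v == t].
    move=> za ta hzt zt; have [|i [j [zi zj /hitsP H]]] := avoid1 (a := z).
      by rewrite irr.
    have := H _ _ haa; have := H _ _ hzt; rewrite (negPf zi) (negPf zj) /= => Ht Ha.
    have {}Ha : (a == i) || (a == j) by move: Ha; do 2 case: (_ == _).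
    case/orP: Ht Ha ta H => /eqP <- /orP[] /eqP <-; rewrite ?eqxx // => _ H u v /H;
      by move=> /or4P[]->; rewrite ?orbT.
  have kx := key _ _ xa ya hxy xy.
  have ky : forall u v, h u v -> [|| u == a, u == x, v == a | v == x].
    by apply: (key y) => //; rewrite 1?hC // eq_sym.
  exists [:: a; x; y], [:: (0, 0); (1, 2)].
  have us : uniq [:: a; x; y] by rewrite /= !inE negb_or eq_sym xa eq_sym ya xy.
  split=> //; apply: (has_typeP (x0 := a)) => // [k l|[|[|[|//]]] [|[|[|//]]] _ _ /=];
    rewrite ?ha ?ha' ?irr ?hxy // ?(hC y x) ?hxy //.
  rewrite !inE !negb_or => /and3P[ka kx' ky']; rewrite /= (eq_sym a).
  have [->|la] := eqVneq l a; first by rewrite ha'.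
  transitivity false; last by case: (x == l); case: (y == l).
  apply/negbTE/negP => hkl; have := kx _ _ hkl; have := ky _ _ hkl.
  rewrite (negPf ka) (negPf kx') (negPf ky') (negPf la) /= => /eqP->.
  by rewrite (negPf xy).
exists [:: a], [:: (0, 0)]; split=> //.
apply: (has_typeP (x0 := a)) => // [k l|[|//] [|//] _ _ /=]; rewrite ?ha //.
rewrite inE => ka; rewrite /= (eq_sym a).
have [->|la] := eqVneq l a; first by rewrite ha'.
by have := noedge (k, l); rewrite /= ka la.
Qed.

Hypothesis irr : forall x, h x x = false.

Lemma h_neq x y : h x y -> x != y.
Proof. by move=> hxy; apply/eqP => E; rewrite E irr in hxy. Qed.

(** A cover avoiding [a] contains all neighbours of [a]. *)
Lemma degree_le2 a u v w : h a u -> h a v -> h a w -> [|| u == v, u == w | v == w].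
Proof.
have [|i [j [ai aj /hitsP H]]] := avoid1 (a := a); first by rewrite irr.
move=> /H; rewrite (negPf ai) (negPf aj) /= => /orP[] /eqP->;
  move=> /H; rewrite (negPf ai) (negPf aj) /= => /orP[] /eqP->;
  move=> /H; rewrite (negPf ai) (negPf aj) /= => /orP[] /eqP->;
  by rewrite ?eqxx ?orbT.
Qed.

(** No edge leaves the four vertices. As degrees are at most two, the edges between the two given
    ones form a matching with zero, one or two members, which gives two disjoint edges, a path or a
    4-cycle. *)
Lemma classify_disjoint w x y z : uniq [:: w; x; y; z] -> h w x -> h y z ->
  exists s E, uniq s /\ has_type s E.
Proof.
move=> us hwx hyz.
(* A cover avoiding [v] contains [u] and has only one vertex left for two disjoint edges. *)
have out u v : u \notin [:: w; x; y; z] -> h u v = false.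
  move=> us'; apply/negP => huv.
  have [|i [j [vi vj /hitsP H]]] := avoid1 (a := v); first by rewrite irr.
  have := H _ _ huv; rewrite (negPf vi) (negPf vj) orbF /= => Hu.
  have := H _ _ hwx; have := H _ _ hyz; move: us us'; rewrite /= !inE !negb_or.
  rewrite orbF in Hu.
  by case/orP: Hu => /eqP-> us us' /or4P[] /eqP E1 /or4P[] /eqP E2;
    clear H huv vi vj; subst; move: us us'; rewrite ?eqxx ?andbF.
have typ s E : perm_eq [:: w; x; y; z] s -> (size s, E) \in graph_types ->
    all (fun p => p.1 != p.2) E ->
    (forall a b, a < size s -> b < size s -> h (nth w s a) (nth w s b) = nonface E a b) ->
    exists s E, uniq s /\ has_type s E.
  move=> ps sE noloop inn; exists s, E; have us' : uniq s by rewrite -(perm_uniq ps).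
  split=> //; apply: (has_typeP (x0 := w)) => // i j si.
  rewrite out ?(perm_mem ps) //; apply/esym/negbTE/negP => /(allP noloop) /=.
  by rewrite eqxx.
have hxw : h x w by rewrite hC.
have hzy : h z y by rewrite hC.
have deg a u v t : uniq [:: u; v; t] -> h a u -> h a v -> h a t = false.
  move=> uvt au av; apply/negP => at_; have := degree_le2 au av at_.
  by move: uvt; rewrite /= !inE negb_or => /andP[/andP[/negPf-> /negPf->] /andP[/negPf-> _]].
have := us; rewrite /= !inE !negb_or andbT => /and3P[/and3P[wx wy wz] /andP[xy xz] yz].
have sym2 a b c : h a b = c -> h b a = c by rewrite hC.
have [hwy|hwy] := boolP (h w y); [have hyw := sym2 _ _ _ hwy|
    move/negbTE in hwy; have hyw := sym2 _ _ _ hwy].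
  have hwz : h w z = false by apply: (deg w x y) => //=; rewrite !inE negb_or xy xz yz.
  have hyx : h y x = false.
    by apply: (deg y z w) => //=; rewrite !inE negb_or ?(eq_sym z) wz xz wx.
  have hzw := sym2 _ _ _ hwz; have hxy := sym2 _ _ _ hyx.
  have [hxz|/negbTE hxz] := boolP (h x z); have hzx := sym2 _ _ _ hxz.
    apply: (typ [:: w; x; z; y] [:: (0, 1); (1, 2); (2, 3); (0, 3)]);
      [by apply/permP => p /=; case: (p w); case: (p x); case: (p y); case: (p z)|by []|by []|].
    by move=> [|[|[|[|//]]]] [|[|[|[|//]]]] _ _ /=;
      rewrite ?(irr, hwx, hxw, hyz, hzy) ?hwy ?hyw ?hwz ?hzw ?hxy ?hyx ?hxz ?hzx.
  apply: (typ [:: x; w; y; z] [:: (0, 1); (1, 2); (2, 3)]);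
    [by apply/permP => p /=; case: (p w); case: (p x); case: (p y); case: (p z)|by []|by []|].
  by move=> [|[|[|[|//]]]] [|[|[|[|//]]]] _ _ /=;
    rewrite ?(irr, hwx, hxw, hyz, hzy) ?hwy ?hyw ?hwz ?hzw ?hxy ?hyx ?hxz ?hzx.
have [hwz|/negbTE hwz] := boolP (h w z); have hzw := sym2 _ _ _ hwz.
  have hzx : h z x = false.
    by apply: (deg z y w) => //=; rewrite !inE negb_or ?(eq_sym y) wy xy wx.
  have hxz := sym2 _ _ _ hzx.
  have [hxy|/negbTE hxy] := boolP (h x y); have hyx := sym2 _ _ _ hxy.
    apply: (typ [:: w; x; y; z] [:: (0, 1); (1, 2); (2, 3); (0, 3)]);
      [by apply/permP => p /=; case: (p w); case: (p x); case: (p y); case: (p z)|by []|by []|].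
    by move=> [|[|[|[|//]]]] [|[|[|[|//]]]] _ _ /=;
      rewrite ?(irr, hwx, hxw, hyz, hzy) ?hwy ?hyw ?hwz ?hzw ?hxy ?hyx ?hxz ?hzx.
  apply: (typ [:: x; w; z; y] [:: (0, 1); (1, 2); (2, 3)]);
    [by apply/permP => p /=; case: (p w); case: (p x); case: (p y); case: (p z)|by []|by []|].
  by move=> [|[|[|[|//]]]] [|[|[|[|//]]]] _ _ /=;
    rewrite ?(irr, hwx, hxw, hyz, hzy) ?hwy ?hyw ?hwz ?hzw ?hxy ?hyx ?hxz ?hzx.
have [hxy|/negbTE hxy] := boolP (h x y); have hyx := sym2 _ _ _ hxy.
  have hxz : h x z = false by apply: (deg x w y) => //=; rewrite !inE negb_or wy wz yz.
  have hzx := sym2 _ _ _ hxz.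
  apply: (typ [:: w; x; y; z] [:: (0, 1); (1, 2); (2, 3)]);
    [by apply/permP => p /=; case: (p w); case: (p x); case: (p y); case: (p z)|by []|by []|].
  by move=> [|[|[|[|//]]]] [|[|[|[|//]]]] _ _ /=;
    rewrite ?(irr, hwx, hxw, hyz, hzy) ?hwy ?hyw ?hwz ?hzw ?hxy ?hyx ?hxz ?hzx.
have [hxz|/negbTE hxz] := boolP (h x z); have hzx := sym2 _ _ _ hxz.
  apply: (typ [:: w; x; z; y] [:: (0, 1); (1, 2); (2, 3)]);
    [by apply/permP => p /=; case: (p w); case: (p x); case: (p y); case: (p z)|by []|by []|].
  by move=> [|[|[|[|//]]]] [|[|[|[|//]]]] _ _ /=;
    rewrite ?(irr, hwx, hxw, hyz, hzy) ?hwy ?hyw ?hwz ?hzw ?hxy ?hyx ?hxz ?hzx.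
apply: (typ [:: w; x; y; z] [:: (0, 1); (2, 3)]);
  [by apply/permP => p /=; case: (p w); case: (p x); case: (p y); case: (p z)|by []|by []|].
by move=> [|[|[|[|//]]]] [|[|[|[|//]]]] _ _ /=;
  rewrite ?(irr, hwx, hxw, hyz, hzy) ?hwy ?hyw ?hwz ?hzw ?hxy ?hyx ?hxz ?hzx.
Qed.

(** If there is a path [x y z], an edge leaving it must meet both of its edges, so it ends in [y],
    which would have three neighbours; a path or a triangle remains. Without such a path there is
    one edge. *)
Lemma classify_star : (forall w x y z, h w x -> h y z -> [|| w == y, w == z, x == y | x == z]) ->
  (exists u v, h u v) -> exists s E, uniq s /\ has_type s E.
Proof.
move=> meet [x0 [y0 h0]].
have sym2 a b c : h a b = c -> h b a = c by rewrite hC.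
have [[[x y] z] /= /and4P[xz yz hxy hyz]|nothird] :=
    pickP [pred p : V * V * V | [&& p.1.1 != p.2, p.1.2 != p.2, h p.1.1 p.1.2 & h p.1.2 p.2]].
  have xy := h_neq hxy; have hyx := sym2 _ _ _ hxy; have hzy := sym2 _ _ _ hyz.
  have out u v : u \notin [:: x; y; z] -> h u v = false.
    rewrite !inE !negb_or => /and3P[ux uy uz]; apply/negP => huv.
    have := meet _ _ _ _ huv hxy; have := meet _ _ _ _ huv hyz.
    rewrite (negPf ux) (negPf uy) (negPf uz) /=.
    have [vy _ _|vy] := eqVneq v y; last first.
      by rewrite /= ?orbF => /eqP vz /eqP vx; rewrite -vz -vx eqxx in xz.
    have := @degree_le2 y x z u hyx hyz; rewrite -vy (sym2 _ _ _ huv) => /(_ isT).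
    by rewrite (negPf xz) eq_sym (negPf ux) eq_sym (negPf uz).
  have us : uniq [:: x; y; z] by rewrite /= !inE negb_or xy xz yz.
  have [hxz|/negbTE hxz] := boolP (h x z); have hzx := sym2 _ _ _ hxz.
    exists [:: x; y; z], [:: (0, 1); (1, 2); (0, 2)]; split=> //.
    apply: (has_typeP (x0 := x)) => // [i j si|a b]; last first.
      by case: a b => [|[|[|//]]] [|[|[|//]]] _ _ /=;
        rewrite ?(irr, hxy, hyx, hyz, hzy, hxz, hzx).
    rewrite out //; apply/esym/negbTE; move: (index j _) => p.
    by rewrite !inE !xpair_eqE; case: p => [|[|[|p]]].
  exists [:: x; y; z], [:: (0, 1); (1, 2)]; split=> //.
  apply: (has_typeP (x0 := x)) => // [i j si|a b]; last first.
    by case: a b => [|[|[|//]]] [|[|[|//]]] _ _ /=;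
      rewrite ?(irr, hxy, hyx, hyz, hzy, hxz, hzx).
  rewrite out //; apply/esym/negbTE; move: (index j _) => p.
  by rewrite !inE !xpair_eqE; case: p => [|[|[|p]]].
have third a b c : h a b -> h b c -> a = c.
  move=> hab hbc; apply/eqP; apply: contraFT (nothird (a, b, c)) => /= ac.
  by rewrite ac hab hbc h_neq.
have xy := h_neq h0; have h0' := sym2 _ _ _ h0.
have out u v : u \notin [:: x0; y0] -> h u v = false.
  rewrite !inE negb_or => /andP[ux uy]; apply/negP => huv.
  have := meet _ _ _ _ huv h0; rewrite (negPf ux) (negPf uy) /=.
  case/orP => /eqP E; rewrite E in huv.
    by rewrite (third _ _ _ huv h0) eqxx in uy.
  by rewrite (third _ _ _ huv h0') eqxx in ux.
exists [:: x0; y0], [:: (0, 1)].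
have us : uniq [:: x0; y0] by rewrite /= inE xy.
split=> //; apply: (has_typeP (x0 := x0)) => // [i j si|a b]; last first.
  by case: a b => [|[|//]] [|[|//]] _ _ /=;
    rewrite ?(irr, h0, h0').
rewrite out //; apply/esym/negbTE; move: (index j _) => p.
by rewrite !inE !xpair_eqE; case: p => [|[|p]].
Qed.

End Classification.

Lemma classify (V : finType) (h : rel V) : symmetric h ->
  (forall a x, h a a -> h a x) ->
  (forall A : {set V}, (forall u v, u \in A -> v \in A -> ~~ h u v) ->
    exists i j, [/\ i \notin A, j \notin A & hits h i j]) ->
  (exists u v, h u v) -> exists s E, uniq s /\ has_type h s E.
Proof.
move=> hC loopP avoid edge.
have [a haa|irr] := pickP [pred a | h a a]; first exact: classify_loop haa.
have [[[[w x] y] z] /= /and3P[us hwx hyz]|none] := pickP [pred p : V * V * V * V |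
    [&& uniq [:: p.1.1.1; p.1.1.2; p.1.2; p.2], h p.1.1.1 p.1.1.2 & h p.1.2 p.2]].
  exact: classify_disjoint us hwx hyz.
apply: classify_star => // w x y z hwx hyz.
have := none (w, x, y, z); rewrite /= hwx hyz !inE !negb_or !andbT.
rewrite (h_neq irr hwx) (h_neq irr hyz) /= andbT.
by do 4 case: (_ == _).
Qed.

(** * Bier spheres *)

Section BierRelation.
Local Open Scope nat_scope.
Variables (V : finType) (K : {set {set V}}).
Hypotheses (cplxK : simplicial_complex K) (K_neq : K <> [set: {set V}]%SET).

Lemma setT_nonface : [set: V]%SET \notin K.
Proof.
apply/negP => KT; apply: K_neq; apply/setP => A; rewrite inE.
by have [_ Ksub] := cplxK; apply: Ksub KT (finset.subsetT A).
Qed.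

Lemma mem_bier (A : {set V + V}) : A \in bier K =
  [&& [set i | inl i \in A]%SET \in K, (~: [set j | inr j \in A])%SET \notin K
    & [forall i, ~~ ((inl i \in A) && (inr i \in A))]].
Proof.
have inlE (I J : {set V}) i : (inl i \in (inl @: I :|: inr @: J)%SET) = (i \in I).
  rewrite inE mem_imset; last by move=> ? ? [].
  by rewrite (negbTE (introN imsetP _)) ?orbF // => -[].
have inrE (I J : {set V}) i : (inr i \in (inl @: I :|: inr @: J)%SET) = (i \in J).
  rewrite inE [X in _ || X]mem_imset; last by move=> ? ? [].
  by rewrite (negbTE (introN imsetP _)) // => -[].
apply/imset2P/and3P => [[I J IK]|[IK JK /forallP dis]].
  rewrite !inE => /andP[JK /eqP IJ] ->; split.
  - by rewrite (_ : [set i | _]%SET = I) //; apply/setP => i; rewrite inE inlE.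
  - by rewrite (_ : [set i | _]%SET = J) //; apply/setP => i; rewrite inE inrE.
  - apply/forallP => i; rewrite inlE inrE.
    by have := congr1 (fun B : {set V} => i \in B) IJ; rewrite !inE => ->.
exists [set i | inl i \in A]%SET [set j | inr j \in A]%SET => //.
  by rewrite !inE JK; apply/eqP/setP => i; rewrite !inE; apply/negbTE/dis.
by apply/setP => -[i|i]; rewrite ?inlE ?inrE inE.
Qed.

Lemma bier_complex : simplicial_complex (bier K).
Proof.
have [K0 Ksub] := cplxK; split.
  rewrite mem_bier; apply/and3P; split.
  - by rewrite (_ : [set i | _]%SET = finset.set0) //; apply/setP => i; rewrite !inE.
  - rewrite (_ : (~: _)%SET = [set: V]%SET) ?setT_nonface //.
    by apply/setP => i; rewrite !inE.
  - by apply/forallP => i; rewrite !inE.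
move=> A B; rewrite !mem_bier => /and3P[AK AJ /forallP Adis] /fintype.subsetP BA.
apply/and3P; split.
- by apply: Ksub AK _; apply/fintype.subsetP => i; rewrite !inE; exact: BA.
- apply: contra AJ => H; apply: Ksub H _; apply/fintype.subsetP => i.
  by rewrite !inE; apply: contra; exact: BA.
- apply/forallP => i; apply: contra (Adis i) => /andP[/BA-> /BA->].
  by [].
Qed.

Definition bier_rel : rel (V + V) := fun x y => [set x; y]%SET \notin bier K.
Definition face_rel : rel V := fun i j => [set i; j]%SET \notin K.
(** [{i', j'}] is a non-face of the Alexander dual. *)
Definition coface_rel : rel V := fun i j => (~: [set i; j])%SET \in K.

Lemma bier_rel_sym : symmetric bier_rel.
Proof. by move=> x y; rewrite /bier_rel finset.setUC. Qed.

Lemma face_rel_sym : symmetric face_rel.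
Proof. by move=> x y; rewrite /face_rel finset.setUC. Qed.

Lemma bier_rel_ll i j : bier_rel (inl i) (inl j) = face_rel i j.
Proof.
rewrite /bier_rel /face_rel mem_bier; congr (~~ _).
rewrite (_ : [set k | inl k \in _]%SET = [set i; j]%SET); last first.
  by apply/setP => k; rewrite !inE.
rewrite (_ : (~: _)%SET = [set: V]%SET) ?setT_nonface; last first.
  by apply/setP => k; rewrite !inE.
rewrite (_ : [forall k, _]) ?andbT //; apply/forallP => k.
by rewrite !inE andbF.
Qed.

Lemma bier_rel_rr i j : bier_rel (inr i) (inr j) = coface_rel i j.
Proof.
rewrite /bier_rel /coface_rel mem_bier.
rewrite (_ : [set k | inl k \in _]%SET = finset.set0); last first.
  by apply/setP => k; rewrite !inE.
have [-> _] := cplxK.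
rewrite (_ : (~: _)%SET = (~: [set i; j])%SET); last by apply/setP => k; rewrite !inE.
rewrite (_ : [forall k, _]) ?andbT ?negbK //; apply/forallP => k.
by rewrite !inE.
Qed.

Lemma bier_rel_lr i j : bier_rel (inl i) (inr j) =
  [|| face_rel i i, coface_rel j j | i == j].
Proof.
rewrite /bier_rel /face_rel /coface_rel mem_bier.
rewrite (_ : [set k | inl k \in _]%SET = [set i; i]%SET); last first.
  by apply/setP => k; rewrite !inE orbF orbb.
rewrite (_ : (~: _)%SET = (~: [set j; j])%SET); last first.
  by apply/setP => k; rewrite !inE orbb.
rewrite !negb_and negbK; congr [|| _, _ | _].
rewrite negb_forall; apply/existsP/eqP => [[k]|->]; last first.
  by exists j; rewrite !inE !eqxx.
by rewrite negbK !inE orbF => /andP[/eqP[->] /eqP[->]].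
Qed.

Hypothesis flagB : flag_complex (bier K).

Lemma bier_indep : bier K = indep bier_rel.
Proof. exact: flag_complex_indep bier_complex flagB. Qed.

(** [K] is the full subcomplex of the Bier sphere on the unprimed vertices and inherits its
    flagness. *)
Lemma face_indep A : (A \in K) = [forall u in A, forall v in A, ~~ face_rel u v].
Proof.
apply/idP/forall_inP => [AK u uA|H].
  apply/forall_inP => v vA; rewrite negbK.
  have [_ Ksub] := cplxK; apply: Ksub AK _.
  by apply/fintype.subsetP => w; rewrite !inE => /orP[] /eqP->.
have : (inl @: A)%SET \in bier K.
  rewrite bier_indep; apply/indepP => _ _ /imsetP[u uA ->] /imsetP[v vA ->].
  by rewrite bier_rel_ll; have /forall_inP/(_ v vA) := H u uA.
rewrite mem_bier => /and3P[+ _ _]; rewrite (_ : [set i | _]%SET = A) //.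
by apply/setP => i; rewrite inE mem_imset // => ? ? [].
Qed.

Lemma coface_hits i j : coface_rel i j = hits face_rel i j.
Proof.
rewrite /coface_rel face_indep; apply/forall_inP/hitsP => [H u v uv|H u].
  apply: contraTT uv; rewrite !negb_or => /and4P[ui uj vi vj].
  have uC : u \in (~: [set i; j])%SET by rewrite !inE negb_or ui uj.
  have /forall_inP := H u uC; apply.
  by rewrite !inE negb_or vi vj.
rewrite !inE negb_or => /andP[ui uj]; apply/forall_inP => v.
rewrite !inE negb_or => /andP[vi vj]; apply/negP => /H.
by rewrite (negPf ui) (negPf uj) (negPf vi) (negPf vj).
Qed.

(** As [A] is a face, the primed copy of its complement is a non-face of the Bier sphere. Flagness
    yields a non-face [{i', j'}] inside it, which is a cover disjoint from [A]. *)
Lemma avoiding_cover (A : {set V}) :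
  (forall u v, u \in A -> v \in A -> ~~ face_rel u v) ->
  exists i j, [/\ i \notin A, j \notin A & hits face_rel i j].
Proof.
move=> H; have AK : A \in K.
  by rewrite face_indep; apply/forall_inP => u uA; apply/forall_inP => v; exact: H.
have : (inr @: (~: A))%SET \notin bier K.
  have E : (~: [set j : V | (inr j : V + V) \in (inr @: ~: A)])%SET = A.
    apply/setP => i; rewrite !inE mem_imset; last by move=> ? ? [].
    by rewrite inE negbK.
  by rewrite mem_bier !negb_and negbK E AK orbT.
rewrite bier_indep => nB; apply: contra_notP (negP nB) => none.
apply/indepP => _ _ /imsetP[i iA ->] /imsetP[j jA ->].
rewrite bier_rel_rr coface_hits; apply/negP => ij; apply: none.
by exists i, j; rewrite !inE in iA jA.
Qed.

Lemma face_classify : exists s E, uniq s /\ has_type face_rel s E.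
Proof.
apply: classify.
- exact: face_rel_sym.
- move=> a x; apply: contra => H; have [_ Ksub] := cplxK; apply: Ksub H _.
  by apply/fintype.subsetP => y; rewrite !inE orbb => ->.
- exact: avoiding_cover.
have := setT_nonface; rewrite face_indep => /forall_inPn[u _ /forall_inPn[v _]].
by rewrite negbK; exists u, v.
Qed.

End BierRelation.

(** * Embedding the models into Bier spheres *)

Section Tables.
Local Open Scope nat_scope.

(* A vertex [inl i] or [inr i] of the Bier sphere is encoded by its side and by the
   index of [i] in the list [s] of the non-isolated vertices of the graph. *)
Definition bier_code_rel (E : seq (nat * nat)) (p q : bool * nat) : bool :=
  match p, q with
  | (false, a), (false, b) => nonface E a b
  | (true, a), (true, b) => edge_cover E a b
  | (false, a), (true, b) | (true, b), (false, a) =>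
      [|| nonface E a a, edge_cover E b b | a == b]
  end.

Definition sides := [:: false; true].

(** The index [N] stands for any isolated vertex. The tests say that [ft] carries the relation [E0],
    that every code of smaller index left out of [ft] is a loop, and that isolated vertices are
    unrelated to the codes in [ft]. *)
Definition embedding_ok (N : nat) (E E0 : seq (nat * nat)) (ft : seq (bool * nat)) : bool :=
  [&& uniq ft, all (fun p => p.2 < N) ft,
      all (fun a => all (fun b =>
        bier_code_rel E (nth (false, 0) ft a) (nth (false, 0) ft b) == pair_rel E0 a b)
        (iota 0 (size ft))) (iota 0 (size ft)),
      all (fun t => all (fun a => ((t, a) \in ft) ||
        bier_code_rel E (t, a) (t, a)) (iota 0 N)) sides,
      all (fun p => all (fun t => ~~ bier_code_rel E p (t, N)) sides) ft,
      ~~ nonface E N N, ~~ edge_cover E N N & all (fun p => (p.1 < N) && (p.2 < N)) E].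

Variables (m : nat) (h : rel 'I_m) (s : seq 'I_m) (E : seq (nat * nat)).
Hypotheses (us : uniq s) (hE : forall i j, h i j = nonface E (index i s) (index j s)).
Hypothesis bnd : all (fun p => (p.1 < size s) && (p.2 < size s)) E.

Lemma index_eq (i0 : 'I_m) a k : a < size s -> (a == index k s) = (nth i0 s a == k).
Proof.
move=> as_; apply/eqP/eqP => [ak|<-]; last by rewrite index_uniq.
by rewrite ak nth_index // -index_mem -ak.
Qed.

(** Pairs of [h] that are due to a loop are met as soon as the loop is, so testing the listed edges
    suffices. *)
Lemma hits_cover i j : hits h i j = edge_cover E (index i s) (index j s).
Proof.
apply/hitsP/allP => [H [a b] ab /=|H u v].
  have /andP[/= as_ bs] := allP bnd _ ab.
  rewrite !(index_eq i) //; apply: H.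
  by rewrite hE !index_uniq // /nonface /pair_rel ab !orbT.
have sE k l : index k s < size s -> (index k s == index l s) = (k == l).
  by move=> ks; rewrite (index_eq k) // nth_index // -index_mem.
rewrite hE => /or3P[uE|vE|/orP[uvE|vuE]].
- have /andP[/= us' _] := allP bnd _ uE.
  by have := H _ uE; rewrite /= !sE // => /or4P[]->; rewrite ?orbT.
- have /andP[/= vs _] := allP bnd _ vE.
  by have := H _ vE; rewrite /= !sE // => /or4P[]->; rewrite ?orbT.
- have /andP[/= us' vs] := allP bnd _ uvE.
  by have := H _ uvE; rewrite /= !sE.
- have /andP[/= vs us'] := allP bnd _ vuE.
  by have := H _ vuE; rewrite /= !sE // => /or4P[]->; rewrite ?orbT.
Qed.

Definition bier_code (v : 'I_m + 'I_m) : bool * nat :=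
  match v with inl i => (false, index i s) | inr i => (true, index i s) end.

Definition bier_vertex (i0 : 'I_m) (p : bool * nat) : 'I_m + 'I_m :=
  if p.1 then inr (nth i0 s p.2) else inl (nth i0 s p.2).

Lemma bier_vertexK i0 p : p.2 < size s -> bier_code (bier_vertex i0 p) = p.
Proof. by case: p => [[] a] /= as_; rewrite index_uniq. Qed.

Lemma bier_codeK i0 v : (bier_code v).2 < size s -> bier_vertex i0 (bier_code v) = v.
Proof. by case: v => i /=; rewrite index_mem => is_; rewrite /bier_vertex /= nth_index. Qed.

Variable e : rel ('I_m + 'I_m).
Hypotheses (e_sym : symmetric e) (e_ll : forall i j, e (inl i) (inl j) = h i j)
  (e_rr : forall i j, e (inr i) (inr j) = hits h i j)
  (e_lr : forall i j, e (inl i) (inr j) = [|| h i i, hits h j j | i == j]).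

(** The code forgets which isolated vertex is meant; comparing indices is faithful once one of them
    is below [size s]. *)
Lemma bier_codeE v w : (bier_code v).2 < size s ->
  e v w = bier_code_rel E (bier_code v) (bier_code w).
Proof.
have sE k l : index k s < size s -> (index k s == index l s) = (k == l).
  by move=> ks; rewrite (index_eq k) // nth_index // -index_mem.
case: v w => [i|i] [j|j] /= is_; rewrite ?e_ll ?e_rr ?hE ?hits_cover //.
  by rewrite e_lr hE hits_cover sE.
by rewrite e_sym e_lr hE hits_cover [index j s == _]eq_sym sE // (eq_sym i).
Qed.

(** Among non-ghost vertices, the two copies of an isolated vertex are related only to each other.
    These pairs form [cross_rel], enumerated by [io]; the list [ft] supplies the rest. *)
Lemma bier_embedding E0 ft : (exists i : 'I_m, True) -> embedding_ok (size s) E E0 ft ->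
  exists f : ('I_(m - size s) + 'I_(m - size s)) + 'I_(size ft) -> 'I_m + 'I_m,
  [/\ injective f,
      forall x y, e (f x) (f y) =
        sum_rel (@cross_rel (m - size s)) (ord_rel (k := size ft) E0) x y
    & forall v, v \notin codom f -> e v v].
Proof.
move=> [i0 _] /and4P[uft /allP ftN /all_iotaP tab] /and5P[/allP rest /allP iso hN cN _].
pose C := (~: [set i in s])%SET.
have cardC : #|C| = m - size s.
  by rewrite cardsCs finset.setCK cardsE (card_uniqP us) card_ord.
pose io (t : 'I_(m - size s)) : 'I_m := enum_val (cast_ord (esym cardC) t).
have io_inj : injective io by move=> t u /enum_val_inj/cast_ord_inj.
have io_s t : io t \notin s.
  by have := enum_valP (cast_ord (esym cardC) t); rewrite !inE.
have io_idx t : index (io t) s = size s by rewrite memNindex.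
have io_onto i : i \notin s -> exists t, io t = i.
  move=> nis; have iC : i \in C by rewrite !inE.
  exists (cast_ord cardC (enum_rank_in iC i)).
  by rewrite /io cast_ordK enum_rankK_in.
pose f (x : ('I_(m - size s) + 'I_(m - size s)) + 'I_(size ft)) : 'I_m + 'I_m :=
  match x with
  | inl (inl t) => inl (io t)
  | inl (inr t) => inr (io t)
  | inr q => bier_vertex i0 (nth (false, 0) ft q)
  end.
have ftq (q : 'I_(size ft)) : nth (false, 0) ft q \in ft by rewrite mem_nth.
have codeq q : bier_code (f (inr q)) = nth (false, 0) ft q.
  by rewrite bier_vertexK // ftN.
have codel t : bier_code (f (inl t)) = (if t is inl _ then false else true, size s).
  by case: t => t /=; rewrite io_idx.
have eq_f q w : e (f (inr q)) w = bier_code_rel E (nth (false, 0) ft q) (bier_code w).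
  by rewrite bier_codeE codeq // ftN.
have mixed q t : e (f (inr q)) (f (inl t)) = false.
  rewrite eq_f codel; apply/negbTE; have /allP := iso _ (ftq q).
  by apply; case: t; rewrite !inE.
exists f; split.
- move=> x y fxy; have := congr1 bier_code fxy; case: x y fxy => [x|q] [y|r] fxy.
  + case: x y fxy => [t|t] [u|u] //= [/io_inj->] //.
  + rewrite codeq codel => E'; have := ftN _ (ftq r); rewrite -E' /=.
    by rewrite ltnn.
  + rewrite codeq codel => E'; have := ftN _ (ftq q); rewrite E' /=.
    by rewrite ltnn.
  + rewrite !codeq => /eqP; rewrite nth_uniq // => /eqP/val_inj->.
    by [].
- move=> [x|q] [y|r]; last 2 first.
  + exact: mixed.
  + by rewrite eq_f codeq; apply/eqP; have /all_iotaP := tab q; apply.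
  + case: x y => [t|t] [u|u] /=.
    * by rewrite e_ll hE !io_idx (negbTE hN).
    * by rewrite e_lr hE hits_cover !io_idx (negbTE hN) (negbTE cN) (inj_eq io_inj).
    * rewrite e_sym e_lr hE hits_cover !io_idx (negbTE hN) (negbTE cN) (inj_eq io_inj).
      by rewrite eq_sym.
    * by rewrite e_rr hits_cover !io_idx (negbTE cN).
  + by rewrite e_sym mixed.
- move=> v vf; have [vN|vN] := ltnP (bier_code v).2 (size s).
    have side : (bier_code v).1 \in sides by case: (bier_code v).1.
    have /all_iotaP/(_ (Ordinal vN)) := rest _ side.
    rewrite [nat_of_ord _]/(bier_code v).2 -surjective_pairing => /orP[vft|]; last by rewrite bier_codeE.
    have vi : index (bier_code v) ft < size ft by rewrite index_mem.
    case/negP: vf; apply/codomP; exists (inr (Ordinal vi)).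
    by rewrite /= nth_index // bier_codeK.
  case/negP: vf; apply/codomP; case: v vN => i; rewrite /= leqNgt index_mem => /io_onto[t <-].
    by exists (inl (inl t)).
  by exists (inl (inr t)).
Qed.

End Tables.

(** * Models for the nine graphs and the conclusion *)

Section Models.
Local Open Scope classical_set_scope.
Variable R : realType.

Definition listed_type (m d : nat) (P : set 'rV[R]_d) : Prop :=
  [\/ exists n : nat, ((1 < m)%N -> (1 <= n)%N) /\ comb_equiv P (cube R n),
      exists (n : nat) (G : set 'rV[R]_2),
        polygon 5 G /\ comb_equiv P (polytope_prod (cube R n) G),
      exists (n : nat) (G : set 'rV[R]_2),
        polygon 6 G /\ comb_equiv P (polytope_prod (cube R n) G)
    | exists (n : nat) (Q : set 'rV[R]_3),
        Q23 Q /\ comb_equiv P (polytope_prod (cube R n) Q)].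

(** Polytope and building set share one relation, as [comb_equiv_tight] requires; [n] counts the
    isolated vertices. *)
Definition modelled m n k (E : seq (nat * nat)) : Prop :=
  exists (d : nat) (P : set 'rV[R]_d),
    [/\ realizes P (indep (sum_rel (@cross_rel n) (ord_rel (k := k) E))),
        exists n' (B : {set {set 'I_n'.+1}}) s,
          nest_realizes R B s (indep (sum_rel (@cross_rel n) (ord_rel (k := k) E)))
      & listed_type m P].

Lemma nest_cross n' tbl E n : nest_table_ok n'.+1 tbl E ->
  exists n'' (B : {set {set 'I_n''.+1}}) s,
    nest_realizes R B s (indep (sum_rel (@cross_rel n) (ord_rel (k := size tbl) E))).
Proof.
by move=> ok; apply: nest_realizes_cross (nest_realizes_table R ok); exact: ord_rel_sym.
Qed.

(** The nestohedron starts from the empty table on a one-element ground set, that is, from a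
    point. *)
Lemma modelled_cube m n : ((1 < m)%N -> (1 <= n)%N) -> modelled m n 0 [::].
Proof.
move=> mn; exists n, (cube R n); split.
- apply: (realizes_embed (f := inl)) (realizes_cube R n) => //.
    by move=> x y [].
  by move=> [x|[]//]; rewrite codom_f.
- by apply: (@nest_cross 0 [::]); vm_compute.
- by apply: Or41; exists n; split=> //; exact: comb_equiv_refl.
Qed.

(** The extra pair is one more interval factor; [f] makes the coordinate [ord0] play its part. *)
Lemma modelled_cubeS m n : modelled m n 2 [:: (0, 1)%N].
Proof.
exists n.+1, (cube R n.+1); split.
- pose f (x : 'I_n.+1 + 'I_n.+1) : ('I_n + 'I_n) + 'I_2 :=
    match x with
    | inl i => if unlift ord0 i is Some j then inl (inl j) else inr ord0
    | inr i => if unlift ord0 i is Some j then inl (inr j) else inr ord_max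
    end.
  have fl j : f (inl (lift ord0 j)) = inl (inl j) by rewrite /f liftK.
  have fr j : f (inr (lift ord0 j)) = inl (inr j) by rewrite /f liftK.
  have fl0 : f (inl ord0) = inr ord0 by rewrite /f unlift_none.
  have fr0 : f (inr ord0) = inr ord_max by rewrite /f unlift_none.
  apply: (realizes_embed (f := f)) (realizes_cube R n.+1).
  + by move=> [i|i] [j|j]; case: (unliftP ord0 i) => [i' ->|->];
      case: (unliftP ord0 j) => [j' ->|->]; rewrite ?fl ?fr ?fl0 ?fr0 // => -[->].
  + by move=> [i|i] [j|j]; case: (unliftP ord0 i) => [i' ->|->];
      case: (unliftP ord0 j) => [j' ->|->];
      rewrite ?fl ?fr ?fl0 ?fr0 //= ?(inj_eq lift_inj) //.
  + move=> v /negP[]; apply/codomP; case: v => [[j|j]|[[|[|//]] j2]].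
    * by exists (inl (lift ord0 j)).
    * by exists (inr (lift ord0 j)).
    * by exists (inl ord0); rewrite fl0; congr inr; apply/val_inj.
    * by exists (inr ord0); rewrite fr0; congr inr; apply/val_inj.
- by apply: (@nest_cross 1 [:: [:: true; false]; [:: false; true]]); vm_compute.
- by apply: Or41; exists n.+1; split=> //; exact: comb_equiv_refl.
Qed.

Lemma modelled_pentagon m n : modelled m n 5 pentagon_nonedges.
Proof.
exists (n + 2)%N, (polytope_prod (cube R n) (int_polyhedron pentagon_halfspaces)); split.
- exact: realizes_prod (realizes_cube R n) (realizes_pentagon R).
- by apply: (@nest_cross 2 pentagon_nest); vm_compute.
- apply: Or42; exists n, (int_polyhedron pentagon_halfspaces).
  by split; [exact: polygon_pentagon|exact: comb_equiv_refl].
Qed.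

Lemma modelled_hexagon m n : modelled m n 6 hexagon_nonedges.
Proof.
exists (n + 2)%N, (polytope_prod (cube R n) (int_polyhedron hexagon_halfspaces)); split.
- exact: realizes_prod (realizes_cube R n) (realizes_hexagon R).
- by apply: (@nest_cross 2 hexagon_nest); vm_compute.
- apply: Or43; exists n, (int_polyhedron hexagon_halfspaces).
  by split; [exact: polygon_hexagon|exact: comb_equiv_refl].
Qed.

Lemma modelled_two_cuts m n : modelled m n 8 two_cuts_nonedges.
Proof.
exists (n + 3)%N, (polytope_prod (cube R n) (int_polyhedron two_cuts_halfspaces)); split.
- exact: realizes_prod (realizes_cube R n) (realizes_two_cuts R).
- by apply: (@nest_cross 3 two_cuts_nest); vm_compute.
- apply: Or44; exists n, (int_polyhedron two_cuts_halfspaces).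
  by split; [exact: Q23_two_cuts|exact: comb_equiv_refl].
Qed.

Local Notation o := false.
Local Notation o' := true.

(** Each [ft] lists the non-ghost vertices of the Bier sphere of the graph in the order of the
    facets of the model; [o] marks unprimed and [o'] primed ones. *)
Lemma graph_type_modelled m N E : (0 < m)%N -> (N, E) \in graph_types ->
  exists ft E0, embedding_ok N E E0 ft /\ modelled m (m - N) (size ft) E0.
Proof.
move=> m_gt0; rewrite !inE => /or4P[|||/or4P[|||/or3P[]]] /eqP[-> ->].
(* For a single loop both copies of its vertex are ghosts, and the cube has dimension [m - 1]. *)
- exists [::], [::]; split; first by vm_compute.
  by apply: modelled_cube; rewrite subn_gt0.
- exists [:: (o', 0); (o', 1)]%N, [:: (0, 1)]%N; split; first by vm_compute.
  exact: modelled_cubeS.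
- exists [:: (o, 0); (o, 1)]%N, [:: (0, 1)]%N; split; first by vm_compute.
  exact: modelled_cubeS.
- exists [:: (o, 1); (o, 2); (o', 0); (o', 2); (o', 1)]%N, pentagon_nonedges.
  by split; [vm_compute|exact: modelled_pentagon].
- exists [:: (o, 0); (o, 1); (o', 2); (o, 2); (o', 0)]%N, pentagon_nonedges.
  by split; [vm_compute|exact: modelled_pentagon].
- exists [:: (o, 0); (o', 0); (o, 1); (o', 1); (o, 2); (o', 2)]%N, hexagon_nonedges.
  by split; [vm_compute|exact: modelled_hexagon].
- exists [:: (o, 0); (o, 1); (o', 2); (o, 2); (o', 3); (o, 3); (o', 0); (o', 1)]%N,
    two_cuts_nonedges.
  by split; [vm_compute|exact: modelled_two_cuts].
- exists [:: (o', 0); (o, 0); (o, 2); (o, 1); (o', 3); (o', 1); (o', 2); (o, 3)]%N,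
    two_cuts_nonedges.
  by split; [vm_compute|exact: modelled_two_cuts].
- exists [:: (o, 0); (o', 0); (o', 1); (o', 2); (o, 3); (o, 2); (o, 1); (o', 3)]%N,
    two_cuts_nonedges.
  by split; [vm_compute|exact: modelled_two_cuts].
Qed.

(** [P] is used with two complexes: [L] yields the polar dual with the right boundary, [indep e] the
    comparison with the nestohedron. *)
Lemma realizes_conclusion d (P : set 'rV[R]_d) (V J : finType) (L : {set {set V}})
    (e : rel J) n (B : {set {set 'I_n.+1}}) s :
  (0 < #|V|)%N -> simplicial_complex L -> flag_complex L -> realizes P L ->
  realizes P (indep e) -> nest_realizes R B s (indep e) ->
  polytopal R L /\ simple_polytope_of L P /\ flag_polytope P /\ nestohedron P.
Proof.
move=> V0 cL fL PL Pe Be.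
have polP : polytope P by apply: realizes_polytope PL; have [] := cL.
have [Q [Qs Qiso Qdual]] := realizes_dual V0 cL PL.
split; first by exists d, Q.
split; first by split=> //; exists d, Q.
split.
  split=> //; exists d, Q; split=> //.
  exact: complex_iso_flag (complex_iso_sym Qiso) fL.
split=> //; exists n, B; split; first by case: Be.
have [l [b Pt]] := realizes_tight_complex Pe.
exact: comb_equiv_tight Pt (nest_tight_complex Be).
Qed.

Lemma flag_bier_realized m (K : {set {set 'I_m}}) : (0 < m)%N ->
  simplicial_complex K -> K <> [set: {set 'I_m}]%SET -> flag_complex (bier K) ->
  exists (d : nat) (P : set 'rV[R]_d),
    [/\ polytopal R (bier K), simple_polytope_of (bier K) P, flag_polytope P,
        nestohedron P & listed_type m P].
Proof.
move=> m_gt0 cK K_neq fB.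
have [s [E [us [sE hE]]]] := face_classify cK K_neq fB.
have bnd : all (fun p => (p.1 < size s)%N && (p.2 < size s)%N) E.
  have : all (fun t => all (fun p => (p.1 < t.1)%N && (p.2 < t.1)%N) t.2) graph_types by [].
  by move=> /allP/(_ _ sE).
have [ft [E0 [ok [d [P [Pe [n [B [t Be]]] Pm]]]]]] := graph_type_modelled m_gt0 sE.
have [f [finj fe fout]] := bier_embedding us hE bnd (bier_rel_sym K)
  (bier_rel_ll cK K_neq) (fun i j => etrans (bier_rel_rr cK i j) (coface_hits cK K_neq fB i j))
  (fun i j => etrans (bier_rel_lr K i j)
     (congr1 (fun c => [|| face_rel K i i, c | i == j]) (coface_hits cK K_neq fB j j)))
  (ex_intro _ (Ordinal m_gt0) I) ok.
have PB : realizes P (bier K).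
  by rewrite (bier_indep cK K_neq fB); apply: realizes_embed finj fe fout Pe.
have V0 : (0 < #|{: 'I_m + 'I_m}|)%N by rewrite card_sum card_ord addn_gt0 m_gt0.
have [pB [sP [fP nP]]] := realizes_conclusion V0 (bier_complex cK K_neq) fB PB Pe Be.
by exists d, P.
Qed.

(** The two hypotheses provide two simplicial polytopes dual to [P]; these are combinatorially
    equivalent, so flagness passes from one to the other and then to [L]. *)
Lemma simple_flag_polytope d (P : set 'rV[R]_d) (V : finType) (L : {set {set V}}) :
  simple_polytope_of L P -> flag_polytope P -> flag_complex L.
Proof.
move=> [_ [e [Q [[polQ _] isoQ dualQ]]]] [_ [e' [Q' [[polQ' _] dualQ' flagQ']]]].
apply: complex_iso_flag isoQ _; apply: comb_equiv_flag flagQ' => //.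
exact: dual_comb_equiv dualQ dualQ'.
Qed.

End Models.

(* Type (1) with n = 0 (a point) occurs exactly for m = 1, where Bier(K) is the
   (-1)-sphere; for m >= 2 the side condition reads n >= 1. *)
Theorem theorem1p1 (R : realType) (m : nat) (K : {set {set 'I_m}})
    (m_gt0 : (0 < m)%N)
    (cplxK : simplicial_complex K)
    (K_neq : K <> finset.setTfor {set 'I_m}) :
  flag_complex (bier K) <->
  polytopal R (bier K) /\
  exists (d : nat) (P : set 'rV[R]_d),
    simple_polytope_of (bier K) P /\
    flag_polytope P /\
    nestohedron P /\
    [\/ exists n : nat, ((1 < m)%N -> (1 <= n)%N) /\ comb_equiv P (cube R n),
        exists (n : nat) (G : set 'rV[R]_2),
          polygon 5 G /\ comb_equiv P (polytope_prod (cube R n) G),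
        exists (n : nat) (G : set 'rV[R]_2),
          polygon 6 G /\ comb_equiv P (polytope_prod (cube R n) G)
      | exists (n : nat) (Q : set 'rV[R]_3),
          Q23 Q /\ comb_equiv P (polytope_prod (cube R n) Q)].
Proof.
split=> [flagB|[_ [d [P [simP [flagP _]]]]]]; last exact: simple_flag_polytope simP flagP.
have [d [P [polB simP flagP nestP listP]]] := flag_bier_realized R m_gt0 cplxK K_neq flagB.
by split=> //; exists d, P.
Qed.
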